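(* Let $\varphi\in H^\infty\cap C^1(\mathbb T)$ and let $\rho$ be an elliptic analytic automorphism of $\mathbb D$ of (finite) order $q$. Let $\zeta$ be an analytic automorphism of $\mathbb D$ such that $\zeta(\rho(\zeta^{-1}(z)))=\lambda z$ for all $z\in\mathbb D$, for some $\lambda\in\mathbb T$ of order $q$, and let $\overline\tau(z)=\overline\lambda z$. Then the spectrum of the weighted composition operator $W_{\varphi,\rho}$ on $H^2$ is $$\{\mu\in\mathbb C:\ \mu^q\in\operatorname{cl}(\hat\psi(\mathbb D))\},\qquad \psi=\prod_{k=0}^{q-1}(\varphi\circ\zeta^{-1})\circ\overline\tau^{\,k},$$ where $\operatorname{cl}$ denotes closure in $\mathbb C$.
   Context: $\mathbb D$ is the open unit disc and $\mathbb T$ the unit circle. $H^2\subset L^2(\mathbb T)$ is the Hardy space of functions whose Fourier coefficients of negative index vanish, identified as usual with analytic functions on $\mathbb D$ via boundary values; $H^\infty=H^2\cap L^\infty(\mathbb T)$; $C^1(\mathbb T)$ is the space of continuously differentiable functions on $\mathbb T$. Automorphisms of $\mathbb D$ extend to $\mathbb T$, and compositions with them are understood on $\mathbb T$ or $\mathbb D$ accordingly. An automorphism of $\mathbb D$ is elliptic if it has a fixed point in $\mathbb D$; its order is the least $q\ge1$ with $\rho^{q}=\mathrm{id}$ ($q$-fold composition). The order of $\lambda\in\mathbb T$ is the least $q\ge1$ with $\lambda^q=1$. $\overline\tau^{\,k}$ is the $k$-th iterate of $\overline\tau$. The weighted composition operator is $W_{\varphi,\rho}f=\varphi\cdot(f\circ\rho)$,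 $f\in H^2$. For $f\in H^2$, the Gelfand transform is the analytic function on $\mathbb D$ given by $\hat f(z)=\frac1{2\pi}\int_0^{2\pi}\frac{f(e^{i\theta})}{1-ze^{-i\theta}}\,d\theta$, $|z|<1$. *)

(* Defs.v *)
From HB Require Import structures.
From mathcomp Require Import all_boot all_order all_algebra.
From mathcomp Require Import complex.
From mathcomp Require Import all_classical all_reals all_analysis.

Set Implicit Arguments.
Unset Strict Implicit.
Unset Printing Implicit Defensive.

Import Order.TTheory GRing.Theory Num.Theory.
Import numFieldNormedType.Exports.

Local Open Scope classical_set_scope.
Local Open Scope ring_scope.
Local Open Scope complex_scope.
Local Notation normc := ComplexField.Normc.normc.

(* The topology of the complex plane given by the modulus, as for any
   numFieldType. *)
HB.instance Definition _ (R : realType) := NormedModule.copy R[i] R[i]^o.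

Section HardySpace.
Variable R : realType.
Local Notation C := R[i].
Implicit Types (f g : C -> C) (z w a : C) (t : R).

Definition unit_disc : set C := [set z | `|z| < 1].
Definition closed_unit_disc : set C := [set z | `|z| <= 1].

Definition expi t : C := cos t +i* sin t.

(* Functions on the circle are functions f : C -> C of which only the values
   at the points expi t matter; they are integrated in the angle t over
   [0, 2 pi]. *)
Local Notation leb := (@lebesgue_measure R).
Definition angles : set R := `[0, 2 * pi].

Definition circle_mean (h : R -> C) : C :=
  ((2 * pi)^-1 * \int[leb]_(t in angles) complex.Re (h t)) +i*
  ((2 * pi)^-1 * \int[leb]_(t in angles) complex.Im (h t)).

Definition eq_circle f g : Prop :=
  {ae leb, forall t, angles t -> f (expi t) = g (expi t)}.

Definition L2_circle f : Prop :=
  [/\ measurable_fun angles (fun t => complex.Re (f (expi t))),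
      measurable_fun angles (fun t => complex.Im (f (expi t))) &
      (\int[leb]_(t in angles) (normc (f (expi t)) ^+ 2)%:E < +oo)%E].

Definition L2_norm f : R :=
  Num.sqrt ((2 * pi)^-1 * \int[leb]_(t in angles) (normc (f (expi t)) ^+ 2)).

Definition fourier_coef f (n : int) : C :=
  circle_mean (fun t => f (expi t) * expi (- (n%:~R * t))).

Definition H2 f : Prop :=
  L2_circle f /\ forall n : int, n < 0 -> fourier_coef f n = 0.

Definition Linfty_circle f : Prop :=
  exists M : R, {ae leb, forall t, angles t -> normc (f (expi t)) <= M}.

Definition Hinfty f : Prop := H2 f /\ Linfty_circle f.

Definition C1_real (u : R -> R) : Prop :=
  (forall t, derivable u t 1) /\ continuous (derive1 u).

Definition C1_circle f : Prop :=
  C1_real (fun t => complex.Re (f (expi t))) /\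
  C1_real (fun t => complex.Im (f (expi t))).

Definition gelfand f z : C :=
  circle_mean (fun t => f (expi t) / (1 - z * expi (- t))).

(* Elements of H2 are classes of functions modulo eq_circle.  A bounded linear
   operator on H2 is given on representatives; linearity holds almost
   everywhere, and compatibility with eq_circle follows from linearity and
   boundedness. *)
Definition bounded_operator (S : (C -> C) -> (C -> C)) : Prop :=
  [/\ forall f, H2 f -> H2 (S f),
      forall a f g, H2 f -> H2 g ->
        eq_circle (S (fun z => a * f z + g z)) (fun z => a * S f z + S g z) &
      exists M : R, forall f, H2 f -> L2_norm (S f) <= M * L2_norm f].

(* For a bounded operator T on H2: mu is in the spectrum when mu - T has no
   two-sided inverse among the bounded operators on H2. *)
Definition spectrum (T : (C -> C) -> (C -> C)) : set C :=
  [set mu | ~ exists S : (C -> C) -> (C -> C),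
    [/\ bounded_operator S,
        forall f, H2 f -> eq_circle (S (fun z => mu * f z - T f z)) f &
        forall f, H2 f -> eq_circle (fun z => mu * S f z - T (S f) z) f]].

Definition weighted_composition (phi rho : C -> C) : (C -> C) -> (C -> C) :=
  fun f z => phi z * f (rho z).

Definition analytic_on (D : set C) f : Prop :=
  forall z0, D z0 -> exists r : R, 0 < r /\ exists c : nat -> C,
    forall z, `|z - z0| < r%:C ->
      (fun N => \sum_(0 <= k < N) c k * (z - z0) ^+ k) @ \oo --> f z.

(* An analytic automorphism of the open disc with its inverse, both taken with
   their (unique) continuous extensions to the closed disc; values outside the
   closed disc are irrelevant. *)
Record disc_aut := DiscAut {
  aut_fun :> C -> C;
  aut_inv : C -> C;
  aut_fun_disc : forall z, unit_disc z -> unit_disc (aut_fun z);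
  aut_inv_disc : forall z, unit_disc z -> unit_disc (aut_inv z);
  aut_funK : forall z, unit_disc z -> aut_inv (aut_fun z) = z;
  aut_invK : forall z, unit_disc z -> aut_fun (aut_inv z) = z;
  aut_fun_analytic : analytic_on unit_disc aut_fun;
  aut_inv_analytic : analytic_on unit_disc aut_inv;
  aut_fun_cont : {within closed_unit_disc, continuous aut_fun};
  aut_inv_cont : {within closed_unit_disc, continuous aut_inv} }.

Definition elliptic (rho : disc_aut) : Prop :=
  exists z, unit_disc z /\ rho z = z.

Definition aut_order (rho : disc_aut) (q : nat) : Prop :=
  [/\ (0 < q)%N,
      forall z, unit_disc z -> iter q rho z = z &
      forall m, (0 < m < q)%N -> ~ forall z, unit_disc z -> iter m rho z = z].

End HardySpace.

(* Main.v *)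
Require Import Defs.
From HB Require Import structures.
From mathcomp Require Import all_boot all_order all_algebra.
From mathcomp Require Import complex.
From mathcomp Require Import all_classical all_reals all_analysis.
From mathcomp Require Import measurable_realfun ring lra.

(** The operator W f = phi (f o rho) is a weighted shift along the orbits of
    rho.  Let Psi be the product of the functions phi o rho^k for k < q.  As
    rho^q is the identity, W^q is multiplication by Psi, which is invariant
    under rho.  The automorphism zeta turns rho into the rotation by lambda, and
    on the circle psi = Psi o zeta^-1 because the powers of lambda and of its
    conjugate are the same roots of unity ([psi_orbit_prod]); so the Gelfand
    transforms of psi and Psi have the same range on the disc.

    If mu^q is at a positive distance from that range, then 1 / (mu^q - Psi) is a
    uniform limit of polynomials on the circle ([circle_alg_inv]).  It commutes
    with W, and its product with the sum of the mu^(q-1-j) W^j is a bounded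
    inverse of mu - W ([resolvent_exists]).

    Conversely take a point w of the disc with q distinct points w_k = rho^k(w) in
    its orbit.  The value of W f at w_k is phi(w_k) f(w_(k+1)), so the adjoint of
    W acts on the span of the evaluations at the w_k as a weighted
    cyclic shift whose weights have product Psi(w).  Every q-th root mu' of Psi(w)
    thus has an eigenfunctional L, with L(W f) = mu' L(f)
    ([cyclic_eigenvector]).  A bounded inverse of mu - W, for mu close enough to
    mu', would force L to vanish ([eigenfunctional_spectrum]); as Psi(w) may be
    taken arbitrarily close to any point of the closure of the range, this
    closure consists of q-th powers of points of the spectrum, with all their
    roots.

    Three facts of function theory support this.  The Poisson kernel is an
    approximate identity ([poisson_approx]), hence a continuous function on the
    circle without negative Fourier coefficients is a uniform limit of
    polynomials ([circle_alg_moments]); such functions multiply the Hardy space,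
    and the Gelfand transform is multiplicative ([H2M], [gelfandM]).  A function
    analytic in the disc and continuous on the closed disc, such as an
    automorphism, equals its Poisson integral by the maximum principle and
    therefore has no negative Fourier coefficient ([analytic_disc_alg]).
    Finally, for an automorphism a, the mean of u o a is the mean of u against
    the Poisson kernel at a(0): the mean value property gives this for real
    parts of polynomials, and uniqueness of measures extends it to Borel
    functions ([circle_transport]).  Composition with a is thus bounded in the
    square mean; it preserves the Hardy space and commutes with the Gelfand
    transform ([H2_aut], [gelfand_comp_aut]). *)

Set Implicit Arguments.
Unset Strict Implicit.
Unset Printing Implicit Defensive.
Import Order.TTheory GRing.Theory Num.Theory.
Import numFieldNormedType.Exports.
Local Open Scope classical_set_scope.
Local Open Scope ring_scope.
Local Open Scope complex_scope.

Local Notation Re := complex.Re.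
Local Notation Im := complex.Im.
Local Notation normc := ComplexField.Normc.normc.
(** * The modulus as a real number, and the parametrization of the circle *)

Section Modulus.
Local Notation "z ^*" := (conjc z) : ring_scope.
Variable R : realType.
Implicit Types (z w : R[i]) (t : R).

Lemma normc_norm z : `|z| = (normc z)%:C. Proof. by []. Qed.

Lemma normc0 : normc (0 : R[i]) = 0.
Proof. exact: ComplexField.Normc.normc0. Qed.

Lemma normc_ge0 z : 0 <= normc z.
Proof. by case: z => a b; exact: sqrtr_ge0. Qed.

Lemma normc_eq0 z : (normc z == 0) = (z == 0).
Proof.
apply/eqP/eqP => [|->]; first exact: ComplexField.Normc.eq0_normc.
exact: normc0.
Qed.

Lemma normc_gt0 z : (0 < normc z) = (z != 0).
Proof. by rewrite lt_def normc_ge0 andbT normc_eq0. Qed.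

Lemma normc_sqr z : normc z ^+ 2 = Re z ^+ 2 + Im z ^+ 2.
Proof. by case: z => a b /=; rewrite sqr_sqrtr// addr_ge0 ?sqr_ge0. Qed.

Lemma normcM z w : normc (z * w) = normc z * normc w.
Proof. exact: ComplexField.Normc.normcM. Qed.

Lemma normcV z : normc z^-1 = (normc z)^-1.
Proof. exact: ComplexField.Normc.normcV. Qed.

Lemma normc1 : normc (1 : R[i]) = 1.
Proof. exact: ComplexField.Normc.normc1. Qed.

Lemma normcX z n : normc (z ^+ n) = normc z ^+ n.
Proof. by elim: n => [|n IH]; rewrite ?expr0 ?normc1// !exprS normcM IH. Qed.

Lemma normcJ z : normc z^* = normc z.
Proof. by case: z => a b /=; rewrite sqrrN. Qed.

Lemma normc_real (x : R) : normc x%:C = `|x|.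
Proof. by rewrite /normc /= expr0n /= addr0 sqrtr_sqr. Qed.

Lemma normcB z w : normc (z - w) = normc (w - z).
Proof. by rewrite -normcN opprB. Qed.

Lemma le_normc_sub z w : normc z - normc w <= normc (z - w).
Proof. by rewrite lerBlDr; have := le_normcD (z - w) w; rewrite subrK. Qed.

Lemma le_normcB z w : normc (z - w) <= normc z + normc w.
Proof. by rewrite (le_trans (le_normcD _ _))// normcN. Qed.

Lemma le_normc_trans z w u : normc (z - u) <= normc (z - w) + normc (w - u).
Proof. by have := le_normcD (z - w) (w - u); rewrite addrA subrK. Qed.

Lemma le_Re_normc z : `|Re z| <= normc z.
Proof.
rewrite -(@ler_pXn2r _ 2) ?nnegrE ?normc_ge0//.
by rewrite normc_sqr real_normK ?num_real// lerDl sqr_ge0.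
Qed.

Lemma le_Im_normc z : `|Im z| <= normc z.
Proof.
rewrite -(@ler_pXn2r _ 2) ?nnegrE ?normc_ge0//.
by rewrite normc_sqr real_normK ?num_real// lerDr sqr_ge0.
Qed.

Lemma le_normc_ReIm z : normc z <= `|Re z| + `|Im z|.
Proof.
rewrite -(@ler_pXn2r _ 2) ?nnegrE ?normc_ge0 ?addr_ge0//.
rewrite normc_sqr sqrrD !real_normK ?num_real//.
by rewrite addrAC lerDl mulrn_wge0// mulr_ge0.
Qed.

Lemma cReD z w : Re (z + w) = Re z + Re w. Proof. by case: z; case: w. Qed.
Lemma cImD z w : Im (z + w) = Im z + Im w. Proof. by case: z; case: w. Qed.
Lemma cReN z : Re (- z) = - Re z. Proof. by case: z. Qed.
Lemma cImN z : Im (- z) = - Im z. Proof. by case: z. Qed.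
Lemma cReM z w : Re (z * w) = Re z * Re w - Im z * Im w.
Proof. by case: z; case: w. Qed.
Lemma cImM z w : Im (z * w) = Re z * Im w + Im z * Re w.
Proof. by case: z => a b; case: w => c d /=; rewrite addrC. Qed.
Lemma cReJ z : Re z^* = Re z. Proof. by case: z. Qed.
Lemma cImJ z : Im z^* = - Im z. Proof. by case: z. Qed.

Lemma complex_eqP z w : Re z = Re w -> Im z = Im w -> z = w.
Proof. by case: z => a b; case: w => c d /= -> ->. Qed.

Lemma mulcJ z : z * z^* = (normc z ^+ 2)%:C.
Proof.
by rewrite normc_sqr; case: z => a b; apply: complex_eqP => /=; ring.
Qed.

Lemma conjcM z w : (z * w)^* = z^* * w^*. Proof. exact: rmorphM. Qed.
Lemma unit_discE z : unit_disc z <-> normc z < 1.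
Proof. by rewrite /unit_disc /= normc_norm -ltcR. Qed.

Lemma closed_unit_discE z : closed_unit_disc z <-> normc z <= 1.
Proof. by rewrite /closed_unit_disc /= normc_norm -lecR. Qed.

Lemma normc_expi t : normc (expi t) = 1.
Proof. by rewrite /expi /= cos2Dsin2 sqrtr1. Qed.

Lemma expiN t : expi (- t) = (expi t)^*.
Proof. by rewrite /expi cosN sinN. Qed.

Lemma expiD s t : expi (s + t) = expi s * expi t.
Proof.
by apply: complex_eqP => /=; rewrite ?cosD ?sinD //; ring.
Qed.

Lemma expi0 : expi 0 = 1 :> R[i].
Proof. by rewrite /expi cos0 sin0. Qed.

Lemma expiMn t n : expi (n%:R * t) = expi t ^+ n.
Proof.
elim: n => [|n IH]; first by rewrite mul0r expi0 expr0.
by rewrite -natr1 mulrDl mul1r expiD IH exprSr.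
Qed.

Lemma expi2pi : expi (2 * pi) = 1 :> R[i].
Proof.
by rewrite /expi mulr_natl cos2pi sin2pi.
Qed.

Lemma conjc_circle z : normc z = 1 -> z^* = z^-1.
Proof.
move=> z1; have z0 : z != 0 by rewrite -normc_gt0 z1.
by apply: (mulfI z0); rewrite mulcJ z1 expr1n divff.
Qed.

Lemma circle_neq0 z : normc z = 1 -> z != 0.
Proof. by move=> z1; rewrite -normc_gt0 z1. Qed.

(** The angle is an arccosine of the real part on the upper half circle, and
    the opposite of one, shifted by a period, on the lower half. *)
Lemma circle_expi z : normc z = 1 ->
  exists2 t, 0 <= t < 2 * pi & z = expi t.
Proof.
move=> z1; have := normc_sqr z; rewrite z1 expr1n => sq.
have Re1 : -1 <= Re z <= 1 by rewrite -ler_norml -z1 le_Re_normc.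
have a0 := acos_ge0 Re1; have api := acos_lepi Re1.
have cosa : cos (acos (Re z)) = Re z by rewrite acosK// in_itv.
have sina : sin (acos (Re z)) = `|Im z|.
  by rewrite sin_acos// -sqrtr_sqr; congr Num.sqrt; rewrite sq; ring.
have pi0 := pi_gt0 R.
have [I0|I0] := lerP 0 (Im z).
  exists (acos (Re z)); first by rewrite a0 /=; lra.
  by apply: complex_eqP => /=; rewrite ?cosa ?sina ?ger0_norm.
exists (2 * pi - acos (Re z)).
  rewrite ltrBlDr ltrDl lt_def a0 andbT subr_ge0; apply/andP; split; first lra.
  apply/eqP => a00; move: sina; rewrite a00 sin0 => /esym/eqP.
  by rewrite normr_eq0 => /eqP Iz0; rewrite Iz0 ltxx in I0.
rewrite expiD expi2pi mul1r expiN.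
by apply: complex_eqP => /=; rewrite ?cosa ?sina ?ltr0_norm ?opprK.
Qed.

Lemma expi_inj s t : 0 <= s < 2 * pi -> 0 <= t < 2 * pi ->
  expi s = expi t -> s = t.
Proof.
wlog st : s t / s <= t => [H|].
  have [st|/ltW ts] := lerP s t; first exact: H.
  by move=> hs ht st; symmetry; apply: H.
move=> /andP[s0 s2] /andP[t0 t2] E; apply/eqP/negPn/negP => neq.
have {neq}st : s < t by rewrite lt_def eq_sym neq.
have : expi (t - s) = 1.
  by rewrite expiD expiN -E conjc_circle ?normc_expi// divff ?circle_neq0 ?normc_expi.
move=> /(congr1 (@complex.Re R)) /=.
have -> : t - s = ((t - s) / 2) *+ 2 by rewrite -mulr_natr divfK.
rewrite cos_mulr2n cos2sin2.
have : 0 < sin ((t - s) / 2).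
  apply: sin_gt0_pi; apply/andP; split; first by rewrite divr_gt0// subr_gt0.
  by rewrite ltr_pdivrMr// mulrC; lra.
move=> s_gt0; have := exprn_gt0 2 s_gt0; rewrite mulr2n; lra.
Qed.

End Modulus.

(** * Means over the circle *)

Section Means.
Local Notation "z ^*" := (conjc z) : ring_scope.
Variable R : realType.
Implicit Types (z w c : R[i]) (u v : R[i] -> R) (F G : R[i] -> R[i]).
Local Notation leb := (@lebesgue_measure R).
Local Notation angles := (@angles R).

(** Functions are taken on the circle rather than on the interval of angles, so
    that they can be composed with maps of the circle; only their values there
    matter. *)
Definition rmean u : R := (2 * pi)^-1 * \int[leb]_(t in angles) u (expi t).

Definition cmean F : R[i] := circle_mean (fun t => F (expi t)).

Definition rmeas u : Prop := measurable_fun angles (fun t => u (expi t)).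

Definition rint u : Prop := leb.-integrable angles (EFin \o (fun t => u (expi t))).

Definition rcont u : Prop := continuous (fun t : R => u (expi t)).

Definition cmeas F : Prop := rmeas (fun z => Re (F z)) /\ rmeas (fun z => Im (F z)).

Definition cint F : Prop := rint (fun z => Re (F z)) /\ rint (fun z => Im (F z)).

Definition ccont F : Prop := rcont (fun z => Re (F z)) /\ rcont (fun z => Im (F z)).

Lemma twopi_gt0 : 0 < 2 * pi :> R.
Proof. by rewrite mulr_gt0// pi_gt0. Qed.

Lemma measurable_angles : measurable (angles : set (measurableTypeR R)).
Proof. exact: measurable_itv. Qed.

Lemma angles_measure : leb angles = (2 * pi)%:E.
Proof.
by rewrite /angles lebesgue_measure_itv /= lte_fin twopi_gt0 oppr0 addr0.
Qed.

Lemma eq_rmean u v : (forall z, normc z = 1 -> u z = v z) -> rmean u = rmean v.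
Proof.
move=> uv; congr (_ * _); apply: eq_Rintegral => t _.
by apply: uv; rewrite normc_expi.
Qed.

Lemma eq_cmean F G : (forall z, normc z = 1 -> F z = G z) -> cmean F = cmean G.
Proof.
move=> FG; have E t : F (expi t) = G (expi t) by apply: FG; rewrite normc_expi.
by rewrite /cmean; congr circle_mean; apply/funext.
Qed.

Lemma eq_rmeas u v : (forall z, normc z = 1 -> u z = v z) -> rmeas u -> rmeas v.
Proof.
move=> uv; rewrite /rmeas; suff -> : (fun t => u (expi t)) = (fun t => v (expi t)) by [].
by apply/funext => t; apply: uv; rewrite normc_expi.
Qed.

Lemma eq_rint u v : (forall z, normc z = 1 -> u z = v z) -> rint u -> rint v.
Proof.
move=> uv; rewrite /rint; suff -> : (fun t => u (expi t)) = (fun t => v (expi t)) by [].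
by apply/funext => t; apply: uv; rewrite normc_expi.
Qed.

Lemma eq_cmeas F G : (forall z, normc z = 1 -> F z = G z) -> cmeas F -> cmeas G.
Proof.
by move=> FG [F1 F2]; split; [apply: eq_rmeas F1|apply: eq_rmeas F2] => z z1; rewrite FG.
Qed.

Lemma eq_cint F G : (forall z, normc z = 1 -> F z = G z) -> cint F -> cint G.
Proof.
by move=> FG [F1 F2]; split; [apply: eq_rint F1|apply: eq_rint F2] => z z1; rewrite FG.
Qed.

Lemma rint_meas u : rint u -> rmeas u.
Proof. by move=> /integrableP[/measurable_EFinP]. Qed.

Lemma rmean_cst (x : R) : rmean (fun=> x) = x.
Proof.
rewrite /rmean Rintegral_cst; last exact: measurable_angles.
rewrite (_ : fine _ = 2 * pi); last exact: (congr1 fine angles_measure).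
by rewrite mulrCA mulVf ?mulr1// gt_eqF ?twopi_gt0.
Qed.

Lemma rint_cst (x : R) : rint (fun=> x).
Proof.
apply/integrableP; split; first exact/measurable_EFinP.
rewrite (eq_integral (fun=> `|x|%:E))// integral_cst; last exact: measurable_angles.
rewrite (_ : (_ * _)%E = `|x|%:E * (2 * pi)%:E)%E; last first.
  by congr (_ * _)%E; exact: angles_measure.
by rewrite -EFinM ltry.
Qed.

Lemma rintD u v : rint u -> rint v -> rint (fun z => u z + v z).
Proof. by move=> iu iv; exact: (integrableD measurable_angles iu iv). Qed.

Lemma rmeanD u v : rint u -> rint v ->
  rmean (fun z => u z + v z) = rmean u + rmean v.
Proof.
by move=> iu iv; rewrite /rmean RintegralD ?mulrDr//; exact: measurable_angles.
Qed.

Lemma rintZ (x : R) u : rint u -> rint (fun z => x * u z).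
Proof. by move=> iu; exact: (integrableZl measurable_angles x iu). Qed.

Lemma rmeanZ (x : R) u : rint u -> rmean (fun z => x * u z) = x * rmean u.
Proof.
move=> iu; rewrite /rmean [RHS]mulrCA; congr (_ * _).
exact: (RintegralZl x measurable_angles iu).
Qed.

Lemma rintN u : rint u -> rint (fun z => - u z).
Proof.
by move=> iu; apply: eq_rint (rintZ (-1) iu) => z _; rewrite mulN1r.
Qed.

Lemma rmeanN u : rint u -> rmean (fun z => - u z) = - rmean u.
Proof.
by move=> iu; rewrite -mulN1r -rmeanZ//; apply: eq_rmean => z _; rewrite mulN1r.
Qed.

Lemma le_rmean u v : rint u -> rint v ->
  (forall z, normc z = 1 -> u z <= v z) -> rmean u <= rmean v.
Proof.
move=> iu iv uv; rewrite /rmean ler_pM2l ?invr_gt0 ?twopi_gt0//.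
apply: le_Rintegral => //; first exact: measurable_angles.
by move=> t _; apply: uv; rewrite normc_expi.
Qed.

Lemma rmean_ge0 u : (forall z, normc z = 1 -> 0 <= u z) -> 0 <= rmean u.
Proof.
move=> u0; rewrite /rmean mulr_ge0 ?invr_ge0 ?(ltW twopi_gt0)//.
by apply: Rintegral_ge0 => t _; apply: u0; rewrite normc_expi.
Qed.

Lemma le_rint u v : rmeas u -> rint v ->
  (forall z, normc z = 1 -> `|u z| <= v z) -> rint u.
Proof.
move=> mu iv uv; apply: le_integrable iv => //; first exact: measurable_angles.
  exact/measurable_EFinP.
move=> t _ /=; rewrite lee_fin.
by apply: (le_trans (uv _ (normc_expi t))); exact: ler_norm.
Qed.

Lemma rmeasD u v : rmeas u -> rmeas v -> rmeas (fun z => u z + v z).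
Proof. exact: measurable_funD. Qed.

Lemma rmeasB u v : rmeas u -> rmeas v -> rmeas (fun z => u z - v z).
Proof. exact: measurable_funB. Qed.

Lemma rmeasM u v : rmeas u -> rmeas v -> rmeas (fun z => u z * v z).
Proof. exact: measurable_funM. Qed.

Lemma rmeas_sqrt u : rmeas u -> rmeas (fun z => Num.sqrt (u z)).
Proof.
move=> mu; apply: (@measurableT_comp _ _ _ _ _ _ (@Num.sqrt R)) => //.
by apply: continuous_measurable_fun; exact: sqrt_continuous.
Qed.

Lemma rcont_meas u : rcont u -> rmeas u.
Proof. by move=> cu; apply: measurable_funTS; exact: continuous_measurable_fun. Qed.

Lemma rcont_bounded u : rcont u -> exists2 B, 0 <= B & forall z, normc z = 1 -> `|u z| <= B.
Proof.
move=> cu; have : {within `[0, 2 * pi], continuous (fun t : R => `|u (expi t)|)}.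
  apply: continuous_subspaceT => t; apply: (@cvg_norm _ _ _ _ _ (fun t => u (expi t))).
  exact: cu.
move=> /(EVT_max (ltW twopi_gt0))[t0 _ tmax].
exists `|u (expi t0)| => // z /circle_expi[t /andP[t1 t2] ->].
by apply: tmax; rewrite in_itv /= t1 ltW.
Qed.

Lemma rint_bounded u B : rmeas u -> (forall z, normc z = 1 -> `|u z| <= B) -> rint u.
Proof. by move=> mu uB; apply: le_rint (rint_cst B) _. Qed.

Lemma rcont_int u : rcont u -> rint u.
Proof.
move=> cu; have [B _ uB] := rcont_bounded cu.
by apply: rint_bounded uB; exact: rcont_meas.
Qed.

Lemma rintM u v B : rint u -> rmeas v -> (forall z, normc z = 1 -> `|v z| <= B) ->
  rint (fun z => v z * u z).
Proof.
move=> iu mv vB.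
have iau : rint (fun z => B * `|u z|).
  apply: rintZ; exact: (integrable_norm iu).
apply: le_rint iau _ => [|z z1]; first by apply: rmeasM => //; exact: rint_meas.
by rewrite normrM ler_wpM2r// vB.
Qed.

Lemma cint_meas F : cint F -> cmeas F.
Proof. by move=> [? ?]; split; exact: rint_meas. Qed.

Lemma cmeas_cst c : cmeas (fun=> c).
Proof. by split; exact: measurable_cst. Qed.

Lemma cmeasD F G : cmeas F -> cmeas G -> cmeas (fun z => F z + G z).
Proof.
move=> [F1 F2] [G1 G2]; split.
  by apply: eq_rmeas (rmeasD F1 G1) => z _; rewrite cReD.
by apply: eq_rmeas (rmeasD F2 G2) => z _; rewrite cImD.
Qed.

Lemma cmeasM F G : cmeas F -> cmeas G -> cmeas (fun z => F z * G z).
Proof.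
move=> [F1 F2] [G1 G2]; split.
  by apply: eq_rmeas (rmeasB (rmeasM F1 G1) (rmeasM F2 G2)) => z _; rewrite cReM.
by apply: eq_rmeas (rmeasD (rmeasM F1 G2) (rmeasM F2 G1)) => z _; rewrite cImM.
Qed.

Lemma cmeas_normc F : cmeas F -> rmeas (fun z => normc (F z)).
Proof.
move=> [F1 F2].
apply: eq_rmeas (rmeas_sqrt (rmeasD (rmeasM F1 F1) (rmeasM F2 F2))) => z _.
by rewrite -!expr2 -normc_sqr sqrtr_sqr ger0_norm ?normc_ge0.
Qed.

Lemma cmeas_normc_sqr F : cmeas F -> rmeas (fun z => normc (F z) ^+ 2).
Proof. by move=> /cmeas_normc mF; apply: eq_rmeas (rmeasM mF mF) => z _; rewrite expr2. Qed.

Lemma cint_normc F : cint F -> rint (fun z => normc (F z)).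
Proof.
move=> iF; have [F1 F2] := iF.
have G1 := integrable_norm F1; have G2 := integrable_norm F2.
have iN : rint (fun z => `|Re (F z)| + `|Im (F z)|) by apply: rintD.
apply: le_rint iN _ => [|z _]; first by apply: cmeas_normc; exact: cint_meas.
by rewrite ger0_norm ?normc_ge0// le_normc_ReIm.
Qed.

Lemma le_cint F u : cmeas F -> rint u ->
  (forall z, normc z = 1 -> normc (F z) <= u z) -> cint F.
Proof.
move=> [F1 F2] iu Fu; split; apply: (le_rint _ iu) => // z z1.
  by apply: le_trans (Fu _ z1); exact: le_Re_normc.
by apply: le_trans (Fu _ z1); exact: le_Im_normc.
Qed.

Lemma cintM F G B : cint F -> cmeas G -> (forall z, normc z = 1 -> normc (G z) <= B) ->
  cint (fun z => G z * F z).
Proof.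
move=> iF mG GB; apply: (@le_cint _ (fun z => B * normc (F z))).
- by apply: cmeasM => //; exact: cint_meas.
- by apply: rintZ; exact: cint_normc.
- by move=> z z1; rewrite normcM ler_wpM2r ?normc_ge0// GB.
Qed.

Lemma cint_cst c : cint (fun=> c).
Proof. by split; exact: rint_cst. Qed.

Lemma cintD F G : cint F -> cint G -> cint (fun z => F z + G z).
Proof.
move=> [F1 F2] [G1 G2]; split.
  by apply: eq_rint (rintD F1 G1) => z _; rewrite cReD.
by apply: eq_rint (rintD F2 G2) => z _; rewrite cImD.
Qed.

Lemma cintZ c F : cint F -> cint (fun z => c * F z).
Proof. by move=> iF; apply: (cintM iF (cmeas_cst c)) => z _; exact: lexx. Qed.

Lemma cintN F : cint F -> cint (fun z => - F z).
Proof. by move=> iF; apply: eq_cint (cintZ (-1) iF) => z _; rewrite mulN1r. Qed.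

Lemma cintB F G : cint F -> cint G -> cint (fun z => F z - G z).
Proof. by move=> iF /cintN; exact: cintD. Qed.

Lemma Re_cmean F : Re (cmean F) = rmean (fun z => Re (F z)).
Proof. by []. Qed.

Lemma Im_cmean F : Im (cmean F) = rmean (fun z => Im (F z)).
Proof. by []. Qed.

Lemma cmean_cst c : cmean (fun=> c) = c.
Proof. by apply: complex_eqP; rewrite ?Re_cmean ?Im_cmean rmean_cst. Qed.

Lemma cmeanD F G : cint F -> cint G -> cmean (fun z => F z + G z) = cmean F + cmean G.
Proof.
move=> [F1 F2] [G1 G2]; apply: complex_eqP.
  by rewrite cReD !Re_cmean -rmeanD//; apply: eq_rmean => z _; rewrite cReD.
by rewrite cImD !Im_cmean -rmeanD//; apply: eq_rmean => z _; rewrite cImD.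
Qed.

Lemma cmeanZ c F : cint F -> cmean (fun z => c * F z) = c * cmean F.
Proof.
move=> [F1 F2]; have Z (x : R) := rintZ x F1; have Y (x : R) := rintZ x F2.
apply: complex_eqP.
  rewrite cReM !Re_cmean !Im_cmean -!rmeanZ// -rmeanN// -rmeanD//; last exact: rintN.
  by apply: eq_rmean => z _; rewrite cReM.
rewrite cImM !Re_cmean !Im_cmean -!rmeanZ// -rmeanD//.
by apply: eq_rmean => z _; rewrite cImM.
Qed.

Lemma cmeanN F : cint F -> cmean (fun z => - F z) = - cmean F.
Proof. by move=> iF; rewrite -mulN1r -cmeanZ//; apply: eq_cmean => z _; rewrite mulN1r. Qed.

Lemma cmeanB F G : cint F -> cint G -> cmean (fun z => F z - G z) = cmean F - cmean G.
Proof. by move=> iF iG; rewrite cmeanD ?cmeanN//; exact: cintN. Qed.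

Lemma cmeanJ F : cint F -> cmean (fun z => (F z)^*) = (cmean F)^*.
Proof.
move=> [F1 F2]; apply: complex_eqP.
  by rewrite cReJ !Re_cmean; apply: eq_rmean => z _; rewrite cReJ.
by rewrite cImJ !Im_cmean -rmeanN//; apply: eq_rmean => z _; rewrite cImJ.
Qed.

(** Multiplying by the conjugate of the mean turns the modulus of the mean into
    the mean of a real part. *)
Lemma le_normc_cmean F : cint F -> normc (cmean F) <= rmean (fun z => normc (F z)).
Proof.
move=> iF; have [->|m0] := eqVneq (cmean F) 0.
  by rewrite normc0; apply: rmean_ge0 => z _; exact: normc_ge0.
have n0 : 0 < normc (cmean F) by rewrite normc_gt0.
rewrite -(ler_pM2l n0) -expr2.
have -> : normc (cmean F) ^+ 2 = rmean (fun z => Re ((cmean F)^* * F z)).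
  by rewrite -Re_cmean cmeanZ// mulrC mulcJ.
rewrite -rmeanZ; last exact: cint_normc.
apply: le_rmean.
- by case: (cintZ (cmean F)^* iF).
- by apply: rintZ; exact: cint_normc.
- move=> z _; apply: (le_trans (ler_norm _)).
  by rewrite (le_trans (le_Re_normc _))// normcM normcJ.
Qed.

Lemma ccont_meas F : ccont F -> cmeas F.
Proof. by move=> [? ?]; split; exact: rcont_meas. Qed.

Lemma ccont_int F : ccont F -> cint F.
Proof. by move=> [? ?]; split; exact: rcont_int. Qed.

Lemma ccont_bounded F : ccont F ->
  exists2 B, 0 <= B & forall z, normc z = 1 -> normc (F z) <= B.
Proof.
move=> [/rcont_bounded[B1 B10 HB1] /rcont_bounded[B2 B20 HB2]].
exists (B1 + B2) => [|z z1]; first exact: addr_ge0.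
by apply: (le_trans (le_normc_ReIm _)); rewrite lerD ?HB1 ?HB2.
Qed.

Lemma rcontD u v : rcont u -> rcont v -> rcont (fun z => u z + v z).
Proof. by move=> cu cv t; apply: cvgD; [exact: cu|exact: cv]. Qed.

Lemma rcontB u v : rcont u -> rcont v -> rcont (fun z => u z - v z).
Proof. by move=> cu cv t; apply: cvgB; [exact: cu|exact: cv]. Qed.

Lemma rcontN u : rcont u -> rcont (fun z => - u z).
Proof. by move=> cu t; apply: cvgN; exact: cu. Qed.

Lemma rcontM u v : rcont u -> rcont v -> rcont (fun z => u z * v z).
Proof. by move=> cu cv t; apply: cvgM; [exact: cu|exact: cv]. Qed.

Lemma rcontV u : rcont u -> (forall z, normc z = 1 -> u z != 0) ->
  rcont (fun z => (u z)^-1).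
Proof. by move=> cu u0 t; apply: cvgV; [apply: u0; rewrite normc_expi|exact: cu]. Qed.

Lemma rcont_cst (x : R) : rcont (fun=> x).
Proof. by move=> t; exact: cvg_cst. Qed.

Lemma ccont_cst c : ccont (fun=> c).
Proof. by split; exact: rcont_cst. Qed.

Lemma ccont_id : ccont id.
Proof. by split => t; [exact: continuous_cos|exact: continuous_sin]. Qed.

Lemma eq_rcont u v : (forall z, normc z = 1 -> u z = v z) -> rcont u -> rcont v.
Proof.
move=> uv; rewrite /rcont; suff -> : (fun t => u (expi t)) = (fun t => v (expi t)) by [].
by apply/funext => t; apply: uv; rewrite normc_expi.
Qed.

Lemma eq_ccont F G : (forall z, normc z = 1 -> F z = G z) -> ccont F -> ccont G.
Proof.
by move=> FG [F1 F2]; split; [apply: eq_rcont F1|apply: eq_rcont F2] => z z1; rewrite FG.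
Qed.

Lemma ccontD F G : ccont F -> ccont G -> ccont (fun z => F z + G z).
Proof.
move=> [F1 F2] [G1 G2]; split.
  by apply: eq_rcont (rcontD F1 G1) => z _; rewrite cReD.
by apply: eq_rcont (rcontD F2 G2) => z _; rewrite cImD.
Qed.

Lemma ccontM F G : ccont F -> ccont G -> ccont (fun z => F z * G z).
Proof.
move=> [F1 F2] [G1 G2]; split.
  by apply: eq_rcont (rcontB (rcontM F1 G1) (rcontM F2 G2)) => z _; rewrite cReM.
by apply: eq_rcont (rcontD (rcontM F1 G2) (rcontM F2 G1)) => z _; rewrite cImM.
Qed.

Lemma ccontN F : ccont F -> ccont (fun z => - F z).
Proof.
by move=> [F1 F2]; split; [apply: eq_rcont (rcontN F1)|apply: eq_rcont (rcontN F2)]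
  => z _; rewrite ?cReN ?cImN.
Qed.

Lemma ccontB F G : ccont F -> ccont G -> ccont (fun z => F z - G z).
Proof. by move=> cF /ccontN; exact: ccontD. Qed.

Lemma ccontJ F : ccont F -> ccont (fun z => (F z)^*).
Proof.
by move=> [F1 F2]; split; [apply: eq_rcont F1|apply: eq_rcont (rcontN F2)]
  => z _; rewrite ?cReJ ?cImJ.
Qed.

Lemma ccontX F n : ccont F -> ccont (fun z => F z ^+ n).
Proof.
move=> cF; elim: n => [|n IH]; first by apply: eq_ccont (ccont_cst 1) => z _; rewrite expr0.
by apply: eq_ccont (ccontM cF IH) => z _; rewrite exprS.
Qed.

Lemma invcE z : z^-1 = z^* * ((normc z ^+ 2)^-1)%:C.
Proof.
have [->|z0] := eqVneq z 0; first by rewrite invr0 rmorph0 mul0r.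
apply: (mulfI z0); rewrite divff// mulrA mulcJ -rmorphM /= divff ?rmorph1//.
by rewrite expf_neq0// normc_eq0.
Qed.

Lemma ccontV F : ccont F -> (forall z, normc z = 1 -> F z != 0) ->
  ccont (fun z => (F z)^-1).
Proof.
move=> cF F0.
have cN : rcont (fun z => (normc (F z) ^+ 2)^-1).
  apply: rcontV => [|z z1]; last by rewrite expf_neq0// normc_eq0 F0.
  case: cF => F1 F2; apply: eq_rcont (rcontD (rcontM F1 F1) (rcontM F2 F2)) => z _.
  by rewrite -!expr2 -normc_sqr.
have cC : ccont (fun z => ((normc (F z) ^+ 2)^-1)%:C) by split => //; exact: rcont_cst.
by apply: eq_ccont (ccontM (ccontJ cF) cC) => z _; rewrite -invcE.
Qed.

Lemma ccont_horner (p : {poly R[i]}) : ccont (fun z => p.[z]).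
Proof.
elim/poly_ind: p => [|p c IH].
  by apply: eq_ccont (ccont_cst 0) => z _; rewrite horner0.
by apply: eq_ccont (ccontD (ccontM IH ccont_id) (ccont_cst c)) => z _; rewrite !hornerE.
Qed.

Lemma ccont_normc F : ccont F -> rcont (fun z => normc (F z)).
Proof.
move=> [F1 F2]; have c := rcontD (rcontM F1 F1) (rcontM F2 F2).
apply: (eq_rcont (u := fun z => Num.sqrt (Re (F z) * Re (F z) + Im (F z) * Im (F z)))).
  by move=> z _; rewrite -!expr2 -normc_sqr sqrtr_sqr ger0_norm ?normc_ge0.
move=> t; apply: continuous_comp (c t) _; exact: sqrt_continuous.
Qed.

End Means.

(** * Square integrable functions and the Cauchy and Poisson kernels *)

Section Kernels.
Local Notation "z ^*" := (conjc z) : ring_scope.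
Variable R : realType.
Implicit Types (z w c e : R[i]) (u v : R[i] -> R) (f F G : R[i] -> R[i]).
Local Notation leb := (@lebesgue_measure R).
Local Notation angles := (@angles R).

Lemma L2_circleP f : L2_circle f <-> cmeas f /\ rint (fun z => normc (f z) ^+ 2).
Proof.
split=> [[m1 m2 fin]|[[m1 m2] /integrableP[_ fin]]].
  have mf : cmeas f by [].
  split => //; apply/integrableP; split.
    by apply/measurable_EFinP; exact: cmeas_normc_sqr mf.
  by under eq_integral => t _ do rewrite /= ger0_norm ?sqr_ge0 //.
split => //; apply: le_lt_trans fin.
by under [leRHS]eq_integral => t _ do rewrite /= ger0_norm ?sqr_ge0 //.
Qed.

Lemma L2_normE f : L2_norm f = Num.sqrt (rmean (fun z => normc (f z) ^+ 2)).
Proof. by []. Qed.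

Lemma L2_norm_ge0 f : 0 <= L2_norm f. Proof. exact: sqrtr_ge0. Qed.

Lemma L2_norm_sqr f : L2_norm f ^+ 2 = rmean (fun z => normc (f z) ^+ 2).
Proof. by rewrite L2_normE sqr_sqrtr// rmean_ge0// => z _; exact: sqr_ge0. Qed.

Lemma L2_cint f : L2_circle f -> cint f.
Proof.
move=> /L2_circleP[mf i2]; apply: (@le_cint _ _ (fun z => 1 + normc (f z) ^+ 2)) => //.
  by apply: rintD => //; exact: rint_cst.
move=> z _; have := normc_ge0 (f z); have := sqr_ge0 (normc (f z) - 1).
rewrite sqrrB1 mulr2n; lra.
Qed.

(** The inequality 2 m |f| <= m ^+ 2 + |f| ^+ 2, averaged at the mean m of |f|. *)
Lemma rmean_normc_le_L2 f : L2_circle f -> rmean (fun z => normc (f z)) <= L2_norm f.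
Proof.
move=> Lf; have /L2_circleP[mf i2] := Lf; have iN := cint_normc (L2_cint Lf).
set m := rmean _; have m0 : 0 <= m by apply: rmean_ge0 => z _; exact: normc_ge0.
rewrite -(@ler_pXn2r _ 2) ?nnegrE ?L2_norm_ge0// L2_norm_sqr.
have : rmean (fun z => (2 * m) * normc (f z)) <= rmean (fun z => m ^+ 2 + normc (f z) ^+ 2).
  apply: le_rmean; [exact: rintZ|by apply: rintD => //; exact: rint_cst|].
  by move=> z _; have := sqr_ge0 (m - normc (f z)); rewrite sqrrB mulr2n; lra.
rewrite rmeanZ// rmeanD//; last exact: rint_cst.
by rewrite rmean_cst -/m expr2; lra.
Qed.

Lemma L2M f F B : L2_circle f -> cmeas F -> 0 <= B ->
  (forall z, normc z = 1 -> normc (F z) <= B) ->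
  L2_circle (fun z => F z * f z) /\ L2_norm (fun z => F z * f z) <= B * L2_norm f.
Proof.
move=> /L2_circleP[mf i2] mF B0 FB.
have iB : rint (fun z => B ^+ 2 * normc (f z) ^+ 2) by exact: rintZ.
have le z : normc z = 1 -> normc (F z * f z) ^+ 2 <= B ^+ 2 * normc (f z) ^+ 2.
  by move=> z1; rewrite normcM exprMn ler_wpM2r ?sqr_ge0// lerXn2r ?nnegrE ?normc_ge0// FB.
have iFf : rint (fun z => normc (F z * f z) ^+ 2).
  apply: (le_rint _ iB); first by apply: cmeas_normc_sqr; exact: cmeasM.
  by move=> z z1; rewrite ger0_norm ?sqr_ge0// le.
split; first by apply/L2_circleP; split => //; exact: cmeasM.
rewrite -(@ler_pXn2r _ 2) ?nnegrE ?L2_norm_ge0 ?mulr_ge0 ?L2_norm_ge0//.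
by rewrite exprMn !L2_norm_sqr -rmeanZ//; exact: le_rmean.
Qed.

(** A triangle inequality up to the factor 2, which is enough for the boundedness
    of sums of operators and follows from (a + b) ^+ 2 <= 2 a ^+ 2 + 2 b ^+ 2. *)
Lemma L2D f g : L2_circle f -> L2_circle g ->
  L2_circle (fun z => f z + g z) /\ L2_norm (fun z => f z + g z) <= 2 * (L2_norm f + L2_norm g).
Proof.
move=> /L2_circleP[mf if2] /L2_circleP[mg ig2].
have iB : rint (fun z => 2 * normc (f z) ^+ 2 + 2 * normc (g z) ^+ 2).
  by apply: rintD; exact: rintZ.
have le z : normc (f z + g z) ^+ 2 <= 2 * normc (f z) ^+ 2 + 2 * normc (g z) ^+ 2.
  apply: (@le_trans _ _ ((normc (f z) + normc (g z)) ^+ 2)).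
    by rewrite lerXn2r ?nnegrE ?addr_ge0 ?normc_ge0// le_normcD.
  by have := sqr_ge0 (normc (f z) - normc (g z)); rewrite sqrrB sqrrD !mulr2n; lra.
have iS : rint (fun z => normc (f z + g z) ^+ 2).
  apply: (le_rint _ iB); first by apply: cmeas_normc_sqr; exact: cmeasD.
  by move=> z _; rewrite ger0_norm ?sqr_ge0// le.
split; first by apply/L2_circleP; split => //; exact: cmeasD.
have := L2_norm_ge0 f; have := L2_norm_ge0 g => g0 f0.
rewrite -(@ler_pXn2r _ 2) ?nnegrE ?L2_norm_ge0 ?mulr_ge0 ?addr_ge0//.
have : rmean (fun z => normc (f z + g z) ^+ 2) <=
    rmean (fun z => 2 * normc (f z) ^+ 2 + 2 * normc (g z) ^+ 2) by exact: le_rmean.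
rewrite rmeanD ?rmeanZ -?L2_norm_sqr//; [|exact: rintZ..].
by move=> H; apply: (le_trans H); rewrite exprMn sqrrD mulr2n; nra.
Qed.

Lemma ccont_L2 F : ccont F -> L2_circle F.
Proof.
move=> cF; apply/L2_circleP; split; first exact: ccont_meas.
apply: rcont_int; have c := ccont_normc cF.
by apply: eq_rcont (rcontM c c) => z _; rewrite expr2.
Qed.

(** Gives the vanishing of the means of cos (n t) and sin (n t). *)
Lemma integral_derivative_period (P p : R -> R) :
  (forall x : R, is_derive x (1 : R) P (p x)) -> continuous p -> P (2 * pi) = P 0 ->
  \int[leb]_(t in angles) p t = 0.
Proof.
move=> dP cp per.
have cP : continuous P.
  by move=> x; apply/differentiable_continuous/derivable1_diffP; case: (dP x).
rewrite /Rintegral (@continuous_FTC2 _ p P 0 (2 * pi)) ?twopi_gt0//.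
- by rewrite per -EFinB subrr.
- by apply: continuous_subspaceT.
- split; first by move=> x _; case: (dP x).
  + by apply: cvg_at_right_filter; exact: cP.
  + by apply: cvg_at_left_filter; exact: cP.
- by move=> x _; rewrite derive1E; case: (dP x).
Qed.

Lemma cmeanX n : (0 < n)%N -> cmean (fun z : R[i] => z ^+ n) = 0.
Proof.
move=> n0; have n0' : n%:R != 0 :> R by rewrite pnatr_eq0 -lt0n.
have cs (x : R) : is_derive x (1 : R) (fun t : R => n%:R * t) n%:R.
  by apply: is_derive_eq; rewrite ?scaler1 ?[_ *: 1]mulr1.
have E t : expi t ^+ n = expi (n%:R * t :> R) by rewrite expiMn.
have per : expi (n%:R * (2 * pi)) = expi (n%:R * 0) :> R[i].
  by rewrite (expiMn (2 * pi) n) (expiMn 0 n) expi2pi expi0.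
have cn : continuous (fun t : R => n%:R * t).
  by move=> x; apply: cvgM; [exact: cvg_cst|exact: cvg_id].
apply: complex_eqP; rewrite ?Re_cmean ?Im_cmean /rmean.
  rewrite (_ : Rintegral _ _ _ = \int[leb]_(t in angles) cos (n%:R * t)); last first.
    by apply: eq_Rintegral => t _; rewrite E.
  have dS (x : R) : is_derive x (1 : R) (fun t : R => n%:R^-1 * sin (n%:R * t)) (cos (n%:R * x)).
    have := is_derive1_comp (is_derive_sin (n%:R * x)) (cs x).
    move=> /(is_deriveZ n%:R^-1) H.
    by apply: is_derive_eq H _; rewrite /GRing.scale /= mulrCA mulVf ?mulr1.
  rewrite (integral_derivative_period dS) ?mulr0//.
    by move=> x; apply: continuous_comp (cn x) _; exact: continuous_cos.
  by congr (_ * _); move: (congr1 (@complex.Im R) per); rewrite mulr0.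
rewrite (_ : Rintegral _ _ _ = \int[leb]_(t in angles) sin (n%:R * t)); last first.
  by apply: eq_Rintegral => t _; rewrite E.
have dC (x : R) : is_derive x (1 : R) (fun t : R => - n%:R^-1 * cos (n%:R * t)) (sin (n%:R * x)).
  have := is_derive1_comp (is_derive_cos (n%:R * x)) (cs x).
  move=> /(is_deriveZ (- n%:R^-1)) H.
  apply: is_derive_eq H _.
  by rewrite /GRing.scale /= !mulNr mulrN opprK mulrCA mulVf ?mulr1.
rewrite (integral_derivative_period dC) ?mulr0//.
  by move=> x; apply: continuous_comp (cn x) _; exact: continuous_sin.
by congr (_ * _); move: (congr1 (@complex.Re R) per); rewrite mulr0.
Qed.

End Kernels.

Section Poisson.
Local Notation "z ^*" := (conjc z) : ring_scope.
Variable R : realType.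
Implicit Types (z w c e : R[i]) (u v : R[i] -> R) (f F G : R[i] -> R[i]).

Lemma expr_small (r B eps : R) : 0 <= r < 1 -> 0 < eps -> exists N, r ^+ N * B < eps.
Proof.
move=> /andP[r0 r1] eps0.
have B0 : 0 < `|B| + 1 by rewrite ltr_wpDl.
have r1' : `|r| < 1 by rewrite ger0_norm.
have := cvg_expr r1' => /cvgrPdist_lt /(_ (eps / (`|B| + 1))) [].
  by rewrite divr_gt0.
move=> N _ /(_ N (leqnn N)); rewrite sub0r normrN ger0_norm ?exprn_ge0// ltr_pdivlMr// => H.
exists N; apply: le_lt_trans H; rewrite ler_wpM2l ?exprn_ge0//.
by rewrite (le_trans (ler_norm B))// lerDl.
Qed.

Lemma normc_le_geom0 z (r B : R) : 0 <= r < 1 ->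
  (forall N, normc z <= r ^+ N * B) -> z = 0.
Proof.
move=> hr H; apply/eqP; rewrite -normc_eq0 eq_le normc_ge0 andbT leNgt.
apply/negP => z0; have [N] := expr_small B hr z0.
by rewrite ltNge H.
Qed.

Lemma H2P f : H2 f <->
  L2_circle f /\ forall n, (0 < n)%N -> cmean (fun z => z ^+ n * f z) = 0.
Proof.
have E n : fourier_coef f (- n%:Z) = cmean (fun z => z ^+ n * f z).
  rewrite /fourier_coef /cmean; congr circle_mean; apply/funext => t.
  by rewrite mulrC -expiMn rmorphN /= mulNr opprK.
split=> [[Lf H]|[Lf H]]; split => //.
  by move=> n n0; rewrite -E H// oppr_lt0.
case=> // n _; rewrite NegzE E; exact: H.
Qed.

Lemma H2_cint f : H2 f -> cint f.
Proof. by move=> [/L2_cint]. Qed.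

Lemma H2_L2 f : H2 f -> L2_circle f. Proof. by case. Qed.

Lemma H2_moment f n : H2 f -> (0 < n)%N -> cmean (fun z => z ^+ n * f z) = 0.
Proof. by move=> /H2P[_ H] /H. Qed.

Lemma gelfandE f z : gelfand f z = cmean (fun e => (1 - z * e^*)^-1 * f e).
Proof.
rewrite /gelfand /cmean; congr circle_mean; apply/funext => t.
by rewrite expiN mulrC.
Qed.

(** The kernel 1 / (1 - w u) for a circle function u: u = conjugation gives the
    Cauchy kernel, and u = id the other half of the Poisson kernel. *)
Section Kernel.
Variables (u : R[i] -> R[i]) (w : R[i]).
Hypotheses (cu : ccont u) (u1 : forall z, normc z = 1 -> normc (u z) = 1).
Hypothesis w1 : normc w < 1.

Lemma kernel_lower z : normc z = 1 -> 1 - normc w <= normc (1 - w * u z).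
Proof.
move=> z1; have := le_normc_sub 1 (w * u z).
by rewrite normc1 normcM u1// mulr1.
Qed.

Lemma kernel_neq0 z : normc z = 1 -> 1 - w * u z != 0.
Proof.
by move=> z1; rewrite -normc_gt0 (lt_le_trans _ (kernel_lower z1))// subr_gt0.
Qed.

Lemma kernel_bound z : normc z = 1 -> normc (1 - w * u z)^-1 <= (1 - normc w)^-1.
Proof.
move=> z1; rewrite normcV lef_pV2 ?posrE ?subr_gt0 ?kernel_lower//.
by rewrite normc_gt0 kernel_neq0.
Qed.

Lemma kernel_ccont : ccont (fun z => (1 - w * u z)^-1).
Proof.
apply: ccontV; last exact: kernel_neq0.
by apply: ccontB; [exact: ccont_cst|apply: ccontM => //; exact: ccont_cst].
Qed.

Lemma kernel_cint f : cint f -> cint (fun z => (1 - w * u z)^-1 * f z).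
Proof. by move=> iF; apply: cintM iF (ccont_meas kernel_ccont) _; exact: kernel_bound. Qed.

Lemma powu_cint f n : cint f -> cint (fun z => u z ^+ n * f z).
Proof.
move=> iF; apply: (@cintM _ _ _ 1 iF); first by apply: ccont_meas; exact: ccontX.
by move=> z z1; rewrite normcX u1// expr1n.
Qed.

Lemma kernel_expand f N : cint f ->
  cmean (fun z => (1 - w * u z)^-1 * f z) =
  \sum_(n < N) w ^+ n * cmean (fun z => u z ^+ n * f z) +
  w ^+ N * cmean (fun z => (1 - w * u z)^-1 * (u z ^+ N * f z)).
Proof.
move=> iF; elim: N => [|N ->].
  rewrite big_ord0 add0r mul1r; apply: eq_cmean => z _; by rewrite mul1r.
rewrite big_ord_recr /= -addrA; congr (_ + _).
have iN := powu_cint N iF; have iN1 := powu_cint N.+1 iF.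
rewrite exprSr -mulrA -mulrDr -(cmeanZ w); last exact: kernel_cint.
rewrite -cmeanD //; last by apply: cintZ; exact: kernel_cint.
congr (_ * _); apply: eq_cmean => z z1.
have := kernel_neq0 z1; set k := 1 - _ => k0.
apply: (mulfI k0); rewrite mulrA mulfV// mul1r mulrDr.
have -> : k * (w * (k^-1 * (u z ^+ N.+1 * f z))) = (k / k) * (w * (u z ^+ N.+1 * f z)).
  by ring.
by rewrite mulfV// mul1r /k exprS; ring.
Qed.

Lemma kernel_tail f N : cint f ->
  normc (cmean (fun z => (1 - w * u z)^-1 * (u z ^+ N * f z))) <=
  (1 - normc w)^-1 * rmean (fun z => normc (f z)).
Proof.
move=> iF; have iN := powu_cint N iF.
apply: (le_trans (le_normc_cmean (kernel_cint iN))).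
rewrite -rmeanZ; last exact: cint_normc.
apply: le_rmean.
- by apply: cint_normc; exact: kernel_cint.
- by apply: rintZ; exact: cint_normc.
- move=> z z1; rewrite !normcM normcX u1// expr1n mul1r.
  by rewrite ler_wpM2r ?normc_ge0// kernel_bound.
Qed.

(** In the geometric expansion only the term of degree 0 and the tail survive,
    and the tail is geometrically small. *)
Lemma kernel_mean f : cint f -> (forall n, (0 < n)%N -> cmean (fun z => u z ^+ n * f z) = 0) ->
  cmean (fun z => (1 - w * u z)^-1 * f z) = cmean f.
Proof.
move=> iF f0; apply/eqP; rewrite -subr_eq0; apply/eqP.
apply: (@normc_le_geom0 _ (normc w)
  ((1 - normc w)^-1 * rmean (fun z => normc (f z)) + normc (cmean (fun z => (1 - w * u z)^-1 * f z) - cmean f))).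
  by rewrite normc_ge0.
case=> [|N].
  rewrite expr0 mul1r lerDr mulr_ge0 ?invr_ge0 ?subr_ge0 ?(ltW w1)//.
  by apply: rmean_ge0 => z _; exact: normc_ge0.
rewrite {1}(kernel_expand N.+1 iF) big_ord_recl big1 => [|i _]; last by rewrite f0// mulr0.
rewrite addr0 expr0 mul1r (@eq_cmean _ _ f) => [|z _]; last by rewrite mul1r.
rewrite addrAC subrr add0r normcM normcX ler_wpM2l ?exprn_ge0 ?normc_ge0//.
by apply: (le_trans (kernel_tail _ iF)); rewrite lerDl normc_ge0.
Qed.

End Kernel.

Lemma ccont_conj : ccont (fun e : R[i] => e^*).
Proof. exact: ccontJ (ccont_id R). Qed.

Lemma normcJ_circle e : normc e = 1 -> normc e^* = 1.
Proof. by rewrite normcJ. Qed.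

Lemma gelfand_cint f z : normc z < 1 -> cint f -> cint (fun e => (1 - z * e^*)^-1 * f e).
Proof. by move=> z1; apply: kernel_cint => //; [exact: ccont_conj|exact: normcJ_circle]. Qed.

Lemma gelfand_bound f z : normc z < 1 -> cint f ->
  normc (gelfand f z) <= (1 - normc z)^-1 * rmean (fun e => normc (f e)).
Proof.
move=> z1 iF; have := @kernel_tail _ z ccont_conj normcJ_circle z1 f 0 iF.
rewrite gelfandE; under [X in normc X]eq_cmean => e _ do rewrite expr0 mul1r.
by [].
Qed.

Lemma gelfandD f g z : normc z < 1 -> cint f -> cint g ->
  gelfand (fun e => f e + g e) z = gelfand f z + gelfand g z.
Proof.
move=> z1 iF iG; rewrite !gelfandE -cmeanD; [|exact: gelfand_cint..].
by apply: eq_cmean => e _; rewrite mulrDr.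
Qed.

Lemma gelfandZ c f z : normc z < 1 -> cint f ->
  gelfand (fun e => c * f e) z = c * gelfand f z.
Proof.
move=> z1 iF; rewrite !gelfandE -cmeanZ; last exact: gelfand_cint.
by apply: eq_cmean => e _; rewrite mulrCA.
Qed.

Lemma gelfandB f g z : normc z < 1 -> cint f -> cint g ->
  gelfand (fun e => f e - g e) z = gelfand f z - gelfand g z.
Proof.
move=> z1 iF iG; rewrite !gelfandE -cmeanB; [|exact: gelfand_cint..].
by apply: eq_cmean => e _; rewrite mulrBr.
Qed.

Lemma eq_gelfand f g z : (forall e, normc e = 1 -> f e = g e) -> gelfand f z = gelfand g z.
Proof. by move=> fg; rewrite !gelfandE; apply: eq_cmean => e /fg ->. Qed.

Lemma gelfand0 f : gelfand f 0 = cmean f.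
Proof. by rewrite gelfandE; apply: eq_cmean => e _; rewrite mul0r subr0 invr1 mul1r. Qed.

Lemma cmean_conjX n : (0 < n)%N -> cmean (fun e : R[i] => e^* ^+ n) = 0.
Proof.
move=> n0; transitivity ((cmean (fun e : R[i] => e ^+ n))^*); last by rewrite cmeanX// rmorph0.
rewrite -cmeanJ; first by apply: eq_cmean => e _; rewrite rmorphXn.
by apply: ccont_int; apply: ccontX; exact: ccont_id.
Qed.

Lemma gelfand_cst c z : normc z < 1 -> gelfand (fun=> c) z = c.
Proof.
move=> z1; rewrite gelfandE kernel_mean ?cmean_cst//.
- exact: ccont_conj.
- exact: normcJ_circle.
- exact: cint_cst.
- move=> n n0; under eq_cmean => e _ do rewrite mulrC.
  rewrite cmeanZ ?cmean_conjX ?mulr0//.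
  by apply: ccont_int; apply: ccontX; exact: ccont_conj.
Qed.

Definition poisson_kernel z e : R := (1 - normc z ^+ 2) / normc (1 - z * e^*) ^+ 2.

Definition poisson f z : R[i] := cmean (fun e => (poisson_kernel z e)%:C * f e).

Lemma poisson_kernelE z e : normc z < 1 -> normc e = 1 ->
  (poisson_kernel z e)%:C = (1 - z * e^*)^-1 + (1 - z^* * e)^-1 - 1.
Proof.
move=> z1 e1; have k0 := kernel_neq0 normcJ_circle z1 e1.
have kc : 1 - z^* * e = (1 - z * e^*)^*.
  by rewrite rmorphB rmorphM rmorph1 /= conjcK.
have kc0 : 1 - z^* * e != 0 by rewrite kc conjc_eq0.
have sq : (normc (1 - z * e^*) ^+ 2)%:C = (1 - z * e^*) * (1 - z^* * e).
  by rewrite kc mulcJ.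
have zz : (1 - normc z ^+ 2)%:C = 1 - (z * e^*) * (z^* * e).
  rewrite rmorphB rmorph1 /= -mulcJ; congr (_ - _).
  by rewrite mulrACA [e^* * e]mulrC (mulcJ e) e1 expr1n mulr1.
rewrite /poisson_kernel rmorphM fmorphV /= sq zz.
by field; rewrite k0 kc0.
Qed.

Lemma poisson_kernel_ge0 z e : normc z < 1 -> 0 <= poisson_kernel z e.
Proof.
move=> z1; rewrite divr_ge0 ?sqr_ge0// subr_ge0 -(expr1n _ 2).
by rewrite lerXn2r ?nnegrE ?normc_ge0//; exact: ltW.
Qed.

Lemma poisson_kernel_le z e : normc z < 1 -> normc e = 1 ->
  poisson_kernel z e <= 2 / (1 - normc z).
Proof.
move=> z1 e1; have d0 : 0 < 1 - normc z by rewrite subr_gt0.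
have := kernel_lower z normcJ_circle e1; set k := normc (1 - _) => kd.
have k0 : 0 < k by exact: lt_le_trans kd.
rewrite /poisson_kernel -/k ler_pdivrMr ?exprn_gt0//.
rewrite mulrAC ler_pdivlMr//.
have := normc_ge0 z => n0.
have : (1 - normc z) ^+ 2 <= k ^+ 2 by rewrite lerXn2r// nnegrE ltW.
nra.
Qed.

Lemma poisson_kernel_ccont z : normc z < 1 -> ccont (fun e => (poisson_kernel z e)%:C).
Proof.
move=> z1; apply: (eq_ccont (F := fun e => (1 - z * e^*)^-1 + (1 - z^* * e)^-1 - 1)).
  by move=> e e1; rewrite poisson_kernelE.
apply: ccontB; last exact: ccont_cst.
apply: ccontD; first by apply: kernel_ccont => //; [exact: ccont_conj|exact: normcJ_circle].
by apply: kernel_ccont => //; [exact: ccont_id|rewrite normcJ].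
Qed.

Lemma poisson_cint f z : normc z < 1 -> cint f -> cint (fun e => (poisson_kernel z e)%:C * f e).
Proof.
move=> z1 iF; have c := poisson_kernel_ccont z1; have [B _ HB] := ccont_bounded c.
exact: cintM iF (ccont_meas c) HB.
Qed.

Lemma poissonE f z : normc z < 1 -> cint f ->
  poisson f z = gelfand f z + cmean (fun e => (1 - z^* * e)^-1 * f e) - cmean f.
Proof.
move=> z1 iF; have i1 := gelfand_cint z1 iF.
have i2 : cint (fun e => (1 - z^* * e)^-1 * f e).
  by apply: (kernel_cint (u := id)) => //; [exact: ccont_id|rewrite normcJ].
rewrite gelfandE -cmeanD// -cmeanB//; last exact: cintD.
by apply: eq_cmean => e e1; rewrite poisson_kernelE// mulrBl mulrDl mul1r.
Qed.

(** On functions without negative Fourier coefficients, the Poisson kernel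
    reproduces the analytic extension, since the conjugate half of the kernel
    only sees the mean. *)
Lemma poisson_gelfand f z : normc z < 1 -> cint f ->
  (forall n, (0 < n)%N -> cmean (fun e => e ^+ n * f e) = 0) ->
  poisson f z = gelfand f z.
Proof.
move=> z1 iF f0; rewrite poissonE// (kernel_mean (u := id)) ?addrK//.
  exact: ccont_id.
by rewrite normcJ.
Qed.

Lemma poisson_cst c z : normc z < 1 -> poisson (fun=> c) z = c.
Proof.
move=> z1; rewrite poisson_gelfand ?gelfand_cst//; first exact: cint_cst.
move=> n n0; under eq_cmean => e _ do rewrite mulrC.
rewrite cmeanZ ?cmeanX ?mulr0//.
by apply: ccont_int; apply: ccontX; exact: ccont_id.
Qed.

Lemma rmean_poisson_kernel z : normc z < 1 -> rmean (poisson_kernel z) = 1.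
Proof.
move=> z1; have := congr1 (@complex.Re R) (poisson_cst 1 z1); rewrite /poisson Re_cmean /= => H.
by rewrite -[RHS]H; apply: eq_rmean => e _; rewrite mulr0 subr0 mulr1.
Qed.

Definition circle_ucont f := forall eps : R, 0 < eps -> exists2 d : R, 0 < d &
  forall z w, normc z = 1 -> normc w = 1 -> normc (z - w) < d -> normc (f z - f w) < eps.

(** The Poisson kernel is an approximate identity: away from the boundary
    point it is bounded by a multiple of the distance to it. *)
Lemma poisson_approx f : ccont f -> circle_ucont f ->
  forall eps : R, 0 < eps -> exists2 d : R, 0 < d &
  forall z e0, normc z < 1 -> normc e0 = 1 -> normc (z - e0) < d ->
  normc (poisson f z - f e0) <= eps.
Proof.
move=> cf uf eps eps0.
have [B B0 HB] := ccont_bounded cf.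
have eps2 : 0 < eps / 2 by rewrite divr_gt0.
have [eta eta0 Heta] := uf _ eps2.
have B1 : 0 < 32 * (B + 1) by rewrite mulr_gt0// ltr_wpDl.
have eta2 : 0 < eta ^+ 2 by rewrite exprn_gt0.
(* For z within eta / 2 of e0, the kernel at points farther than eta from e0 is
   at most 8 |z - e0| / eta ^+ 2, while f e - f e0 is at most 2 B. *)
exists (Num.min (eta / 2) (eps * eta ^+ 2 / (32 * (B + 1)))).
  by rewrite lt_min !divr_gt0// mulr_gt0.
move=> z e0 z1 e01; rewrite lt_min => /andP[zd1]; rewrite ltr_pdivlMr// => zd2.
have iF := ccont_int cf.
have ib : cint (fun e => f e - f e0) by apply: cintB => //; exact: cint_cst.
have -> : poisson f z - f e0 = cmean (fun e => (poisson_kernel z e)%:C * (f e - f e0)).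
  rewrite -{1}(poisson_cst (f e0) z1) /poisson -cmeanB; [|exact: poisson_cint|].
    by apply: eq_cmean => e _; rewrite mulrBr.
  by apply: poisson_cint => //; exact: cint_cst.
have rP : rint (poisson_kernel z) by have [/rcont_int] := poisson_kernel_ccont z1.
apply: (le_trans (le_normc_cmean (poisson_cint z1 ib))).
have -> : eps = rmean (fun e => eps / 2 * poisson_kernel z e + eps / 2).
  rewrite (rmeanD (rintZ _ rP) (rint_cst _)) (rmeanZ _ rP) rmean_cst rmean_poisson_kernel//.
  by field.
apply: le_rmean.
- by apply: cint_normc; exact: poisson_cint.
- by apply: rintD; [exact: rintZ|exact: rint_cst].
move=> e e1; have P0 := poisson_kernel_ge0 e z1.
rewrite normcM normc_real ger0_norm// mulrC.
have [near|far] := ltP (normc (e - e0)) eta.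
  have /ltW H := Heta _ _ e1 e01 near.
  by apply: ler_wpDr; [exact: ltW|rewrite ler_wpM2r].
have f2B : normc (f e - f e0) <= 2 * B.
  by apply: (le_trans (le_normcB _ _)); have := HB _ e1; have := HB _ e01; lra.
suff PB : poisson_kernel z e * (2 * B) <= eps / 2.
  have : normc (f e - f e0) * poisson_kernel z e <= 2 * B * poisson_kernel z e.
    by rewrite ler_wpM2r.
  by have := mulr_ge0 (ltW eps2) P0; lra.
have kE : normc (1 - z * e^*) = normc (e - z).
  have -> : 1 - z * e^* = (e - z) * e^*.
    by rewrite mulrBl mulcJ e1 expr1n.
  by rewrite normcM normcJ e1 mulr1.
have kl : eta / 2 <= normc (e - z).
  have := le_normc_trans e z e0; lra.
have k0 : 0 < normc (e - z) by apply: lt_le_trans kl; rewrite divr_gt0.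
have ksq : eta ^+ 2 / 4 <= normc (e - z) ^+ 2.
  have -> : eta ^+ 2 / 4 = (eta / 2) ^+ 2 by field.
  by rewrite lerXn2r ?nnegrE ?normc_ge0// divr_ge0// ltW.
rewrite /poisson_kernel kE mulrAC ler_pdivrMr ?exprn_gt0//.
have n1 : 1 - normc z <= normc (z - e0).
  by rewrite normcB -e01; exact: le_normc_sub.
have n0 := normc_ge0 z.
have m0 := normc_ge0 (z - e0).
have h1 : (1 - normc z ^+ 2) * (2 * B) <= 2 * normc (z - e0) * (2 * (B + 1)).
  by apply: ler_pM; [nra|lra|nra|lra].
nra.
Qed.

End Poisson.

(** * Uniform continuity and uniform approximation by polynomials *)

Section Heine.
Local Notation "z ^*" := (conjc z) : ring_scope.
Variables (R : realType) (T : topologicalType).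
Implicit Types (p g : T -> R[i]).

Definition tcont p := continuous (fun x => Re (p x)) /\ continuous (fun x => Im (p x)).

Lemma tcont_normc_sub p : tcont p ->
  continuous (fun xy : T * T => normc (p xy.1 - p xy.2)).
Proof.
move=> [c1 c2] xy.
have d (u : T -> R) : continuous u ->
    continuous (fun xy : T * T => (u xy.1 - u xy.2) * (u xy.1 - u xy.2)).
  move=> cu st.
  have c : {for st, continuous (fun xy : T * T => u xy.1 - u xy.2)}.
    by apply: cvgB; (apply: continuous_comp; [|exact: cu]); [exact: cvg_fst|exact: cvg_snd].
  exact: (cvgM c c).
rewrite (_ : (fun _ => _) = (fun xy : T * T => Num.sqrt
   ((Re (p xy.1) - Re (p xy.2)) * (Re (p xy.1) - Re (p xy.2)) +
    (Im (p xy.1) - Im (p xy.2)) * (Im (p xy.1) - Im (p xy.2))))); last first.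
  by apply/funext => st; rewrite -!expr2; case: (p st.1) => a b; case: (p st.2).
apply: continuous_comp; last exact: sqrt_continuous.
exact: (cvgD (d _ c1 xy) (d _ c2 xy)).
Qed.

(** The sum h of the proof is positive on a compact square, as its first term
    vanishes only where the second is positive.  Its minimum is the modulus of
    continuity of g through the quotient map p. *)
Lemma heine (K : set T) p g : compact K -> tcont p -> tcont g ->
  (forall x y, K x -> K y -> p x = p y -> g x = g y) ->
  forall eps : R, 0 < eps -> exists2 d : R, 0 < d &
  forall x y, K x -> K y -> normc (p x - p y) < d -> normc (g x - g y) < eps.
Proof.
move=> cK cp cg pg eps eps0.
pose h (xy : T * T) := normc (p xy.1 - p xy.2) + Num.max 0 (eps - normc (g xy.1 - g xy.2)).
have ch : continuous h.
  move=> xy; apply: cvgD; first exact: tcont_normc_sub.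
  apply: (@continuous_max _ _ (fun=> 0) (fun st : T * T => eps - normc (g st.1 - g st.2))).
    exact: cvg_cst.
  by apply: cvgB; [exact: cvg_cst|exact: tcont_normc_sub].
have [K0|/set0P/negP] := pselect (K !=set0); last first.
  rewrite negbK => /eqP ->; by exists 1.
have KK0 : (K `*` K) !=set0 by case: K0 => x Kx; exists (x, x).
have cKK : compact (K `*` K) by exact: compact_setX.
have [[x0 y0]] := compact_EVT_min KK0 cKK (continuous_subspaceT ch).
rewrite inE => -[/= Kx0 Ky0] hmin.
have h_ge0 : 0 <= normc (p x0 - p y0) by exact: normc_ge0.
exists (h (x0, y0)).
  rewrite /h /=; have [E|ne] := eqVneq (p x0) (p y0).
    rewrite (pg _ _ Kx0 Ky0 E) subrr normc0 subr0.
    by rewrite ltr_wpDl// lt_max eps0 orbT.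
  by rewrite ltr_pwDl ?normc_gt0 ?subr_eq0// le_max lexx.
move=> x y Kx Ky H; rewrite ltNge; apply/negP => ge.
have : h (x0, y0) <= h (x, y) by apply: hmin; rewrite inE; split.
have -> : h (x, y) = normc (p x - p y) by rewrite /h /= max_l ?addr0// subr_le0.
by rewrite leNgt H.
Qed.

End Heine.

Section Approximation.
Local Notation "z ^*" := (conjc z) : ring_scope.
Variable R : realType.
Implicit Types (z w c e : R[i]) (u v : R[i] -> R) (f g s F G : R[i] -> R[i]).

Lemma conj_kernel z e : 1 - z^* * e = (1 - z * e^*)^*.
Proof. by rewrite rmorphB rmorphM rmorph1 /= conjcK. Qed.

Lemma ccont_ucont f : ccont f -> circle_ucont f.
Proof.
move=> [f1 f2] eps eps0.
have c : tcont (@expi R) by split; [exact: continuous_cos|exact: continuous_sin].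
have cf : tcont (fun t : R => f (expi t)) by [].
have [|d d0 H] := heine (@segment_compact R 0 (2 * pi)) c cf _ eps0.
  by move=> s t _ _ ->.
exists d => // z w /circle_expi[s /andP[s0 s1] ->] /circle_expi[t /andP[t0 t1] ->].
by apply: H; rewrite /= in_itv /= ?s0 ?t0 ltW.
Qed.

(** The boundary values of the disc algebra, and the disc algebra itself. *)
Definition circle_alg f : Prop := forall eps : R, 0 < eps ->
  exists p : {poly R[i]}, forall z, normc z = 1 -> normc (f z - p.[z]) <= eps.

Definition disc_alg f : Prop := forall eps : R, 0 < eps ->
  exists p : {poly R[i]}, forall z, normc z <= 1 -> normc (f z - p.[z]) <= eps.

(** The geometric expansion of the Cauchy kernel is uniform on the disc of radius
    r; its partial sums are polynomials. *)
Lemma gelfand_poly f (r : R) : cint f -> 0 <= r < 1 -> forall eps : R, 0 < eps ->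
  exists p : {poly R[i]}, forall z, normc z <= 1 ->
  normc (gelfand f (r%:C * z) - p.[z]) <= eps.
Proof.
move=> iF /andP[r0 r1] eps eps0.
have hr : 0 <= r < 1 by rewrite r0.
have [N HN] := expr_small ((1 - r)^-1 * rmean (fun z => normc (f z))) hr eps0.
exists (\poly_(n < N) (r%:C ^+ n * cmean (fun z => z^* ^+ n * f z))) => z z1.
have nrz : normc (r%:C * z) <= r.
  by rewrite normcM normc_real ger0_norm// -[leRHS]mulr1 ler_wpM2l.
have rz1 : normc (r%:C * z) < 1 by exact: le_lt_trans r1.
rewrite gelfandE (kernel_expand (ccont_conj R) (@normcJ_circle R) rz1 N iF) horner_poly.
rewrite [X in X + _ - _](_ : _ =
    \sum_(n < N) r%:C ^+ n * cmean (fun z => z^* ^+ n * f z) * z ^+ n); last first.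
  by apply: eq_bigr => n _; rewrite exprMn mulrAC.
rewrite addrAC subrr add0r normcM normcX.
apply: le_trans (ltW HN).
apply: ler_pM; rewrite ?exprn_ge0 ?normc_ge0//.
  by rewrite lerXn2r ?nnegrE ?normc_ge0.
apply: (le_trans (kernel_tail (ccont_conj R) (@normcJ_circle R) rz1 N iF)).
rewrite ler_wpM2r//; first by apply: rmean_ge0 => e _; exact: normc_ge0.
by rewrite lef_pV2 ?posrE ?subr_gt0// lerB.
Qed.

Lemma poisson_radial f : ccont f -> forall eps : R, 0 < eps ->
  exists r : R, 0 <= r < 1 /\
  forall e, normc e = 1 -> normc (poisson f (r%:C * e) - f e) <= eps.
Proof.
move=> cf eps eps0; have [d d0 H] := poisson_approx cf (ccont_ucont cf) eps0.
exists (Num.max 0 (1 - d / 2)); set r := Num.max _ _.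
have r0 : 0 <= r by rewrite le_max lexx.
have r1 : r < 1 by rewrite gt_max ltr01 /=; lra.
have rd : 1 - d / 2 <= r by rewrite le_max lexx orbT.
split; first by rewrite r0.
move=> e e1; apply: H => //.
  by rewrite normcM e1 mulr1 normc_real ger0_norm.
have -> : r%:C * e - e = (r - 1)%:C * e by rewrite rmorphB rmorph1 mulrBl mul1r.
rewrite normcM e1 mulr1 normc_real ler0_norm ?subr_le0 ?ltW//; lra.
Qed.

(** The Poisson extension to a circle of radius close to 1 is uniformly close to
    f and is the Gelfand transform, which polynomials approximate there. *)
Lemma circle_alg_moments f : ccont f ->
  (forall n, (0 < n)%N -> cmean (fun e => e ^+ n * f e) = 0) -> circle_alg f.
Proof.
move=> cf f0 eps eps0; have iF := ccont_int cf.
have eps2 : 0 < eps / 2 by rewrite divr_gt0.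
have [r [hr Hr]] := poisson_radial cf eps2.
have [p Hp] := gelfand_poly iF hr eps2.
exists p => z z1; have [r0 r1] := andP hr.
have rz : normc (r%:C * z) < 1 by rewrite normcM z1 mulr1 normc_real ger0_norm.
apply: (le_trans (le_normc_trans _ (gelfand f (r%:C * z)) _)).
have := Hp z; rewrite z1 lexx => /(_ isT).
have := Hr z z1; rewrite normcB poisson_gelfand//; lra.
Qed.

(** The Poisson extension of a real function is the real part of an analytic
    function, and is uniformly close to the function near the circle. *)
Lemma real_circle_approx u : rcont u -> forall eps : R, 0 < eps ->
  exists p : {poly R[i]}, forall z, normc z = 1 -> `|u z - Re p.[z]| <= eps.
Proof.
move=> cu eps eps0; pose f z := (u z)%:C.
have cf : ccont f by split => //; exact: rcont_cst.
have iF := ccont_int cf.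
have eps2 : 0 < eps / 2 by rewrite divr_gt0.
have eps4 : 0 < eps / 4 by rewrite divr_gt0.
have [r [hr Hr]] := poisson_radial cf eps2.
have [p Hp] := gelfand_poly iF hr eps4.
exists (2 *: p - (cmean f)%:P) => z z1; have [r0 r1] := andP hr.
have rz : normc (r%:C * z) < 1 by rewrite normcM z1 mulr1 normc_real ger0_norm.
have := Hp z; rewrite z1 lexx => /(_ isT) /(le_trans (le_Re_normc _)).
have := Hr z z1 => /(le_trans (le_Re_normc _)).
rewrite poissonE//.
have -> : cmean (fun e => (1 - (r%:C * z)^* * e)^-1 * f e) = (gelfand f (r%:C * z))^*.
  rewrite gelfandE -cmeanJ; last exact: gelfand_cint.
  apply: eq_cmean => e _.
  by rewrite conj_kernel -conjc_inv [in RHS]rmorphM /= /f oppr0.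
rewrite !hornerE; move: (gelfand f _) (cmean f) p.[z] => G m P.
rewrite !(cReD, cReN, cReJ, cReM) /= add0r mul0r subr0.
rewrite !ler_norml; move=> /andP[h1 h2] /andP[h3 h4]; apply/andP; split; lra.
Qed.

Lemma continuous_unif_lim (h : R -> R) :
  (forall eps : R, 0 < eps -> exists2 k : R -> R, continuous k & forall t, `|h t - k t| <= eps) ->
  continuous h.
Proof.
move=> H t; apply/cvgrPdist_lt => eps eps0.
have eps3 : 0 < eps / 3 by rewrite divr_gt0.
have [k ck Hk] := H _ eps3.
have /cvgrPdist_lt /(_ _ eps3) := ck t; apply: filterS => s ks.
have h1 := Hk t; have h2 := Hk s.
have -> : h t - h s = (h t - k t) + ((k t - k s) - (h s - k s)) by ring.
apply: (le_lt_trans (ler_normD _ _)).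
have := ler_normB (k t - k s) (h s - k s); lra.
Qed.

Lemma circle_alg_ccont f : circle_alg f -> ccont f.
Proof.
move=> Af; split; apply: continuous_unif_lim => eps /Af[p Hp].
  exists (fun t => Re p.[expi t]) => [|t]; first by case: (ccont_horner p).
  by have := le_trans (le_Re_normc _) (Hp _ (normc_expi t)); rewrite cReD cReN.
exists (fun t => Im p.[expi t]) => [|t]; first by case: (ccont_horner p).
by have := le_trans (le_Im_normc _) (Hp _ (normc_expi t)); rewrite cImD cImN.
Qed.

Lemma disc_circle_alg f : disc_alg f -> circle_alg f.
Proof. by move=> Df eps /Df[p Hp]; exists p => z z1; apply: Hp; rewrite z1. Qed.

Lemma circle_alg_horner (p : {poly R[i]}) : circle_alg (fun z => p.[z]).
Proof.
by move=> eps eps0; exists p => z _; rewrite subrr normc0 ltW.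
Qed.

Lemma eq_circle_alg f g : (forall z, normc z = 1 -> f z = g z) -> circle_alg f -> circle_alg g.
Proof. by move=> fg Af eps /Af[p Hp]; exists p => z z1; rewrite -fg// Hp. Qed.

Lemma circle_alg_cst c : circle_alg (fun=> c).
Proof. by apply: eq_circle_alg (circle_alg_horner c%:P) => z _; rewrite hornerC. Qed.

Lemma circle_algB f g : circle_alg f -> circle_alg g -> circle_alg (fun z => f z - g z).
Proof.
move=> Af Ag eps eps0; have eps2 : 0 < eps / 2 by rewrite divr_gt0.
have [p Hp] := Af _ eps2; have [q Hq] := Ag _ eps2.
exists (p - q) => z z1; rewrite hornerD hornerN.
have -> : f z - g z - (p.[z] - q.[z]) = (f z - p.[z]) - (g z - q.[z]) by ring.
apply: (le_trans (le_normcB _ _)); have := Hp z z1; have := Hq z z1; lra.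
Qed.

Lemma normc_le_eps0 z (B : R) : 0 <= B -> (forall eps : R, 0 < eps -> normc z <= eps * B) -> z = 0.
Proof.
move=> B0 H; apply/eqP; rewrite -normc_eq0 eq_le normc_ge0 andbT.
apply/ler_addgt0Pr => eps eps0; rewrite add0r.
have B1 : 0 < B + 1 by rewrite ltr_wpDl.
have /H : 0 < eps / (B + 1) by rewrite divr_gt0.
move/le_trans; apply; rewrite mulrAC ler_pdivrMr// ler_pM2l//; lra.
Qed.

(** * Multiplication of the Hardy space by the disc algebra *)

Lemma H2_cst c : H2 (fun=> c).
Proof.
apply/H2P; split; first by apply: ccont_L2; exact: ccont_cst.
move=> n n0; under eq_cmean => e _ do rewrite mulrC.
rewrite cmeanZ ?cmeanX ?mulr0//.
by apply: ccont_int; apply: ccontX; exact: ccont_id.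
Qed.

Lemma powX_cint f n : cint f -> cint (fun z => z ^+ n * f z).
Proof. by move=> iF; apply: (powu_cint (u := id)) => //; exact: ccont_id. Qed.

Lemma H2D f g : H2 f -> H2 g -> H2 (fun z => f z + g z).
Proof.
move=> Hf Hg; have [/H2P[Lf f0] /H2P[Lg g0]] := (Hf, Hg).
apply/H2P; split; first by have [] := L2D Lf Lg.
move=> n n0; under eq_cmean => z _ do rewrite mulrDr.
by rewrite cmeanD ?f0 ?g0 ?addr0//; apply: powX_cint; exact: H2_cint.
Qed.

Lemma H2Z c f : H2 f -> H2 (fun z => c * f z).
Proof.
move=> /H2P[Lf f0]; apply/H2P; split.
  have [] // := L2M Lf (cmeas_cst c) (normc_ge0 c).
move=> n n0; under eq_cmean => z _ do rewrite mulrCA.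
by rewrite cmeanZ ?f0 ?mulr0//; apply: powX_cint; exact: L2_cint.
Qed.

Lemma eq_H2 f g : (forall z, normc z = 1 -> f z = g z) -> H2 f -> H2 g.
Proof.
move=> fg; suff E : (fun t => f (expi t)) = (fun t => g (expi t)).
  move=> /H2P[/L2_circleP[mf i2] f0]; apply/H2P; split.
    apply/L2_circleP; split; first exact: eq_cmeas mf.
    by apply: eq_rint i2 => z z1; rewrite fg.
  by move=> n /f0 <-; apply: eq_cmean => z z1; rewrite fg.
by apply/funext => t; apply: fg; rewrite normc_expi.
Qed.

Lemma L2_mulX f : L2_circle f -> L2_circle (fun z => z * f z).
Proof.
move=> Lf; have [] // := L2M Lf (ccont_meas (ccont_id R)) ler01.
by move=> z ->.
Qed.

Lemma H2_mulX f : H2 f -> H2 (fun z => z * f z).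
Proof.
move=> /H2P[Lf f0]; apply/H2P; split; first exact: L2_mulX.
by move=> n _; rewrite -(f0 n.+1)//; apply: eq_cmean => z _; rewrite exprSr mulrA.
Qed.

(** On the circle z / (1 - w / z) = z + w / (1 - w / z), and the first moment of f
    vanishes. *)
Lemma gelfand_mulX f w : normc w < 1 -> H2 f -> gelfand (fun z => z * f z) w = w * gelfand f w.
Proof.
move=> w1 Hf; have iF := H2_cint Hf.
rewrite -[RHS]add0r -(H2_moment Hf (n := 1%N))// !gelfandE.
rewrite -cmeanZ -?cmeanD; [|exact: powX_cint|by apply: cintZ; exact: gelfand_cint|exact: gelfand_cint].
apply: eq_cmean => e e1; rewrite expr1.
have k0 := kernel_neq0 (@normcJ_circle R) w1 e1.
apply: (mulfI k0); rewrite mulrA mulfV// mul1r mulrDr.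
have -> : (1 - w * e^*) * (w * ((1 - w * e^*)^-1 * f e)) =
   ((1 - w * e^*) / (1 - w * e^*)) * (w * f e) by ring.
rewrite mulfV// mul1r.
have -> : (1 - w * e^*) * (e * f e) = (e - w * (e * e^*)) * f e by ring.
by rewrite mulcJ e1 expr1n mulr1; ring.
Qed.

Lemma H2_horner (p : {poly R[i]}) f : H2 f ->
  H2 (fun z => p.[z] * f z) /\
  forall w, normc w < 1 -> gelfand (fun z => p.[z] * f z) w = p.[w] * gelfand f w.
Proof.
move=> Hf; elim/poly_ind: p => [|p c [IH1 IH2]].
  have E z : normc z = 1 -> 0 * f z = (0 : {poly R[i]}).[z] * f z by rewrite horner0.
  split; first exact: eq_H2 E (H2Z 0 Hf).
  move=> w w1; rewrite -(eq_gelfand w E) gelfandZ ?horner0//; exact: H2_cint.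
have E z : normc z = 1 -> z * (p.[z] * f z) + c * f z = (p * 'X + c%:P).[z] * f z.
  by move=> _; rewrite hornerMXaddC; ring.
have Hp := H2_mulX IH1; have Hc := H2Z c Hf.
split; first exact: eq_H2 E (H2D Hp Hc).
move=> w w1; rewrite -(eq_gelfand w E) gelfandD//; [|exact: H2_cint..].
rewrite gelfand_mulX// IH2// gelfandZ//; last exact: H2_cint.
by rewrite hornerMXaddC; ring.
Qed.

Lemma gelfand_horner (p : {poly R[i]}) w : normc w < 1 -> gelfand (fun z => p.[z]) w = p.[w].
Proof.
move=> w1; have [_ /(_ w w1)] := H2_horner p (H2_cst 1).
rewrite gelfand_cst// mulr1 => <-; by apply: eq_gelfand => z _; rewrite mulr1.
Qed.

Lemma gelfand_small s (p : {poly R[i]}) (eps : R) w : ccont s -> normc w < 1 ->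
  (forall z, normc z = 1 -> normc (s z - p.[z]) <= eps) ->
  normc (gelfand s w - p.[w]) <= (1 - normc w)^-1 * eps.
Proof.
move=> cs w1 Hp; have cp := ccont_horner p.
rewrite -(gelfand_horner p w1) -gelfandB//; [|exact: ccont_int..].
apply: (le_trans (gelfand_bound w1 _)).
  by apply: cintB; exact: ccont_int.
rewrite ler_wpM2l ?invr_ge0 ?subr_ge0 ?(ltW w1)// -[leRHS]rmean_cst.
apply: le_rmean => //; last exact: rint_cst.
by apply: cint_normc; apply: cintB; exact: ccont_int.
Qed.

Lemma cintMs s f : ccont s -> cint f -> cint (fun z => s z * f z).
Proof.
move=> cs iF; have [B _ HB] := ccont_bounded cs.
exact: cintM iF (ccont_meas cs) HB.
Qed.

Lemma rmean_small s f (eps : R) : ccont s -> cint f ->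
  (forall z, normc z = 1 -> normc (s z) <= eps) ->
  rmean (fun z => normc (s z * f z)) <= eps * rmean (fun z => normc (f z)).
Proof.
move=> cs iF Hs; rewrite -rmeanZ; last exact: cint_normc.
apply: le_rmean.
- by apply: cint_normc; exact: cintMs.
- by apply: rintZ; exact: cint_normc.
- by move=> z z1; rewrite normcM ler_wpM2r ?normc_ge0// Hs.
Qed.

(** True for polynomials; the estimates only involve the mean of the modulus of f
    and are uniform in the multiplier. *)
Lemma H2M s f : circle_alg s -> H2 f -> H2 (fun z => s z * f z).
Proof.
move=> As Hf; have cs := circle_alg_ccont As; have iF := H2_cint Hf.
have [B B0 HB] := ccont_bounded cs.
apply/H2P; split.
  by have [] := L2M (H2_L2 Hf) (ccont_meas cs) B0 HB.
move=> n n0; apply: (@normc_le_eps0 _ (rmean (fun z => normc (f z)))).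
  by apply: rmean_ge0 => z _; exact: normc_ge0.
move=> eps /As[p Hp]; have cp := ccont_horner p.
have [Hpf _] := H2_horner p Hf.
have cd : ccont (fun z => s z - p.[z]) by exact: ccontB.
have -> : cmean (fun z => z ^+ n * (s z * f z)) = cmean (fun z => z ^+ n * ((s z - p.[z]) * f z)).
  rewrite -[RHS]addr0 -(H2_moment Hpf n0) -cmeanD; [|exact: (powX_cint _ (cintMs _ _))..].
  by apply: eq_cmean => z _; ring.
apply: le_trans (rmean_small cd iF Hp).
apply: (le_trans (le_normc_cmean (powX_cint _ (cintMs cd iF)))).
apply: le_rmean; [by apply: cint_normc; apply: powX_cint; exact: cintMs|
  by apply: cint_normc; exact: cintMs|].
by move=> z z1; rewrite normcM normcX z1 expr1n mul1r.
Qed.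

Lemma gelfandM s f w : circle_alg s -> H2 f -> normc w < 1 ->
  gelfand (fun z => s z * f z) w = gelfand s w * gelfand f w.
Proof.
move=> As Hf w1; have cs := circle_alg_ccont As; have iF := H2_cint Hf.
apply/eqP; rewrite -subr_eq0; apply/eqP.
have w0 : 0 <= (1 - normc w)^-1 by rewrite invr_ge0 subr_ge0 ltW.
set m := rmean (fun z => normc (f z)).
have m0 : 0 <= m by apply: rmean_ge0 => z _; exact: normc_ge0.
apply: (@normc_le_eps0 _ ((1 - normc w)^-1 * (m + normc (gelfand f w)))).
  by rewrite mulr_ge0// addr_ge0// normc_ge0.
move=> eps /As[p Hp]; have cp := ccont_horner p.
have [Hpf Hpw] := H2_horner p Hf.
have cd : ccont (fun z => s z - p.[z]) by exact: ccontB.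
have -> : gelfand (fun z => s z * f z) w =
    gelfand (fun z => (s z - p.[z]) * f z) w + p.[w] * gelfand f w.
  rewrite -(Hpw _ w1) -gelfandD//; [|exact: cintMs..].
  by apply: eq_gelfand => z _; ring.
rewrite -addrA -mulrBl; apply: (le_trans (le_normcD _ _)).
rewrite mulrCA mulrDr mulrDr; apply: lerD.
  apply: (le_trans (gelfand_bound w1 (cintMs cd iF))).
  by rewrite ler_wpM2l//; exact: rmean_small.
rewrite normcM mulrA ler_wpM2r ?normc_ge0// normcB.
exact: gelfand_small.
Qed.

Lemma circle_alg_H2 s : circle_alg s -> H2 s.
Proof. by move=> As; apply: eq_H2 (H2M As (H2_cst 1)) => z _; rewrite mulr1. Qed.

Lemma circle_alg_cint s : circle_alg s -> cint s.
Proof. by move=> /circle_alg_ccont/ccont_int. Qed.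

Lemma circle_algP f : circle_alg f <->
  ccont f /\ forall n, (0 < n)%N -> cmean (fun e => e ^+ n * f e) = 0.
Proof.
split=> [Af|[cf f0]]; last exact: circle_alg_moments.
split; first exact: circle_alg_ccont.
by move=> n n0; apply: H2_moment => //; exact: circle_alg_H2.
Qed.

Lemma circle_algM f g : circle_alg f -> circle_alg g -> circle_alg (fun z => f z * g z).
Proof.
move=> Af Ag; apply/circle_algP; split.
  by apply: ccontM; exact: circle_alg_ccont.
by move=> n n0; apply: H2_moment => //; apply: H2M => //; exact: circle_alg_H2.
Qed.

(** The Poisson kernel is positive with mean 1. *)
Lemma gelfand_le s (B : R) w : circle_alg s -> (forall z, normc z = 1 -> normc (s z) <= B) ->
  normc w < 1 -> normc (gelfand s w) <= B.
Proof.
move=> As HB w1; have /circle_algP[cs s0] := As; have iS := ccont_int cs.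
rewrite -poisson_gelfand//; apply: (le_trans (le_normc_cmean (poisson_cint w1 iS))).
have rP : rint (poisson_kernel w) by have [/rcont_int] := poisson_kernel_ccont w1.
rewrite -[leRHS]mulr1 -(rmean_poisson_kernel w1) -rmeanZ//.
apply: le_rmean; [by apply: cint_normc; exact: poisson_cint|exact: rintZ|].
move=> z z1; rewrite normcM normc_real ger0_norm ?poisson_kernel_ge0// mulrC.
by rewrite ler_wpM2r ?poisson_kernel_ge0// HB.
Qed.

Lemma gelfand_disc_alg s w : disc_alg s -> normc w < 1 -> gelfand s w = s w.
Proof.
move=> Ds w1; have cs := circle_alg_ccont (disc_circle_alg Ds).
apply/eqP; rewrite -subr_eq0; apply/eqP.
have w0 : 0 <= (1 - normc w)^-1 by rewrite invr_ge0 subr_ge0 ltW.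
apply: (@normc_le_eps0 _ ((1 - normc w)^-1 + 1)); first by rewrite addr_ge0.
move=> eps /Ds[p Hp]; apply: (le_trans (le_normc_trans _ p.[w] _)).
rewrite mulrDr mulr1 mulrC; apply: lerD; last by rewrite normcB Hp// ltW.
by apply: gelfand_small => // z z1; apply: Hp; rewrite z1.
Qed.

Lemma gelfand_near0 f w : normc w <= 2^-1 -> cint f ->
  normc (gelfand f w - gelfand f 0) <= normc w * (2 * rmean (fun z => normc (f z))).
Proof.
move=> w2 iF; have w1 : normc w < 1 by lra.
rewrite gelfand0 gelfandE (kernel_expand (ccont_conj R) (@normcJ_circle R) w1 1 iF).
rewrite big_ord_recl big_ord0 addr0 expr0 mul1r (@eq_cmean _ _ f) => [|z _]; last by rewrite mul1r.
rewrite addrAC subrr add0r normcM expr1 ler_wpM2l ?normc_ge0//.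
apply: (le_trans (kernel_tail (ccont_conj R) (@normcJ_circle R) w1 1 iF)).
rewrite ler_wpM2r//; first by apply: rmean_ge0 => z _; exact: normc_ge0.
by rewrite -[leRHS]invrK lef_pV2 ?posrE//; lra.
Qed.

End Approximation.

(** * Analytic functions continuous on the closed disc *)

Section MaximumPrinciple.
Local Notation "z ^*" := (conjc z) : ring_scope.
Variable R : realType.
Implicit Types (z w c e : R[i]) (f g F G : R[i] -> R[i]).

(** A second order expansion whose polynomial part is harmonic.  Both analytic
    functions and Poisson integrals have one at every point, and it is all the
    maximum principle below uses. *)
Definition harmonic_jet g z : Prop := exists a b c d : R[i], exists K s0 : R,
  [/\ 0 <= K, 0 < s0 & forall w, normc w < s0 ->
  normc (g (z + w) - g z - (a * w + b * w^* + c * w ^+ 2 + d * w^* ^+ 2)) <= K * normc w ^+ 3].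

Lemma harmonic_jetD f g z : harmonic_jet f z -> harmonic_jet g z ->
  harmonic_jet (fun w => f w + g w) z.
Proof.
move=> [a [b [c [d [K [s [K0 s0 H]]]]]]] [a' [b' [c' [d' [K' [s' [K0' s0' H']]]]]]].
exists (a + a'), (b + b'), (c + c'), (d + d'), (K + K'), (Num.min s s'); split.
- exact: addr_ge0.
- by rewrite lt_min s0.
move=> w; rewrite lt_min => /andP[ws ws'].
have -> : f (z + w) + g (z + w) - (f z + g z) - ((a + a') * w + (b + b') * w^* +
    (c + c') * w ^+ 2 + (d + d') * w^* ^+ 2) =
  (f (z + w) - f z - (a * w + b * w^* + c * w ^+ 2 + d * w^* ^+ 2)) +
  (g (z + w) - g z - (a' * w + b' * w^* + c' * w ^+ 2 + d' * w^* ^+ 2)) by ring.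
by rewrite (le_trans (le_normcD _ _))// mulrDl lerD// ?H ?H'.
Qed.

Lemma harmonic_jetZ k g z : harmonic_jet g z -> harmonic_jet (fun w => k * g w) z.
Proof.
move=> [a [b [c [d [K [s [K0 s0 H]]]]]]].
exists (k * a), (k * b), (k * c), (k * d), (normc k * K), s; split => //.
  by rewrite mulr_ge0// normc_ge0.
move=> w ws; have -> : k * g (z + w) - k * g z - (k * a * w + k * b * w^* +
    k * c * w ^+ 2 + k * d * w^* ^+ 2) =
  k * (g (z + w) - g z - (a * w + b * w^* + c * w ^+ 2 + d * w^* ^+ 2)) by ring.
by rewrite normcM -mulrA ler_wpM2l ?normc_ge0// H.
Qed.

Definition imag : R[i] := 0 +i* 1.

Lemma normc_imag : normc imag = 1.
Proof. by rewrite /= expr0n /= expr1n add0r sqrtr1. Qed.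

Lemma imag_sqr : imag ^+ 2 = -1.
Proof. by apply: complex_eqP; rewrite expr2 ?cReM ?cImM /=; ring. Qed.

Lemma imagJ : imag^* = - imag.
Proof. by apply: complex_eqP => /=; rewrite ?oppr0. Qed.

Definition point_cont g z := forall eps : R, 0 < eps -> exists2 d : R, 0 < d &
  forall w, normc (w - z) < d -> normc (g w - g z) < eps.

Lemma harmonic_jet_cont g z : harmonic_jet g z -> point_cont g z.
Proof.
move=> [a [b [c [d [K [s [K0 s0 H]]]]]]] eps eps0.
pose M := normc a + normc b + normc c + normc d + K.
have M0 : 0 <= M by rewrite !addr_ge0 ?normc_ge0.
have M1 : 0 < M + 1 by rewrite ltr_wpDl.
exists (Num.min (Num.min s 1) (eps / (M + 1))).
  by rewrite !lt_min s0 ltr01 divr_gt0.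
move=> w'; rewrite !lt_min ltr_pdivlMr// => /andP[/andP[ws w1] we].
move: ws w1 we; set w := w' - z; have -> : w' = z + w by rewrite addrC subrK.
move=> ws w1 we; have n0 := normc_ge0 w.
have := H w ws; set E := g (z + w) - g z; set P := a * w + _ + _ + _ => HE.
have -> : E = (E - P) + P by rewrite subrK.
apply: (le_lt_trans (le_normcD _ _)).
have n2 : normc w ^+ 2 <= normc w by rewrite expr2 -[leRHS]mulr1 ler_wpM2l// ltW.
have n3 : normc w ^+ 3 <= normc w.
  by rewrite exprS -[leRHS]mulr1 ler_wpM2l// (le_trans n2)// ltW.
have PM : normc P <= (normc a + normc b + normc c + normc d) * normc w.
  have t k x : normc x <= normc w -> normc (k * x) <= normc k * normc w.
    by move=> xw; rewrite normcM ler_wpM2l ?normc_ge0.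
  have ta : normc (a * w) <= normc a * normc w by exact: t.
  have tb : normc (b * w^*) <= normc b * normc w by apply: t; rewrite normcJ.
  have tc : normc (c * w ^+ 2) <= normc c * normc w by apply: t; rewrite normcX.
  have td : normc (d * w^* ^+ 2) <= normc d * normc w by apply: t; rewrite normcX normcJ.
  have := le_normcD (a * w + b * w^* + c * w ^+ 2) (d * w^* ^+ 2).
  have := le_normcD (a * w + b * w^*) (c * w ^+ 2).
  by have := le_normcD (a * w) (b * w^*); rewrite -/P; lra.
have K3 : K * normc w ^+ 3 <= K * normc w by rewrite ler_wpM2l.
have : M * normc w <= normc w * (M + 1) by rewrite mulrC ler_wpM2l// lerDl.
have : (normc a + normc b + normc c + normc d) * normc w + K * normc w = M * normc w.
  by rewrite /M; ring.
lra.
Qed.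

(** The points z + w with w = s, -s, is, -is: the sums over them of w, w ^+ 2 and
    their conjugates vanish. *)
Lemma four_points g z : harmonic_jet g z -> exists K s0 : R, [/\ 0 <= K, 0 < s0 &
  forall s : R, 0 < s < s0 ->
  normc (g (z + s%:C) + g (z + (- s)%:C) + g (z + s%:C * imag) + g (z + (- s)%:C * imag) - 4 * g z)
    <= K * s ^+ 3].
Proof.
move=> [a [b [c [d [K [s1 [K0 s10 H]]]]]]].
exists (4 * K), s1; split => //; first exact: mulr_ge0.
move=> s /andP[s0 ss].
have n1 : normc s%:C = s by rewrite normc_real gtr0_norm.
have n2 : normc (- s)%:C = s by rewrite normc_real normrN gtr0_norm.
have ni := normc_imag.
have n3 : normc (s%:C * imag) = s by rewrite normcM ni mulr1.
have n4 : normc ((- s)%:C * imag) = s by rewrite normcM ni mulr1.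
have := H (s%:C); have := H ((- s)%:C); have := H (s%:C * imag); have := H ((- s)%:C * imag).
rewrite n1 n2 n3 n4 => /(_ ss) h4 /(_ ss) h3 /(_ ss) h2 /(_ ss) h1.
have i2 := imag_sqr.
have e2 : (- s)%:C = - s%:C by rewrite rmorphN.
have cI (x : R) : (x%:C * imag)^* = x%:C * - imag.   by rewrite conjcM imagJ; congr (_ * _); exact: conjc_real.
move: h1 h2 h3 h4; rewrite !cI !conjc_real e2.
set A1 := (X in normc X <= _); move=> h1.
set A2 := (X in normc X <= _); move=> h2.
set A3 := (X in normc X <= _); move=> h3.
set A4 := (X in normc X <= _); move=> h4.
have -> : g (z + s%:C) + g (z + - s%:C) + g (z + s%:C * imag) + g (z + - s%:C * imag) - 4 * g z =
    A1 + A2 + A3 + A4.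
  rewrite /A1 /A2 /A3 /A4.
  have E k : k * (s%:C * imag) ^+ 2 = - (k * s%:C ^+ 2) by rewrite exprMn i2; ring.
  have E1 k : k * (s%:C * - imag) ^+ 2 = - (k * s%:C ^+ 2) by rewrite exprMn sqrrN i2; ring.
  have E2 k : k * (- s%:C * imag) ^+ 2 = - (k * s%:C ^+ 2) by rewrite exprMn i2; ring.
  have E3 k : k * (- s%:C * - imag) ^+ 2 = - (k * s%:C ^+ 2).
    by rewrite exprMn !sqrrN i2; ring.
  by rewrite E E1 E2 E3; ring.
have := le_normcD (A1 + A2 + A3) A4; have := le_normcD (A1 + A2) A3.
have := le_normcD A1 A2; lra.
Qed.

Lemma tcont_near (T : topologicalType) (p : T -> R[i]) x (d : R) : tcont p -> 0 < d ->
  \forall y \near x, normc (p y - p x) < d.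
Proof.
move=> [c1 c2] d0; have d2 : 0 < d / 2 by rewrite divr_gt0.
have /cvgrPdist_lt /(_ _ d2) h1 := c1 x; have /cvgrPdist_lt /(_ _ d2) h2 := c2 x.
near=> y; apply: (le_lt_trans (le_normc_ReIm _)).
rewrite cReD cReN cImD cImN distrC [`|Im _ - _|]distrC [ltRHS](splitr d) ltrD//.
  by near: y; exact: h1.
by near: y; exact: h2.
Unshelve. all: by end_near. Qed.

Lemma tcont_comp (T : topologicalType) (p : T -> R[i]) g : tcont p ->
  (forall x (eps : R), 0 < eps -> exists2 d : R, 0 < d &
    forall y, normc (p y - p x) < d -> normc (g (p y) - g (p x)) < eps) ->
  tcont (fun x => g (p x)).
Proof.
move=> cp H; split => x; apply/cvgrPdist_lt => eps eps0; have [d d0 Hd] := H x _ eps0;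
  have := tcont_near x cp d0; apply: filterS => y /Hd; rewrite normcB; apply: le_lt_trans.
  by rewrite -cReN -cReD le_Re_normc.
by rewrite -cImN -cImD le_Im_normc.
Qed.

(** Polar coordinates with the radius clamped to [0, r], so that the map is
    continuous on the whole plane with values in a closed disc. *)
Definition polar (r : R) (x : R * R) : R[i] := (Num.max 0 (Num.min x.1 r))%:C * expi x.2.

Lemma normc_polar r x : 0 <= r -> normc (polar r x) <= r.
Proof.
move=> r0; rewrite normcM normc_expi mulr1 normc_real ger0_norm ?le_max ?lexx//.
by rewrite ge_max r0 /= ge_min lexx orbT.
Qed.

Lemma polar_surj r z : normc z <= r -> exists2 x, (`[0, r] `*` `[0, 2 * pi]) x & z = polar r x.
Proof.
move=> zr; have [->|z0] := eqVneq z 0.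
  have r0 : 0 <= r by apply: le_trans zr; exact: normc_ge0.
  exists (0, 0).
    by split; rewrite /= in_itv /= lexx ?r0//= ltW// mulr_gt0// pi_gt0.
  by rewrite /polar /= (min_l r0) max_l// rmorph0 mul0r.
have n0 : 0 < normc z by rewrite normc_gt0.
have e1 : normc (z / (normc z)%:C) = 1.
  by rewrite normcM normcV normc_real ger0_norm ?normc_ge0// divff// gt_eqF.
have [t /andP[t0 t1] Et] := circle_expi e1.
exists (normc z, t).
  by split; rewrite /= in_itv /= ?normc_ge0 ?t0//= ltW.
rewrite /polar /= (min_l zr) max_r ?normc_ge0// -Et mulrCA divff ?mulr1//.
by rewrite -normc_eq0 normc_real normr_eq0 gt_eqF.
Qed.

Lemma polar_tcont r : tcont (polar r).
Proof.
have cm : continuous (fun x : R * R => Num.max 0 (Num.min x.1 r)).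
  move=> x; apply: (@continuous_max _ _ (fun=> 0) (fun x : R * R => Num.min x.1 r)).
    exact: cvg_cst.
  by apply: continuous_min; [exact: cvg_fst|exact: cvg_cst].
have ct (u : R -> R) : continuous u -> continuous (fun x : R * R => u x.2).
  by move=> cu x; apply: continuous_comp; [exact: cvg_snd|exact: cu].
split.
  rewrite (_ : (fun x => _) = (fun x : R * R => Num.max 0 (Num.min x.1 r) * cos x.2)).
    by move=> x; exact: (cvgM (cm x) (ct _ (@continuous_cos R) x)).
  by apply/funext => x; rewrite /polar cReM /= mul0r subr0.
rewrite (_ : (fun x => _) = (fun x : R * R => Num.max 0 (Num.min x.1 r) * sin x.2)).
  by move=> x; exact: (cvgM (cm x) (ct _ (@continuous_sin R) x)).
by apply/funext => x; rewrite /polar cImM /= mul0r addr0.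
Qed.

Lemma polar_compact r : compact (`[0, r] `*` `[0, 2 * pi] : set (R * R)).
Proof. by apply: compact_setX; exact: segment_compact. Qed.

(** Adding a small multiple of the squared modulus makes the function strictly
    smaller at every interior point than its average over some four
    neighbours, hence rules out interior maxima. *)
Lemma max_principle g : (forall z, normc z < 1 -> harmonic_jet g z) ->
  (forall eps : R, 0 < eps -> exists2 r : R, r < 1 &
    forall z, r <= normc z -> normc z < 1 -> normc (g z) <= eps) ->
  forall z, normc z < 1 -> g z = 0.
Proof.
move=> jg bg z z1.
suff H c : Re (c * g z) <= 0.
  have := H (g z)^*; rewrite mulrC mulcJ /= => h.
  have : normc (g z) ^+ 2 == 0 by rewrite eq_le h sqr_ge0.
  by rewrite sqrf_eq0 normc_eq0 => /eqP.
have cN : 0 < normc c + 1 by rewrite ltr_wpDl ?normc_ge0.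
apply/ler_addgt0Pr => del del0; rewrite add0r.
pose eps := del / (normc c + 1); have eps0 : 0 < eps by rewrite divr_gt0.
have [r1 r11 Hr1] := bg _ eps0.
pose r := Num.max r1 (normc z); have r_lt1 : r < 1 by rewrite gt_max r11.
have zr : normc z <= r by rewrite le_max lexx orbT.
have r0 : 0 <= r by apply: le_trans zr; exact: normc_ge0.
pose h w := Re (c * g w) + eps * normc w ^+ 2.
have ch : continuous (fun x => h (polar r x)).
  have pr x : normc (polar r x) < 1 by apply: le_lt_trans r_lt1; exact: normc_polar.
  have [cg _] : tcont (fun x => (fun w => c * g w) (polar r x)).
    apply: (@tcont_comp _ (polar r) (fun w => c * g w) (@polar_tcont r)).
    move=> x e e0; have [d d0 Hd] := harmonic_jet_cont (harmonic_jetZ c (jg _ (pr x))) e0.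
    by exists d => // y; exact: Hd.
  have [p1 p2] := polar_tcont r.
  have cn : continuous (fun x => normc (polar r x) ^+ 2).
    rewrite (_ : (fun x => _) = (fun x => Re (polar r x) * Re (polar r x) + Im (polar r x) * Im (polar r x))).
      by move=> x; exact: (cvgD (cvgM (p1 x) (p1 x)) (cvgM (p2 x) (p2 x))).
    by apply/funext => y; rewrite normc_sqr !expr2.
  have cm : continuous (fun x => eps * normc (polar r x) ^+ 2).
    by move=> x; apply: cvgM (cn x); exact: cvg_cst.
  by move=> x; exact: (cvgD (cg x) (cm x)).
have [x0 Kx0 Ez] := polar_surj zr.
have K0 : (`[0, r] `*` `[0, 2 * pi] : set (R * R)) !=set0 by exists x0.
have [x1] := compact_EVT_max K0 (@polar_compact r) (continuous_subspaceT ch).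
rewrite inE => Kx1 hmax; set w0 := polar r x1 in hmax.
have hz : h z <= h w0 by rewrite Ez; apply: hmax; rewrite inE.
have hm w : normc w <= r -> h w <= h w0.
  by move=> /polar_surj[x Kx ->]; apply: hmax; rewrite inE.
have w0r : normc w0 <= r by exact: normc_polar.
have w01 : normc w0 < 1 by exact: le_lt_trans r_lt1.
have w0E : r <= normc w0.
  rewrite leNgt; apply/negP => w0lt.
  have [K [s0 [Kge s0gt HK]]] := four_points (harmonic_jetZ c (jg _ w01)).
  have K1 : 0 < K + 1 by rewrite ltr_wpDl.
  (* The gain 4 eps s ^+ 2 of the squared modulus beats the error K s ^+ 3. *)
  pose s := Num.min (Num.min (s0 / 2) (r - normc w0)) (eps / (K + 1)).
  have s_gt0 : 0 < s by rewrite !lt_min subr_gt0 w0lt !divr_gt0.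
  have ss0 : s < s0.
    by apply: (@le_lt_trans _ _ (s0 / 2)); [rewrite !ge_min lexx|lra].
  have sr : normc w0 + s <= r.
    by rewrite -lerBrDl !ge_min lexx orbT.
  have sK : s * (K + 1) <= eps by rewrite -ler_pdivlMr// !ge_min lexx !orbT.
  have hs : 0 < s < s0 by rewrite s_gt0.
  have := HK s hs => /(le_trans (le_Re_normc _)).
  have nb x : normc x = s -> normc (w0 + x) <= r.
    by move=> xs; apply: le_trans sr; rewrite -xs; exact: le_normcD.
  have n1 : normc s%:C = s by rewrite normc_real gtr0_norm.
  have n2 : normc (- s)%:C = s by rewrite normc_real normrN gtr0_norm.
  have ni := normc_imag.
  have n3 : normc (s%:C * imag) = s by rewrite normcM ni mulr1.
  have n4 : normc ((- s)%:C * imag) = s by rewrite normcM ni mulr1.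
  have := hm _ (nb _ n1); have := hm _ (nb _ n2); have := hm _ (nb _ n3); have := hm _ (nb _ n4).
  rewrite /h !normc_sqr.
  move: (g (w0 + s%:C)) (g (w0 + (- s)%:C)) (g (w0 + s%:C * imag)) (g (w0 + (- s)%:C * imag)).
  move: (g w0) => G G1 G2 G3 G4.
  rewrite !(cReD, cImD, cReM, cImM, cReN) /= ler_norml => i4 i3 i2 i1 /andP[i5 _].
  have s3 : K * s ^+ 3 <= eps * s ^+ 2.
    rewrite exprS mulrA ler_wpM2r ?sqr_ge0//; nra.
  have s2 : 0 < eps * s ^+ 2 by rewrite mulr_gt0// exprn_gt0.
  nra.
have gw0 := Hr1 w0 (le_trans _ w0E) w01; rewrite le_max lexx in gw0.
have h1 : Re (c * g z) <= h z.
  by rewrite lerDl mulr_ge0 ?sqr_ge0// ltW.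
have h2 : h w0 <= normc c * eps + eps.
  rewrite /h; apply: lerD.
    apply: (le_trans (ler_norm _)); apply: (le_trans (le_Re_normc _)).
    by rewrite normcM ler_wpM2l ?normc_ge0// gw0.
  rewrite -[leRHS]mulr1 ler_wpM2l ?(ltW eps0)// expr_le1 ?normc_ge0//; exact: ltW.
apply: (le_trans h1); apply: (le_trans hz); apply: (le_trans h2).
have -> : normc c * eps + eps = eps * (normc c + 1) by ring.
by rewrite /eps divfK// gt_eqF.
Qed.

End MaximumPrinciple.

Section AnalyticDisc.
Variable R : realType.
Local Notation "z ^*" := (conjc z) : ring_scope.
Implicit Types (z w c e : R[i]) (f g F G : R[i] -> R[i]).

(** With k = 1 / (1 - w0 v), the remainder of the expansion of 1 / (1 - (w0 + w) v)
    is w ^+ 3 (v k) ^+ 3 / (1 - (w0 + w) v), and both denominators are bounded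
    below uniformly on the circle. *)
Lemma kernel_jet (v : R[i] -> R[i]) f w0 : ccont v ->
  (forall z, normc z = 1 -> normc (v z) = 1) -> cint f -> normc w0 < 1 ->
  exists c1 c2 : R[i], exists K s0 : R, [/\ 0 <= K, 0 < s0 & forall w, normc w < s0 ->
    normc (cmean (fun z => (1 - (w0 + w) * v z)^-1 * f z) -
      cmean (fun z => (1 - w0 * v z)^-1 * f z) - (c1 * w + c2 * w ^+ 2)) <= K * normc w ^+ 3].
Proof.
move=> cv v1 iF w1; pose d := 1 - normc w0.
have d0 : 0 < d by rewrite subr_gt0.
pose k z := (1 - w0 * v z)^-1.
have iv g : cint g -> cint (fun z => v z * g z).
  move=> ig; apply: (cintM ig (ccont_meas cv) (B := 1)) => z z1; by rewrite v1.
have ik g : cint g -> cint (fun z => k z * g z) by move=> ig; apply: kernel_cint.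
have ivk n : cint (fun z => (v z * k z) ^+ n * f z).
  elim: n => [|n IH]; first by apply: eq_cint iF => z _; rewrite mul1r.
  by apply: eq_cint (iv _ (ik _ IH)) => z _; rewrite exprS; ring.
pose m := rmean (fun z => normc (f z)).
have m0 : 0 <= m by apply: rmean_ge0 => z _; exact: normc_ge0.
exists (cmean (fun z => k z * ((v z * k z) ^+ 1 * f z))).
exists (cmean (fun z => k z * ((v z * k z) ^+ 2 * f z))).
exists ((d / 2)^-1 * (d^-1 ^+ 3 * m)), (d / 2).
have d2 : 0 < d / 2 by rewrite divr_gt0.
have dV0 : 0 <= d^-1 by rewrite invr_ge0 ltW.
have dV20 : 0 <= (d / 2)^-1 by rewrite invr_ge0 ltW.
split=> //; first by apply: mulr_ge0 => //; apply: mulr_ge0 => //; exact: exprn_ge0.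
move=> w ws.
have ww : normc (w0 + w) <= 1 - d / 2.
  by apply: (le_trans (le_normcD _ _)); rewrite /d; move: ws; rewrite /d; lra.
have ww1 : normc (w0 + w) < 1 by apply: le_lt_trans ww _; lra.
have ik' g : cint g -> cint (fun z => (1 - (w0 + w) * v z)^-1 * g z) by move=> ig; apply: kernel_cint.
rewrite -!(mulrC w) -!(mulrC (w ^+ 2)).
have -> : cmean (fun z => (1 - (w0 + w) * v z)^-1 * f z) - cmean (fun z => k z * f z) -
   (w * cmean (fun z => k z * ((v z * k z) ^+ 1 * f z)) +
    w ^+ 2 * cmean (fun z => k z * ((v z * k z) ^+ 2 * f z))) =
   w ^+ 3 * cmean (fun z => (1 - (w0 + w) * v z)^-1 * ((v z * k z) ^+ 3 * f z)).
  rewrite -!cmeanZ -?cmeanB -?cmeanD -?cmeanB;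
    do ?[exact: ik' | exact: ik | apply: ik' | apply: ik | apply: cintZ | apply: cintB | apply: cintD | exact: ivk | exact: iF].
  apply: eq_cmean => z z1.
  have k0 := kernel_neq0 v1 w1 z1; have k0' := kernel_neq0 v1 ww1 z1.
  by rewrite /k; field; rewrite k0 k0'.
rewrite normcM normcX mulrC ler_wpM2r ?exprn_ge0 ?normc_ge0//.
apply: (le_trans (le_normc_cmean (ik' _ (ivk 3)))).
rewrite -!rmeanZ; [|by apply: rintZ; apply: cint_normc|by apply: cint_normc].
apply: le_rmean; [by apply: cint_normc; apply: ik'|by do 2!apply: rintZ; apply: cint_normc|].
move=> z z1; rewrite normcM (normcM (_ ^+ 3)) normcX (normcM (v z)) v1// mul1r.
have kd : normc (k z) <= d^-1 by exact: kernel_bound.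
have kd' : normc (1 - (w0 + w) * v z)^-1 <= (d / 2)^-1.
  apply: (le_trans (kernel_bound v1 ww1 z1)).
  by rewrite lef_pV2 ?posrE ?subr_gt0 ?divr_gt0//; lra.
rewrite [leLHS]mulrA [leRHS]mulrA ler_wpM2r ?normc_ge0//.
apply: ler_pM => //; first exact: normc_ge0.
  by rewrite exprn_ge0 ?normc_ge0.
by rewrite lerXn2r ?nnegrE ?normc_ge0.
Qed.

Lemma poisson_harmonic_jet f z : cint f -> normc z < 1 -> harmonic_jet (poisson f) z.
Proof.
move=> iF z1.
have [c1 [c2 [K [s [K0 s0 H]]]]] := kernel_jet (ccont_conj R) (@normcJ_circle R) iF z1.
have zJ1 : normc z^* < 1 by rewrite normcJ.
have [d1 [d2 [L [t [L0 t0 G]]]]] := kernel_jet (@ccont_id R) (fun _ h => h) iF zJ1.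
exists c1, d1, c2, d2, (K + L), (Num.min (Num.min s t) (1 - normc z)).
split; [exact: addr_ge0|by rewrite !lt_min s0 t0 subr_gt0|].
move=> w; rewrite !lt_min => /andP[/andP[ws wt] wz].
have zw1 : normc (z + w) < 1 by apply: (le_lt_trans (le_normcD _ _)); lra.
have wJt : normc w^* < t by rewrite normcJ.
have zwJ : (z + w)^* = z^* + w^* by exact: rmorphD.
rewrite !poissonE// !gelfandE zwJ.
have := H w ws; have := G w^* wJt; rewrite normcJ.
set A := cmean _; set B := cmean _; move=> h2.
set A' := cmean _; set B' := cmean _; move=> h1.
have -> : A' + A - cmean f - (B' + B - cmean f) - (c1 * w + d1 * w^* + c2 * w ^+ 2 + d2 * w^* ^+ 2) =
  (A' - B' - (c1 * w + c2 * w ^+ 2)) + (A - B - (d1 * w^* + d2 * w^* ^+ 2)) by ring.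
by apply: (le_trans (le_normcD _ _)); rewrite mulrDl lerD.
Qed.

Lemma cvg_normc (u : nat -> R[i]) l : u n @[n --> \oo] --> l ->
  forall eps : R, 0 < eps -> exists N, forall n, (N <= n)%N -> normc (l - u n) < eps.
Proof.
move=> /cvgrPdist_lt H eps eps0.
have e0 : 0 < eps%:C by rewrite ltcR.
have [N _ HN] := H _ e0; exists N => n Nn.
by have := HN n Nn; rewrite /= normc_norm ltcR.
Qed.

Definition analytic_jet f z : Prop := exists c1 c2 : R[i], exists K s0 : R,
  [/\ 0 <= K, 0 < s0 & forall w, normc w < s0 ->
    normc (f (z + w) - f z - (c1 * w + c2 * w ^+ 2)) <= K * normc w ^+ 3].

(** The terms of the series at a point of modulus d are bounded, so its tail from
    degree 3 on is dominated by a geometric series at points of modulus at most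
    d / 2. *)
Lemma analytic_on_jet f z : analytic_on (unit_disc (R := R)) f -> normc z < 1 ->
  analytic_jet f z.
Proof.
move=> af /unit_discE/af[r [r0 [c Hc]]].
have Hs w : normc w < r -> forall eps : R, 0 < eps -> exists N, forall n, (N <= n)%N ->
    normc (f (z + w) - \sum_(0 <= k < n) c k * w ^+ k) < eps.
  move=> wr eps eps0; have E : z + w - z = w by rewrite addrC addKr.
  have h : `|z + w - z| < r%:C by rewrite E normc_norm ltcR.
  by move: (Hc _ h); rewrite E => hc; exact: (cvg_normc hc eps0).
have fz : f z = c 0%N.
  apply/eqP; rewrite -subr_eq0; apply/eqP; apply: (@normc_le_eps0 _ _ 1) => // eps eps0.
  have n0 : normc (0 : R[i]) < r by rewrite normc0.
  have [N HN] := Hs 0 n0 _ eps0.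
  have := HN N.+1 (leqnSn N); rewrite addr0 big_nat_recl// big1 => [|k _].
    by rewrite expr0 mulr1 addr0 mulr1 => /ltW.
  by rewrite expr0n mulr0.
pose d := r / 2; have d0 : 0 < d by rewrite divr_gt0.
have nd : normc d%:C = d by rewrite normc_real gtr0_norm.
have ndr : normc d%:C < r by rewrite nd /d; lra.
have [N HN] := Hs _ ndr _ ltr01.
pose B := \sum_(k < N) (normc (c k) * d ^+ k) + 2.
have B0 : 0 <= B by rewrite addr_ge0// sumr_ge0// => k _; rewrite mulr_ge0 ?normc_ge0// exprn_ge0// ltW.
have cB k : normc (c k) * d ^+ k <= B.
  have t0 j : 0 <= normc (c j) * d ^+ j by rewrite mulr_ge0 ?normc_ge0// exprn_ge0// ltW.
  have [kN|Nk] := ltnP k N.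
    rewrite /B (bigD1 (Ordinal kN))//= -addrA lerDl addr_ge0// sumr_ge0//.
  have h1 := HN k Nk; have h2 := HN k.+1 (leqW Nk).
  move: h2; rewrite big_nat_recr//= => h2.
  have -> : normc (c k) * d ^+ k = normc (c k * d%:C ^+ k) by rewrite normcM normcX nd.
  set S := \sum_(0 <= _ < k) _ in h1 h2.
  have -> : c k * d%:C ^+ k = (f (z + d%:C) - S) - (f (z + d%:C) - (S + c k * d%:C ^+ k)) by ring.
  apply: (le_trans (le_normcB _ _)).
  have : 0 <= \sum_(k < N) (normc (c k) * d ^+ k) by rewrite sumr_ge0.
  by rewrite /B; lra.
exists (c 1%N), (c 2%N), (2 * B / d ^+ 3), (d / 2).
have d30 : 0 <= d ^+ 3 by rewrite exprn_ge0// ltW.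
split; [by apply: divr_ge0 => //; exact: mulr_ge0|by rewrite divr_gt0|].
move=> w ws; have n0 := normc_ge0 w.
pose x := normc w / d; have x0 : 0 <= x by rewrite divr_ge0// ltW.
have x2 : x <= 2^-1 by rewrite ler_pdivrMr//; move: ws; lra.
have tail n : normc (\sum_(0 <= k < n.+3) c k * w ^+ k - c 0%N - (c 1%N * w + c 2%N * w ^+ 2)) <=
    B * x ^+ 3 * (2 - 2 * 2^-1 ^+ n).
  elim: n => [|n IH].
    have -> : B * x ^+ 3 * (2 - 2 * 2^-1 ^+ 0) = 0 by rewrite expr0; ring.
    rewrite !big_nat_recr//= big_geq//.
    by rewrite (_ : _ - _ - _ = 0) ?normc0//; ring.
  rewrite big_nat_recr//=; set S := \sum_(0 <= _ < _) _ in IH *.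
  have -> : S + c n.+3 * w ^+ n.+3 - c 0%N - (c 1%N * w + c 2%N * w ^+ 2) =
    (S - c 0%N - (c 1%N * w + c 2%N * w ^+ 2)) + c n.+3 * w ^+ n.+3 by ring.
  apply: (le_trans (le_normcD _ _)).
  have step : normc (c n.+3 * w ^+ n.+3) <= B * x ^+ 3 * 2^-1 ^+ n.
    rewrite normcM normcX.
    have -> : normc w = d * x by rewrite /x mulrCA divff ?mulr1// gt_eqF.
    have -> : normc (c n.+3) * (d * x) ^+ n.+3 =
      normc (c n.+3) * d ^+ n.+3 * (x ^+ 3 * x ^+ n).
      by rewrite exprMn -exprD mulrA.
    rewrite -[leRHS]mulrA.
    apply: ler_pM => //.
    - by apply: mulr_ge0; [exact: normc_ge0|rewrite exprn_ge0// ltW].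
    - by apply: mulr_ge0; exact: exprn_ge0.
    - by rewrite ler_wpM2l ?exprn_ge0// lerXn2r ?nnegrE.
  rewrite [2^-1 ^+ n.+1]exprS; have : 0 <= B * x ^+ 3 by apply: mulr_ge0 => //; exact: exprn_ge0.
  move: IH step; set Q := B * x ^+ 3; move: (2^-1 ^+ n) => y IH step Q0.
  have -> : Q * (2 - 2 * (2^-1 * y)) = Q * (2 - 2 * y) + Q * y by field.
  lra.
have -> : 2 * B / d ^+ 3 * normc w ^+ 3 = 2 * (B * x ^+ 3).
  have -> : x ^+ 3 = normc w ^+ 3 / d ^+ 3 by rewrite /x exprMn exprVn.
  by ring.
have wr : normc w < r by move: ws; rewrite /d; lra.
apply/ler_addgt0Pr => eps eps0; have [M HM] := Hs w wr _ eps0.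
have h1 : normc (f (z + w) - \sum_(0 <= k < M.+3) c k * w ^+ k) < eps.
  by apply: HM; rewrite -addn3 leq_addr.
have h2 := tail M.
have -> : f (z + w) - f z - (c 1%N * w + c 2%N * w ^+ 2) =
   (\sum_(0 <= k < M.+3) c k * w ^+ k - c 0%N - (c 1%N * w + c 2%N * w ^+ 2)) +
   (f (z + w) - \sum_(0 <= k < M.+3) c k * w ^+ k) by rewrite fz; ring.
apply: (le_trans (le_normcD _ _)); apply: lerD; last exact: ltW.
apply: (le_trans h2).
have y0 : 0 <= (2^-1 : R) ^+ M by rewrite exprn_ge0// invr_ge0.
have : 0 <= B * x ^+ 3 by apply: mulr_ge0 => //; exact: exprn_ge0.
nra.
Qed.

Lemma mulX_jet f z : analytic_jet f z -> analytic_jet (fun w => w * f w) z.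
Proof.
move=> [c1 [c2 [K [s [K0 s0 H]]]]].
exists (z * c1 + f z), (z * c2 + c1), (normc c2 + (normc z + s) * K), s.
have zs : 0 <= normc z + s by rewrite addr_ge0 ?normc_ge0// ltW.
split => //; first by rewrite addr_ge0 ?normc_ge0// mulr_ge0.
move=> w ws; have := H w ws; set E := _ - (c1 * w + _) => HE.
have -> : (z + w) * f (z + w) - z * f z - ((z * c1 + f z) * w + (z * c2 + c1) * w ^+ 2) =
  c2 * w ^+ 3 + (z + w) * E by rewrite /E; ring.
apply: (le_trans (le_normcD _ _)); rewrite [leRHS]mulrDl normcM normcX lerD2l normcM -[leRHS]mulrA.
apply: ler_pM; rewrite ?normc_ge0//.
by apply: (le_trans (le_normcD _ _)); rewrite lerD2l ltW.
Qed.

Definition closed_ucont f := forall eps : R, 0 < eps -> exists2 d : R, 0 < d &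
  forall z w, normc z <= 1 -> normc w <= 1 -> normc (z - w) < d -> normc (f z - f w) < eps.

Lemma within_closed_disc f z : {within closed_unit_disc (R := R), continuous f} -> normc z <= 1 ->
  forall eps : R, 0 < eps -> exists2 d : R, 0 < d &
  forall w, normc w <= 1 -> normc (w - z) < d -> normc (f w - f z) < eps.
Proof.
move=> cf z1 eps eps0.
have Dz : closed_unit_disc z by apply/closed_unit_discE.
have /subspace_continuousP /(_ z Dz) := cf.
move=> /cvgrPdist_lt /(_ eps%:C) []; first by rewrite ltcR.
move=> d /= d0 Hd.
have dE : d = (Re d)%:C by rewrite RRe_real// gtr0_real.
exists (Re d); first by rewrite -ltcR -dE.
move=> w w1 wd; have := Hd w; rewrite /= normcB -ltcR -normc_norm; apply.
  by rewrite normc_norm dE ltcR normcB.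
by apply/closed_unit_discE.
Qed.

Lemma within_closed_ucont f : {within closed_unit_disc (R := R), continuous f} -> closed_ucont f.
Proof.
move=> cf eps eps0.
have cg : tcont (fun x => f (polar 1 x)).
  split => x; apply/cvgrPdist_lt => e e0;
    have [d d0 Hd] := within_closed_disc cf (normc_polar x ler01) e0;
    have := tcont_near x (@polar_tcont R 1) d0; apply: filterS => y /(Hd _ (normc_polar y ler01));
    rewrite normcB; apply: le_lt_trans.
    by rewrite -cReN -cReD le_Re_normc.
  by rewrite -cImN -cImD le_Im_normc.
have [|d d0 H] := heine (@polar_compact R 1) (@polar_tcont R 1) cg _ eps0.
  by move=> x y _ _ ->.
exists d => // z w /polar_surj[x Kx ->] /polar_surj[y Ky ->]; exact: H.
Qed.

Lemma within_ccont f : {within closed_unit_disc (R := R), continuous f} -> ccont f.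
Proof.
move=> cf; have ce : tcont (@expi R) by split; [exact: continuous_cos|exact: continuous_sin].
have e1 (t : R) : normc (expi t) <= 1 by rewrite normc_expi.
split => x; apply/cvgrPdist_lt => e e0;
  have [d d0 Hd] := within_closed_disc cf (e1 x) e0;
  have := tcont_near x ce d0; apply: filterS => y /(Hd _ (e1 y));
  rewrite normcB; apply: le_lt_trans.
  by rewrite -cReN -cReD le_Re_normc.
by rewrite -cImN -cImD le_Im_normc.
Qed.

(** The difference with the Poisson integral has harmonic jets and, by uniform
    continuity, tends to zero at the boundary. *)
Lemma poisson_reproduces f : ccont f -> closed_ucont f ->
  (forall z, normc z < 1 -> analytic_jet f z) ->
  forall z, normc z < 1 -> f z = poisson f z.
Proof.
move=> cf uf jf z z1; have iF := ccont_int cf.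
apply/eqP; rewrite -subr_eq0 -[poisson f z]mul1r -mulNr; apply/eqP.
apply: (@max_principle _ (fun z => f z + (- 1) * poisson f z)) => // {z z1}.
  move=> z z1; apply: harmonic_jetD; last first.
    by apply: harmonic_jetZ; exact: poisson_harmonic_jet.
  have [c1 [c2 [K [s0 [K0 s00 H]]]]] := jf z z1.
  by exists c1, 0, c2, 0, K, s0; split => // w /H; rewrite !mul0r !addr0.
move=> eps eps0; have eps2 : 0 < eps / 2 by rewrite divr_gt0.
have [d d0 Hd] := uf _ eps2.
have [d' d0' Hd'] := poisson_approx cf (ccont_ucont cf) eps2.
exists (Num.max (2^-1) (1 - Num.min d d' / 2)).
  rewrite gt_max; apply/andP; split; first lra.
  by rewrite ltrBlDr ltrDl divr_gt0// lt_min d0.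
move=> z; rewrite ge_max => /andP[z2 zd] z1.
have n0 : 0 < normc z by apply: lt_le_trans z2; rewrite invr_gt0.
have zN0 : (normc z)%:C != 0 by rewrite -normc_eq0 normc_real normr_eq0 gt_eqF.
pose e := z / (normc z)%:C.
have e1 : normc e = 1.
  by rewrite normcM normcV normc_real ger0_norm ?normc_ge0// divff// gt_eqF.
have ze : z - e = (normc z - 1)%:C * e.
  by rewrite rmorphB rmorph1 mulrBl mul1r /e mulrCA divff// mulr1.
have nze : normc (z - e) = 1 - normc z.
  by rewrite ze normcM e1 mulr1 normc_real ler0_norm ?opprB// subr_le0 ltW.
have m_gt0 : 0 < Num.min d d' by rewrite lt_min d0.
have : normc (z - e) < Num.min d d' by rewrite nze; lra.
rewrite lt_min => /andP[zed zed'].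
have h1 : normc (f z - f e) < eps / 2 by apply: Hd; rewrite ?e1// ltW.
have h2 := Hd' z e z1 e1 zed'.
rewrite mulN1r; have := le_normc_trans (f z) (f e) (poisson f z).
by move: h2; rewrite normcB; lra.
Qed.

(** The disc algebra.  Applied to z^n f, whose value at the centre vanishes for
    positive n, the Poisson formula says that f has no negative Fourier
    coefficient. *)
Lemma analytic_disc_alg f : {within closed_unit_disc (R := R), continuous f} ->
  analytic_on (unit_disc (R := R)) f -> disc_alg f.
Proof.
move=> cf af.
have rep n z : normc z < 1 -> z ^+ n * f z = poisson (fun e => e ^+ n * f e) z.
  have cn : {within closed_unit_disc (R := R), continuous (fun z => z ^+ n * f z)}.
    elim: n => [|n IH].
      by rewrite (_ : (fun z => _) = f)//; apply/funext => w; rewrite mul1r.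
    rewrite (_ : (fun z => _) = (fun z => z * (z ^+ n * f z))); last first.
      by apply/funext => w; rewrite exprS mulrA.
    move=> w; apply: cvgM; last exact: IH.
    by apply: continuous_subspaceT => u; exact: cvg_id.
  apply: (poisson_reproduces (f := fun e => e ^+ n * f e)).
  - exact: within_ccont.
  - exact: within_closed_ucont.
  move=> w w1; elim: n {cn} => [|n IH].
    rewrite (_ : (fun z => _) = f); first exact: analytic_on_jet.
    by apply/funext => u; rewrite mul1r.
  rewrite (_ : (fun z => _) = (fun z => z * (z ^+ n * f z))); first exact: mulX_jet.
  by apply/funext => u; rewrite exprS mulrA.
have cF := within_ccont cf; have iF := ccont_int cF.
have n01 : normc (0 : R[i]) < 1 by rewrite normc0.
have f0 n : (0 < n)%N -> cmean (fun e => e ^+ n * f e) = 0.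
  move=> n0; have := rep n 0 n01; rewrite expr0n gtn_eqF// mul0r => ->.
  apply: eq_cmean => e _.
  by rewrite /poisson_kernel mul0r subr0 normc0 expr0n subr0 normc1 expr1n divr1 rmorph1 mul1r.
have Af := circle_alg_moments cF f0.
have fE z : normc z < 1 -> f z = gelfand f z.
  move=> z1; rewrite -poisson_gelfand//; have := rep 0%N z z1; rewrite mul1r => ->.
  by apply: eq_cmean => e _; rewrite mul1r.
move=> eps eps0; have [p Hp] := Af _ eps0; exists p => z.
rewrite le_eqVlt => /orP[/eqP|z1]; first exact: Hp.
rewrite (fE _ z1) -(gelfand_horner p z1) -gelfandB//; last first.
  by apply: ccont_int; exact: ccont_horner.
apply: (@gelfand_le _ (fun z => f z - p.[z])) => //.
by apply: circle_algB => //; exact: circle_alg_horner.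
Qed.

End AnalyticDisc.

(** * Transport of integrals along a circle map *)

Section WeightedImage.
Variable R : realType.
Local Notation leb := (@lebesgue_measure R).
Local Notation angles := (@angles R : set (measurableTypeR R)).
Variables (theta p : R -> R).
Hypotheses (mtheta : measurable_fun setT theta) (mp : measurable_fun setT p).
Hypothesis p0 : forall t, 0 <= p t.

(** The image under theta of the measure with density p on the interval of
    angles.  The proofs are arguments so that the measure structure can be
    attached to the term. *)
Definition image_measure of measurable_fun setT theta & measurable_fun setT p &
    (forall t, 0 <= p t) : set (measurableTypeR R) -> \bar R :=
  fun A => (\int[leb]_(t in angles `&` theta @^-1` A) (p t)%:E)%E.
Local Notation nu := (image_measure mtheta mp p0).

Let mA A : measurable A -> measurable (theta @^-1` A).
Proof. by move=> mA; rewrite -[X in measurable X]setTI; exact: mtheta. Qed.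

Let mpE (D : set (measurableTypeR R)) : measurable_fun D (fun t => (p t)%:E).
Proof. by apply/measurable_EFinP; exact: measurable_funTS. Qed.

Let nu0 : nu set0 = 0%E.
Proof. by rewrite /image_measure preimage_set0 setI0 integral_set0. Qed.

Let nu_ge0 A : (0 <= nu A)%E.
Proof. by apply: integral_ge0 => t _; rewrite lee_fin. Qed.

Let nu_sigma_additive : semi_sigma_additive nu.
Proof.
move=> /= F mF tF mUF; rewrite /image_measure; apply: cvg_toP.
  apply: ereal_nondecreasing_is_cvgn => m n mn.
  apply: lee_sum_nneg_natr => // k _ _.
  by apply: integral_ge0 => /= t _; rewrite lee_fin.
rewrite preimage_bigcup setI_bigcupr ge0_integral_bigcup//=.
- by move=> k; apply: measurableI; [exact: measurable_angles|exact: mA (mF k)].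
- by move=> t _; rewrite lee_fin.
- apply/trivIsetP => i j _ _ ij; move/trivIsetP : tF => /(_ i j Logic.I Logic.I ij) tF.
  by rewrite setIACA setIid -preimage_setI tF preimage_set0 setI0.
Qed.

HB.instance Definition _ := isMeasure.Build _ _ _ nu nu0 nu_ge0 nu_sigma_additive.

Let integral_image_indic A : measurable A ->
  (\int[nu]_x (\1_A x)%:E = \int[leb]_(t in angles) ((\1_A (theta t))%:E * (p t)%:E))%E.
Proof.
move=> mA'; rewrite integral_indic//= setIT /image_measure integral_mkcondr.
apply: eq_integral => t _; rewrite patchE indicE.
have -> : (t \in theta @^-1` A) = (theta t \in A) by apply/idP/idP; rewrite !inE.
by case: ifPn => // _; rewrite ?mul1e ?mul0e.
Qed.

Import HBNNSimple.

Let integral_image_nnsfun (f : {nnsfun measurableTypeR R >-> R}) :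
  (\int[nu]_x (f x)%:E = \int[leb]_(t in angles) ((f (theta t))%:E * (p t)%:E))%E.
Proof.
under [LHS]eq_integral do rewrite fimfunE -fsumEFin//.
rewrite [LHS]ge0_integral_fsum//; last 2 first.
  - by move=> r; exact/measurable_EFinP/measurableT_comp.
  - by move=> n x _; rewrite EFinM nnfun_muleindic_ge0.
under [RHS]eq_integral.
  move=> x xD; rewrite fimfunE -fsumEFin// ge0_mule_fsuml; last first.
    by move=> r; rewrite EFinM nnfun_muleindic_ge0.
  over.
have mi r : measurable_fun angles (fun t => (\1_(f @^-1` [set r]) (theta t))%:E).
  apply/measurable_EFinP; apply: measurable_funTS.
  rewrite (_ : (fun t => _) = \1_(theta @^-1` (f @^-1` [set r]))).
    by apply: measurable_indic; apply: mA; exact: (measurable_funPTI f (measurable_set1 r)).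
  by apply/funext => t; rewrite !indicE; congr (_%:R); apply/idP/idP; rewrite !inE.
rewrite [RHS]ge0_integral_fsum//; last 3 first.
  - exact: measurable_angles.
  - move=> r; apply: emeasurable_funM; last exact: mpE.
    rewrite (_ : (fun _ => _) = (fun t => r%:E * (\1_(f @^-1` [set r]) (theta t))%:E)%E).
      by apply: emeasurable_funM => //; exact: mi.
    by apply/funext => t; rewrite -EFinM.
  - move=> r t _; apply: mule_ge0; last by rewrite lee_fin.
    by rewrite EFinM nnfun_muleindic_ge0.
apply: eq_fsbigr => r /[!inE] -[t0 _ fr].
have r0 : 0 <= r by rewrite -fr.
rewrite integralZl_indic_nnsfun//= integral_image_indic//.
rewrite -ge0_integralZl//.
- by apply: eq_integral => t _; rewrite muleA -EFinM.
- exact: measurable_angles.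
- exact: emeasurable_funM.
- by move=> t _; rewrite mule_ge0 ?lee_fin.
Qed.

Lemma integral_image (f : measurableTypeR R -> \bar R) : measurable_fun setT f -> (forall x, 0 <= f x)%E ->
  (\int[nu]_x f x = \int[leb]_(t in angles) (f (theta t) * (p t)%:E))%E.
Proof.
move=> mf f0; pose f_ := nnsfun_approx measurableT mf.
transitivity (lim (\int[nu]_x (f_ n x)%:E @[n --> \oo])%E).
  rewrite -monotone_convergence//=.
  - apply: eq_integral => ? /[!inE] xD; apply/esym/cvg_lim => //=.
    exact: cvg_nnsfun_approx.
  - by move=> n; exact/measurable_EFinP/measurable_funTS.
  - by move=> n ? _; rewrite lee_fin.
  - by move=> ? _ ? ? mn; rewrite lee_fin; exact/lefP/nd_nnsfun_approx.
have -> : (\int[leb]_(t in angles) (f (theta t) * (p t)%:E))%E =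
    (lim (\int[leb]_(t in angles) ((f_ n (theta t))%:E * (p t)%:E) @[n --> \oo]))%E.
  rewrite -monotone_convergence//=.
  - apply: eq_integral => t _; apply/esym/cvg_lim => //=.
    apply: cvgeZr => //; exact: cvg_nnsfun_approx.
  - exact: measurable_angles.
  - move=> n; apply: emeasurable_funM; last exact: mpE.
    apply/measurable_EFinP; apply: (@measurableT_comp _ _ _ _ _ _ (f_ n)) => //.
    exact: measurable_funTS.
  - by move=> n t _; rewrite mule_ge0 ?lee_fin.
  - move=> t _ m n mn; rewrite lee_wpmul2r ?lee_fin//.
    by have /lefP := nd_nnsfun_approx measurableT mf mn; apply.
by apply: congr_lim; apply/funext => n /=; exact: integral_image_nnsfun.
Qed.

End WeightedImage.

Section Transport.
Variable R : realType.
Local Notation "z ^*" := (conjc z) : ring_scope.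
Implicit Types (z w c e : R[i]) (u v P : R[i] -> R) (F G : R[i] -> R[i]).
Local Notation leb := (@lebesgue_measure R).
Local Notation angles := (@angles R : set (measurableTypeR R)).

Definition angle z : R := xget 0 [set t | 0 <= t < 2 * pi /\ z = expi t].

Lemma angleP z : normc z = 1 -> 0 <= angle z < 2 * pi /\ expi (angle z) = z.
Proof.
move=> /circle_expi[t ht zt]; rewrite /angle.
by case: xgetP => [s _ [hs ->]|/(_ t)] //; case.
Qed.

Definition circle_map F := ccont F /\ forall z, normc z = 1 -> normc (F z) = 1.

Lemma circle_map_id : circle_map id. Proof. by split => //; exact: ccont_id. Qed.

Lemma rcont_comp u F : rcont u -> circle_map F -> rcont (fun z => u (F z)).
Proof.
move=> cu [cF F1]; have cuC : ccont (fun z => (u z)%:C) by split => //; exact: rcont_cst.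
have tF : tcont (fun t : R => F (expi t)) by [].
have [|H _] := @tcont_comp R _ (fun t : R => F (expi t)) (fun z => (u z)%:C) tF; last exact: H.
move=> x eps eps0; have [d d0 Hd] := ccont_ucont cuC eps0.
by exists d => // y; apply: Hd; apply: F1; exact: normc_expi.
Qed.

(** A function of the angle with equal values at 0 and 2 pi factors through the
    quotient map from the interval of angles to the circle. *)
Lemma rcont_angle (k : R -> R) : continuous k -> k 0 = k (2 * pi) -> rcont (fun z => k (angle z)).
Proof.
move=> ck k0.
have ce : tcont (@expi R) by split; [exact: continuous_cos|exact: continuous_sin].
have tk : tcont (fun t => (k t)%:C) by split=> // x; exact: cvg_cst.
have H := heine (@segment_compact R 0 (2 * pi)) ce tk.
have [|G _] := @tcont_comp R _ (@expi R) (fun z => (k (angle z))%:C) ce; last exact: G.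
move=> x eps eps0; have [|d d0 Hd] := H _ _ eps0.
  move=> s t; rewrite /= !in_itv /= !le_eqVlt.
  have w (a : R) : 0 <= a -> a = 2 * pi \/ a < 2 * pi -> exists2 b : R, 0 <= b < 2 * pi & expi b = expi a /\ k b = k a.
    move=> a0 [->|a2]; last by exists a => //; rewrite a0.
    by exists 0; [rewrite lexx mulr_gt0// pi_gt0|rewrite expi0 expi2pi k0].
  rewrite -!le_eqVlt => /andP[s0 s2] /andP[t0 t2] E.
  have [|a ha [Ea ka]] := w s s0; first by move: s2; rewrite le_eqVlt => /orP[/eqP|]; [left|right].
  have [|b hb [Eb kb]] := w t t0; first by move: t2; rewrite le_eqVlt => /orP[/eqP|]; [left|right].
  by rewrite -ka -kb (expi_inj ha hb)// Ea Eb.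
exists d => // y yd.
have [/andP[x0 x2] Ex] := angleP (normc_expi x); have [/andP[y0 y2] Ey] := angleP (normc_expi y).
apply: Hd; rewrite ?Ex ?Ey//= in_itv /= ?x0 ?y0 ltW//.
Qed.

(** A sublevel set of the angle of F is the preimage of a compact arc. *)
Lemma measurable_angle F : circle_map F ->
  measurable_fun [set: measurableTypeR R] (fun t : measurableTypeR R => angle (F (expi t)) : measurableTypeR R).
Proof.
move=> [cF F1]; have tF : tcont (fun t : R => F (expi t)) by [].
have aF t : 0 <= angle (F (expi t)) < 2 * pi /\ expi (angle (F (expi t))) = F (expi t).
  by apply: angleP; apply: F1; exact: normc_expi.
apply: (measurability _ (RGenOInfty.measurableE R)) => _ [_ [x ->] <-]; rewrite setTI.
have [x0|x0] := ltP x 0.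
  rewrite [X in measurable X](_ : _ = setT); first exact: measurableT.
  apply/seteqP; split => // t _; rewrite /= in_itv /= andbT.
  by have [/andP[a0 _] _] := aF t; exact: lt_le_trans a0.
have [x2|x2] := leP (2 * pi) x.
  rewrite [X in measurable X](_ : _ = set0); first exact: measurable0.
  apply/seteqP; split => // t; rewrite /= in_itv /= andbT => xt.
  have [/andP[_ a2] _] := aF t; by move: (lt_trans xt a2); rewrite ltNge x2.
apply: open_measurable; rewrite openE => t; rewrite /= in_itv /= andbT => xt.
have cg : continuous (fun s : R => normc (F (expi t) - expi s)).
  have ce : ccont (fun z => F (expi t) - z) by apply: ccontB; [exact: ccont_cst|exact: ccont_id].
  exact: (ccont_normc ce).
have K0 : (`[0, x] : set R) !=set0 by exists 0; rewrite /= in_itv /= lexx.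
have [c] := compact_EVT_min K0 (@segment_compact R 0 x) (continuous_subspaceT cg).
rewrite inE /= in_itv /= => /andP[c0 cx] cmin.
have [at_ Et] := aF t.
have d0 : 0 < normc (F (expi t) - expi c).
  rewrite normc_gt0 subr_eq0; apply/eqP => E.
  have : angle (F (expi t)) = c.
    apply: (expi_inj at_); first by rewrite c0 (le_lt_trans cx).
    by rewrite Et.
  by move=> Ec; move: xt; rewrite Ec ltNge cx.
have := tcont_near t tF d0; rewrite /interior /=; apply: filterS => s sd /=.
rewrite in_itv /= andbT ltNge; apply/negP => sx.
have [/andP[as0 _] Es] := aF s.
have := cmin (angle (F (expi s))); rewrite inE /= in_itv /= as0 sx Es => /(_ isT).
by rewrite leNgt (normcB (F (expi t)) (F (expi s))) sd.
Qed.

(** As n grows this increases to the indicator function of the interval between x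
    and 2 pi.  For nonnegative x it vanishes at both ends of the interval of
    angles, hence is continuous as a function on the circle. *)
Definition trapezoid (x : R) (n : nat) (s : R) : R :=
  Num.min 1 (n%:R * Num.max 0 (Num.min (s - x) (2 * pi - s))).

Lemma trapezoid_ge0 x n s : 0 <= trapezoid x n s.
Proof. by rewrite le_min ler01 mulr_ge0// le_max lexx. Qed.

Lemma trapezoid_mono x m n s : (m <= n)%N -> trapezoid x m s <= trapezoid x n s.
Proof.
move=> mn; rewrite le_min ge_min lexx /= ge_min; apply/orP; right.
by rewrite ler_wpM2r ?ler_nat// le_max lexx.
Qed.

Lemma trapezoid_cont x n : continuous (trapezoid x n).
Proof.
have ci : continuous (fun s : R => s) by move=> s; exact: cvg_id.
have cc (a : R) : continuous (fun _ : R => a) by move=> s; exact: cvg_cst.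
have c1 : continuous (fun s : R => s - x) by move=> s; exact: (cvgB (ci s) (cc x s)).
have c2 : continuous (fun s : R => 2 * pi - s) by move=> s; exact: (cvgB (cc (2 * pi) s) (ci s)).
have c3 : continuous (fun s : R => Num.min (s - x) (2 * pi - s)).
  by move=> s; exact: (@continuous_min _ _ (fun s : R => s - x) (fun s => 2 * pi - s) s (c1 s) (c2 s)).
have c4 : continuous (fun s : R => Num.max 0 (Num.min (s - x) (2 * pi - s))).
  move=> s.
  exact: (@continuous_max _ _ (fun=> 0) (fun s : R => Num.min (s - x) (2 * pi - s)) s (cc 0 s) (c3 s)).
have c5 : continuous (fun s : R => n%:R * Num.max 0 (Num.min (s - x) (2 * pi - s))).
  by move=> s; exact: (cvgM (cc n%:R s) (c4 s)).
move=> s; exact: (@continuous_min _ _ (fun=> 1)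
  (fun s : R => n%:R * Num.max 0 (Num.min (s - x) (2 * pi - s))) s (cc 1 s) (c5 s)).
Qed.

Lemma trapezoid_bounds x n s : 0 <= x -> s = 0 \/ s = 2 * pi -> trapezoid x n s = 0.
Proof.
move=> x0 hs; suff H : Num.min (s - x) (2 * pi - s) <= 0.
  by rewrite /trapezoid (max_l H) mulr0 min_r.
by case: hs => ->; rewrite ge_min ?subrr ?lexx ?orbT// sub0r oppr_le0 x0.
Qed.

Lemma trapezoid_cvg x s : s < 2 * pi -> trapezoid x n s @[n --> \oo] --> ((x < s)%R%:R : R).
Proof.
move=> s2; have [xs|sx] := ltP x s; last first.
  rewrite (_ : (fun n => _) = fun=> 0); first exact: cvg_cst.
  apply/funext => n; rewrite /trapezoid max_l; last by rewrite ge_min subr_le0 sx.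
  by rewrite mulr0 min_r.
set m := Num.min (s - x) (2 * pi - s).
have m0 : 0 < m by rewrite lt_min !subr_gt0 xs.
apply: cvg_near_cst; exists (Num.bound m^-1) => // n /= Nn.
rewrite /trapezoid -/m max_r ?(ltW m0)// min_l//.
rewrite -ler_pdivrMr// div1r ltW//.
apply: (lt_le_trans (archi_boundP _)); first by rewrite invr_ge0 ltW.
by rewrite ler_nat.
Qed.

Lemma integral_rmean v : rint v ->
  (\int[leb]_(t in angles) (v (expi t))%:E = (2 * pi * rmean v)%:E)%E.
Proof.
move=> iv; rewrite /rmean mulrA divff ?mul1r; last by rewrite gt_eqF ?twopi_gt0.
by rewrite /Rintegral fineK//; exact: (integrable_fin_num (@measurable_angles R) iv).
Qed.

Lemma rcont_measurable P : rcont P ->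
  measurable_fun [set: measurableTypeR R] (fun t : measurableTypeR R => P (expi t)).
Proof. by move=> cP; exact: continuous_measurable_fun. Qed.

Section Image.
Variables (F : R[i] -> R[i]) (P : R[i] -> R).
Hypotheses (mapF : circle_map F) (cP : rcont P) (P0 : forall t, 0 <= P (expi t)).

Definition circle_image : {measure set (measurableTypeR R) -> \bar R} :=
  image_measure (measurable_angle mapF) (rcont_measurable cP) P0.

Lemma circle_imageE (A : set (measurableTypeR R)) : circle_image A =
  (\int[leb]_(t in angles `&` (fun t => angle (F (expi t))) @^-1` A) (P (expi t))%:E)%E.
Proof. by []. Qed.

Lemma angle_map t : 0 <= angle (F (expi t)) < 2 * pi /\ expi (angle (F (expi t))) = F (expi t).
Proof. by apply: angleP; case: mapF => _; apply; exact: normc_expi. Qed.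

Lemma circle_image_total (x : R) : x < 0 -> circle_image `]x, +oo[%classic = (2 * pi * rmean P)%:E.
Proof.
move=> x0; rewrite circle_imageE -integral_rmean; last exact: rcont_int.
rewrite (_ : _ @^-1` _ = setT) ?setIT//.
apply/seteqP; split => // t _; rewrite /= in_itv /= andbT.
by have [/andP[a0 _] _] := angle_map t; exact: lt_le_trans a0.
Qed.

Lemma rcont_trapezoid x n : 0 <= x -> rcont (fun z => trapezoid x n (angle z)).
Proof.
move=> x0; apply: rcont_angle; first exact: trapezoid_cont.
by rewrite !trapezoid_bounds//; [right|left].
Qed.

Lemma circle_image_cvg (x : R) : 0 <= x ->
  ((2 * pi * rmean (fun z => trapezoid x n (angle (F z)) * P z))%:E @[n --> \oo]
    --> circle_image `]x, +oo[%classic)%E.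
Proof.
move=> x0; pose g (n : nat) (t : measurableTypeR R) : \bar R :=
  (trapezoid x n (angle (F (expi t))) * P (expi t))%:E.
have cg n : rcont (fun z => trapezoid x n (angle (F z)) * P z).
  have ct := rcont_comp (@rcont_trapezoid x n x0) mapF.
  exact: (rcontM ct cP).
rewrite (_ : (fun n => _) = (fun n => \int[leb]_(t in angles) g n t)%E); last first.
  by apply/funext => n; rewrite -integral_rmean//; exact: rcont_int.
have gl t : (limn (g ^~ t) = (P (expi t) * (x < angle (F (expi t)))%R%:R)%:E)%E.
  apply/cvg_lim => //; apply: cvg_EFin; first by near=> n.
  rewrite (_ : fine \o _ = fun n => trapezoid x n (angle (F (expi t))) * P (expi t))//.
  rewrite mulrC; apply: cvgM; last exact: cvg_cst.
  by apply: trapezoid_cvg; have [/andP[]] := angle_map t.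
have -> : circle_image `]x, +oo[%classic = (\int[leb]_(t in angles) limn (g ^~ t))%E.
  rewrite circle_imageE integral_mkcondr; apply: eq_integral => t _.
  rewrite gl patchE; case: ifPn; rewrite ?(inE, notin_setE) /= in_itv /= andbT.
    by move=> ->; rewrite mulr1.
  by move=> /negP/negbTE ->; rewrite mulr0.
apply: cvg_monotone_convergence.
- exact: measurable_angles.
- move=> n; apply/measurable_EFinP; exact: rcont_meas (cg n).
- by move=> n t _; rewrite lee_fin mulr_ge0 ?trapezoid_ge0.
- by move=> t _ m n mn; rewrite lee_fin ler_wpM2r// trapezoid_mono.
Unshelve. all: by end_near. Qed.

Lemma integral_circle_image u : rmeas u -> (forall z, normc z = 1 -> 0 <= u z) ->
  (\int[circle_image]_s ((fun t => (u (expi t))%:E) \_ angles) s =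
   \int[leb]_(t in angles) (u (F (expi t)) * P (expi t))%:E)%E.
Proof.
move=> mu u0; rewrite /circle_image integral_image.
- apply: eq_integral => t _; have [/andP[a0 a2] Ea] := angle_map t.
  rewrite patchE mem_set ?Ea//.
  by rewrite /angles /= in_itv /= a0 ltW.
- by apply/(measurable_restrictT _ (@measurable_angles R))/measurable_EFinP.
- move=> s; rewrite patchE; case: ifPn => // _; rewrite lee_fin u0//; exact: normc_expi.
Qed.

End Image.

(** Two weighted images of the circle with the same means of continuous
    functions are the same measure, because trapezoid functions increase to the
    indicator functions of half-lines. *)
Lemma circle_transport F G P Q (mF : circle_map F) (mG : circle_map G) (cP : rcont P)
    (cQ : rcont Q) : (forall t, 0 <= P (expi t)) -> (forall t, 0 <= Q (expi t)) ->
  (forall u, rcont u -> rmean (fun z => u (F z) * P z) = rmean (fun z => u (G z) * Q z)) ->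
  forall u, rmeas u -> (forall z, normc z = 1 -> 0 <= u z) ->
  (\int[leb]_(t in angles) (u (F (expi t)) * P (expi t))%:E =
   \int[leb]_(t in angles) (u (G (expi t)) * Q (expi t))%:E)%E.
Proof.
move=> P0 Q0 H u mu u0.
rewrite -(integral_circle_image mF cP P0 mu u0) -(integral_circle_image mG cQ Q0 mu u0).
have PQ : rmean P = rmean Q.
  have := H (fun=> 1) (@rcont_cst R 1).
  under eq_rmean => z _ do rewrite mul1r.
  by move=> ->; apply: eq_rmean => z _; rewrite mul1r.
apply: eq_measure_integral => A mA _.
suff H0 : circle_image mF cP P0 A = circle_image mG cQ Q0 A by exact: H0.
apply: (@measure_unique _ R (measurableTypeR R) (@RGenOInfty.G R)
  (fun n => `]- (n%:R), +oo[%classic) _ _ _ _ (circle_image mF cP P0) (circle_image mG cQ Q0)) => //.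
- exact: RGenOInfty.measurableE.
- move=> _ _ [x ->] [y ->]; exists (Num.max x y).
  by apply/seteqP; split => s; rewrite /= !in_itv /= !andbT gt_max => /andP.
- by move=> n; exists (- n%:R).
- apply/seteqP; split => // s _; exists (Num.bound `|s|) => //=.
  rewrite in_itv /= andbT ltrNl; apply: le_lt_trans (ler_norm _) _.
  by rewrite normrN; apply: archi_boundP; exact: normr_ge0.
- move=> _ [x ->]; have [x0|x0] := ltP x 0; first by rewrite !circle_image_total// PQ.
  have h1 := @circle_image_cvg F P mF cP P0 x x0; have h2 := @circle_image_cvg G Q mG cQ Q0 x x0.
  have E n : rmean (fun z => trapezoid x n (angle (F z)) * P z) =
      rmean (fun z => trapezoid x n (angle (G z)) * Q z).
    by apply: (H (fun z => trapezoid x n (angle z))); exact: rcont_trapezoid.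
  rewrite -(cvg_lim _ h1)// -(cvg_lim _ h2)//.
  by apply: congr_lim; apply/funext => n; rewrite E.
- move=> n; have n1 : - n%:R - 1 < 0 :> R by rewrite -opprD oppr_lt0 ltr_wpDl.
  apply: (@le_lt_trans _ _ (circle_image mF cP P0 `](- n%:R - 1), +oo[%classic)).
    apply: le_measure; rewrite ?inE; [exact: measurable_itv..|].
    by move=> s; rewrite /= !in_itv /= !andbT; apply: lt_trans; rewrite ltrBlDr ltrDl.
  by rewrite circle_image_total// ltry.
Qed.

End Transport.

(** * Composition with disc automorphisms *)

Section Composition.
Variable R : realType.
Local Notation "z ^*" := (conjc z) : ring_scope.
Implicit Types (z w c e : R[i]) (u v : R[i] -> R) (f g s F G : R[i] -> R[i]) (a : disc_aut R).
Local Notation leb := (@lebesgue_measure R).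
Local Notation angles := (@angles R : set (measurableTypeR R)).

Definition aut_sym a : disc_aut R :=
  DiscAut (@aut_inv_disc _ a) (@aut_fun_disc _ a) (@aut_invK _ a) (@aut_funK _ a)
    (@aut_inv_analytic _ a) (@aut_fun_analytic _ a) (@aut_inv_cont _ a) (@aut_fun_cont _ a).

Lemma disc_dense z (d : R) : normc z <= 1 -> 0 < d ->
  exists2 w, normc w < 1 & normc (w - z) < d.
Proof.
move=> z1 d0; pose t := Num.min 1 (d / 2).
have t0 : 0 < t by rewrite lt_min ltr01 divr_gt0.
have t1 : t <= 1 by rewrite ge_min lexx.
have td : t <= d / 2 by rewrite ge_min lexx orbT.
exists ((1 - t)%:C * z).
  rewrite normcM normc_real ger0_norm ?subr_ge0//.
  by have := normc_ge0 z; nra.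
have -> : (1 - t)%:C * z - z = (- t)%:C * z by rewrite !rmorphB !rmorphN rmorph1 /=; ring.
rewrite normcM normc_real normrN gtr0_norm//.
by have := normc_ge0 z; nra.
Qed.

Lemma closed_ucont_eq f g z : closed_ucont f -> closed_ucont g ->
  (forall w, normc w < 1 -> f w = g w) -> normc z <= 1 -> f z = g z.
Proof.
move=> uf ug fg z1; apply/eqP; rewrite -subr_eq0; apply/eqP.
apply: (@normc_le_eps0 _ _ 2) => // eps eps0.
have [d d0 Hd] := uf _ eps0; have [d' d0' Hd'] := ug _ eps0.
have dd : 0 < Num.min d d' by rewrite lt_min d0.
have [w w1] := disc_dense z1 dd; rewrite lt_min => /andP[wd wd'].
apply: (le_trans (le_normc_trans _ (f w) _)).
have := Hd w z (ltW w1) z1 wd; have := Hd' w z (ltW w1) z1 wd'.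
rewrite fg// (normcB (f z)); lra.
Qed.

Lemma closed_ucont_id : closed_ucont (@id R[i]).
Proof. by move=> eps eps0; exists eps. Qed.

Lemma closed_ucont_comp f g : closed_ucont f -> closed_ucont g ->
  (forall z, normc z <= 1 -> normc (g z) <= 1) -> closed_ucont (fun z => f (g z)).
Proof.
move=> uf ug g1 eps /uf[d d0 Hd]; have [d' d0' Hd'] := ug _ d0.
by exists d' => // z w z1 w1 zw; apply: Hd; rewrite ?g1//; exact: Hd'.
Qed.

Lemma aut_ucont a : closed_ucont a.
Proof. by apply: within_closed_ucont; exact: aut_fun_cont. Qed.

Lemma aut_lt1 a z : normc z < 1 -> normc (a z) < 1.
Proof. by move=> /unit_discE/aut_fun_disc/unit_discE. Qed.

Lemma aut_le1 a z : normc z <= 1 -> normc (a z) <= 1.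
Proof.
move=> z1; apply/ler_addgt0Pr => eps eps0; have [d d0 Hd] := aut_ucont a eps0.
have [w w1 wd] := disc_dense z1 d0.
have := Hd w z (ltW w1) z1 wd; have := aut_lt1 a w1; have := le_normc_sub (a z) (a w).
by rewrite (normcB (a z)); lra.
Qed.

Lemma aut_closedK a z : normc z <= 1 -> aut_inv a (a z) = z.
Proof.
apply: (@closed_ucont_eq (fun z => aut_inv a (a z)) id).
- by apply: closed_ucont_comp; [exact: (aut_ucont (aut_sym a))|exact: aut_ucont|exact: aut_le1].
- exact: closed_ucont_id.
- by move=> w /unit_discE; exact: aut_funK.
Qed.

(** The inverse automorphism would send an interior value back inside. *)
Lemma aut_circle a z : normc z = 1 -> normc (a z) = 1.
Proof.
move=> z1; have zl : normc z <= 1 by rewrite z1.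
have := aut_le1 a zl; rewrite le_eqVlt => /orP[/eqP//|az].
by have := aut_lt1 (aut_sym a) az; rewrite /= aut_closedK// z1 ltxx.
Qed.

Lemma aut_disc_alg a : disc_alg a.
Proof. by apply: analytic_disc_alg; [exact: aut_fun_cont|exact: aut_fun_analytic]. Qed.

Lemma aut_circle_alg a : circle_alg a.
Proof. exact: disc_circle_alg (aut_disc_alg a). Qed.

Lemma gelfand_aut a z : normc z < 1 -> gelfand a z = a z.
Proof. exact: gelfand_disc_alg (aut_disc_alg a). Qed.

Lemma aut_circle_map a : circle_map a.
Proof. by split; [exact: circle_alg_ccont (aut_circle_alg a)|exact: aut_circle]. Qed.

Lemma circle_algD f g : circle_alg f -> circle_alg g -> circle_alg (fun z => f z + g z).
Proof.
move=> Af Ag; apply: eq_circle_alg (circle_algB Af (circle_algB (circle_alg_cst 0) Ag)).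
by move=> z _; ring.
Qed.

Lemma circle_alg_horner_comp (p : {poly R[i]}) s : circle_alg s ->
  circle_alg (fun z => p.[s z]) /\
  forall w, normc w < 1 -> gelfand (fun z => p.[s z]) w = p.[gelfand s w].
Proof.
move=> As; elim/poly_ind: p => [|p c [IH1 IH2]].
  have E z : normc z = 1 -> 0 = (0 : {poly R[i]}).[s z] by rewrite horner0.
  split; first exact: eq_circle_alg E (circle_alg_cst 0).
  by move=> w w1; rewrite -(eq_gelfand w E) gelfand_cst ?horner0.
have E z : normc z = 1 -> s z * p.[s z] + c = (p * 'X + c%:P).[s z].
  by move=> _; rewrite hornerMXaddC; ring.
have A1 := circle_algM As IH1.
split; first exact: eq_circle_alg E (circle_algD A1 (circle_alg_cst c)).
move=> w w1; rewrite -(eq_gelfand w E) gelfandD//; [|exact: circle_alg_cint|exact: cint_cst].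
rewrite gelfandM//; last exact: circle_alg_H2.
by rewrite IH2// gelfand_cst// hornerMXaddC; ring.
Qed.

Lemma circle_alg_comp_aut f a : circle_alg f -> circle_alg (fun z => f (a z)) /\
  forall w, normc w < 1 -> gelfand (fun z => f (a z)) w = gelfand f (a w).
Proof.
move=> Af; have Aa := aut_circle_alg a.
have Afa : circle_alg (fun z => f (a z)).
  move=> eps eps0; have eps2 : 0 < eps / 2 by rewrite divr_gt0.
  have [p Hp] := Af _ eps2; have [Apa _] := circle_alg_horner_comp p Aa.
  have [r Hr] := Apa _ eps2; exists r => z z1.
  apply: (le_trans (le_normc_trans _ p.[a z] _)).
  have := Hp _ (aut_circle a z1); have := Hr z z1; lra.
split => // w w1; apply/eqP; rewrite -subr_eq0; apply/eqP.
apply: (@normc_le_eps0 _ _ 2) => // eps /Af[p Hp].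
have [Apa Gpa] := circle_alg_horner_comp p Aa.
apply: (le_trans (le_normc_trans _ p.[a w] _)).
have -> : eps * 2 = eps + eps by ring.
apply: lerD.
  rewrite -(gelfand_aut a w1) -Gpa// -gelfandB//; [|exact: circle_alg_cint..].
  apply: (@gelfand_le _ (fun z => f (a z) - p.[a z])) => //; first exact: circle_algB.
  by move=> z z1; apply: Hp; exact: aut_circle.
have aw1 := aut_lt1 a w1.
rewrite -(gelfand_horner p aw1) normcB -gelfandB//; [|exact: circle_alg_cint|].
  apply: (@gelfand_le _ (fun z => f z - p.[z])) => //.
  by apply: circle_algB => //; exact: circle_alg_horner.
by apply: ccont_int; exact: ccont_horner.
Qed.

Let n0 : normc (0 : R[i]) < 1. Proof. by rewrite normc0. Qed.

Let a01 a : normc (a 0) < 1. Proof. exact: aut_lt1. Qed.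

Lemma poisson_rcont z : normc z < 1 -> rcont (poisson_kernel z).
Proof. by move=> /poisson_kernel_ccont[]. Qed.

(** Real parts of polynomials approximate u uniformly, and for them both sides are
    the real part of the value at a 0, by the mean value property. *)
Lemma rmean_aut_cont u a : rcont u ->
  rmean (fun z => u (a z)) = rmean (fun z => u z * poisson_kernel (a 0) z).
Proof.
move=> cu; have rP := rcont_int (poisson_rcont (a01 a)).
have cua := rcont_comp cu (aut_circle_map a).
have cP := poisson_rcont (a01 a); have P0 z := poisson_kernel_ge0 z (a01 a).
apply/eqP; rewrite -subr_eq0 -normr_eq0 eq_le normr_ge0 andbT.
apply/ler_addgt0Pr => eps eps0; rewrite add0r.
have eps2 : 0 < eps / 2 by rewrite divr_gt0.
have [p Hp] := real_circle_approx cu eps2.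
have [Apa Gpa] := circle_alg_horner_comp p (aut_circle_alg a).
have cp : rcont (fun z => Re p.[z]) by case: (ccont_horner p).
have cpa : rcont (fun z => Re p.[a z]) := rcont_comp cp (aut_circle_map a).
have e1 : rmean (fun z => Re p.[a z]) = Re p.[a 0].
  by rewrite -Re_cmean -gelfand0 Gpa// gelfand_aut.
have e2 : rmean (fun z => Re p.[z] * poisson_kernel (a 0) z) = Re p.[a 0].
  rewrite -(gelfand_horner p (a01 a)) -poisson_gelfand//.
  - rewrite /poisson Re_cmean; apply: eq_rmean => z _.
    by rewrite cReM /= mul0r subr0 mulrC.
  - by apply: ccont_int; exact: ccont_horner.
  - by move=> n; apply: H2_moment; apply: circle_alg_H2; exact: circle_alg_horner.
have d1 : `|rmean (fun z => u (a z)) - Re p.[a 0]| <= eps / 2.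
  rewrite -e1 ler_distl; apply/andP; split.
    rewrite -[X in _ - X](rmean_cst (eps / 2)) -rmeanN -?rmeanD; do ?[exact: rcont_int|exact: rint_cst|exact: rintN (rint_cst _)].
    apply: le_rmean; [|exact: rcont_int|].
      by apply: rintD; [exact: rcont_int|exact: rintN (rint_cst _)].
    by move=> z z1; have := Hp _ (aut_circle a z1); rewrite ler_distl => /andP[]; lra.
  rewrite -[X in _ + X](rmean_cst (eps / 2)) -?rmeanD; do ?[exact: rcont_int|exact: rint_cst].
  apply: le_rmean; [exact: rcont_int|by apply: rintD; [exact: rcont_int|exact: rint_cst]|].
  by move=> z z1; have := Hp _ (aut_circle a z1); rewrite ler_distl => /andP[]; lra.
have d2 : `|rmean (fun z => u z * poisson_kernel (a 0) z) - Re p.[a 0]| <= eps / 2.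
  have iu := rcont_int (rcontM cu cP); have ip := rcont_int (rcontM cp cP).
  have ie := rintZ (eps / 2) rP.
  have me : rmean (fun z => eps / 2 * poisson_kernel (a 0) z) = eps / 2.
    by rewrite rmeanZ// rmean_poisson_kernel// mulr1.
  rewrite -e2 ler_distl -{1 2}me; apply/andP; split.
    rewrite -rmeanN// -rmeanD//; last exact: rintN.
    apply: le_rmean => //; first by apply: rintD => //; exact: rintN.
    move=> z z1; have := Hp _ z1; rewrite ler_distl => /andP[h _].
    by rewrite -mulNr -mulrDl ler_wpM2r//; lra.
  rewrite -rmeanD//; apply: le_rmean => //; first exact: rintD.
  move=> z z1; have := Hp _ z1; rewrite ler_distl => /andP[_ h].
  by rewrite -mulrDl ler_wpM2r//; lra.
apply: (le_trans (ler_distD (Re p.[a 0]) _ _)).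
by rewrite [X in _ + X <= _]distrC; lra.
Qed.

Lemma aut_integral u a : rmeas u -> (forall z, normc z = 1 -> 0 <= u z) ->
  (\int[leb]_(t in angles) (u (a (expi t)))%:E =
   \int[leb]_(t in angles) (u (expi t) * poisson_kernel (a 0) (expi t))%:E)%E.
Proof.
move=> mu u0.
rewrite -(@circle_transport R a id (fun=> 1) (poisson_kernel (a 0)) (aut_circle_map a)
  (@circle_map_id R) (@rcont_cst R 1) (poisson_rcont (a01 a)))//.
- by apply: eq_integral => t _; rewrite mulr1.
- by move=> t; exact: poisson_kernel_ge0.
- by move=> v cv; rewrite -rmean_aut_cont//; apply: eq_rmean => z _; rewrite mulr1.
Qed.

Lemma rmeas_comp u F : rmeas u -> circle_map F -> rmeas (fun z => u (F z)).
Proof.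
move=> mu mF.
have mg : measurable_fun [set: measurableTypeR R] ((fun t => u (expi t)) \_ angles).
  exact/(measurable_restrictT _ (@measurable_angles R)).
have H := measurableT_comp mg (measurable_angle mF).
 apply: measurable_funTS; apply: eq_measurable_fun H => t _ /=.
have [/andP[a0 a2] Ea] := angle_map mF t.
by rewrite patchE mem_set ?Ea// /angles /= in_itv /= a0 ltW.
Qed.

Lemma rint_poisson u z : normc z < 1 -> rint u -> rint (fun e => u e * poisson_kernel z e).
Proof.
move=> z1 iu; apply: (eq_rint (u := fun e => poisson_kernel z e * u e)).
  by move=> e _; rewrite mulrC.
apply: (rintM (B := 2 / (1 - normc z))) => //.
  by apply: rcont_meas; exact: poisson_rcont.
by move=> e e1; rewrite ger0_norm ?poisson_kernel_ge0// poisson_kernel_le.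
Qed.

Lemma rint_aut u a : rint u -> rint (fun z => u (a z)).
Proof.
move=> iu; have mua := rmeas_comp (rint_meas iu) (aut_circle_map a).
apply/integrableP; split; first exact/measurable_EFinP.
have ia : rint (fun z => `|u z|) := integrable_norm iu.
rewrite (aut_integral (u := fun z => `|u z|) a)//; last exact: rint_meas ia.
have /integrableP[_] := rint_poisson (a01 a) ia.
apply: le_lt_trans; rewrite le_eqVlt; apply/orP; left; apply/eqP.
apply: eq_integral => t _ /=; congr (_%:E); rewrite [RHS]ger0_norm// mulr_ge0//.
exact: poisson_kernel_ge0.
Qed.

Lemma rmean_aut u a : rint u ->
  rmean (fun z => u (a z)) = rmean (fun z => u z * poisson_kernel (a 0) z).
Proof.
move=> iu; have ia : rint (fun z => `|u z|) := integrable_norm iu.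
have pos v : rint v -> (forall z, 0 <= v z) ->
    rmean (fun z => v (a z)) = rmean (fun z => v z * poisson_kernel (a 0) z).
  by move=> iv v0; rewrite /rmean /Rintegral (aut_integral a)//; exact: rint_meas.
have iv : rint (fun z => `|u z| + u z) by exact: rintD.
have e1 := pos _ iv; have e2 := pos _ ia (fun z => normr_ge0 _).
have {}e1 := e1 (fun z => _); rewrite (rmeanD (rint_aut a ia) (rint_aut a iu)) in e1.
have E : rmean (fun z => (`|u z| + u z) * poisson_kernel (a 0) z) =
   rmean (fun z => `|u z| * poisson_kernel (a 0) z) + rmean (fun z => u z * poisson_kernel (a 0) z).
  rewrite -rmeanD; [|exact: rint_poisson..].
  by apply: eq_rmean => z _; rewrite mulrDl.
have /e1 : forall z, 0 <= `|u z| + u z by move=> z; have := ler_norm (- u z); rewrite normrN; lra.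
by rewrite E e2 => /addrI.
Qed.

Lemma cint_aut F a : cint F -> cint (fun z => F (a z)).
Proof. by move=> [F1 F2]; split; [exact: (rint_aut a F1)|exact: (rint_aut a F2)]. Qed.

Lemma cmean_aut F a : cint F -> cmean (fun z => F (a z)) = poisson F (a 0).
Proof.
move=> [F1 F2]; apply: complex_eqP; rewrite /poisson ?Re_cmean ?Im_cmean.
  by apply: (etrans (rmean_aut a F1)); apply: eq_rmean => z _; rewrite cReM /= mul0r subr0 mulrC.
by apply: (etrans (rmean_aut a F2)); apply: eq_rmean => z _; rewrite cImM /= mul0r addr0 mulrC.
Qed.

Lemma cmeas_aut F a : cmeas F -> cmeas (fun z => F (a z)).
Proof. by move=> [F1 F2]; split; [exact: (rmeas_comp F1 (aut_circle_map a))|exact: (rmeas_comp F2 (aut_circle_map a))]. Qed.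

Lemma L2_aut f a : L2_circle f -> L2_circle (fun z => f (a z)) /\
  L2_norm (fun z => f (a z)) <= (2 / (1 - normc (a 0)) + 1) * L2_norm f.
Proof.
move=> /L2_circleP[mf i2]; split.
  by apply/L2_circleP; split; [exact: cmeas_aut|exact: (rint_aut a i2)].
have d0 : 0 < 1 - normc (a 0) by rewrite subr_gt0.
set B := 2 / _; have B0 : 0 <= B by rewrite divr_ge0// ltW.
rewrite -(@ler_pXn2r _ 2) ?nnegrE ?L2_norm_ge0 ?mulr_ge0 ?L2_norm_ge0 ?addr_ge0//.
rewrite exprMn !L2_norm_sqr (rmean_aut a i2).
apply: (@le_trans _ _ (B * rmean (fun z => normc (f z) ^+ 2))).
  rewrite -rmeanZ//; apply: le_rmean; [exact: rint_poisson|exact: rintZ|].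
  by move=> z z1; rewrite mulrC ler_wpM2r ?sqr_ge0// poisson_kernel_le.
rewrite ler_wpM2r ?rmean_ge0//; first by move=> z _; exact: sqr_ge0.
by rewrite sqrrD expr1n mulr1 mulr2n; have := sqr_ge0 B; lra.
Qed.

(** The coordinate is a function of a z, namely the inverse automorphism; the
    moments of f o a are values at a 0 of Hardy functions with the inverse
    automorphism as a factor, and this factor vanishes there. *)
Lemma H2_aut f a : H2 f -> H2 (fun z => f (a z)).
Proof.
move=> Hf; apply/H2P; split; first by have [] := L2_aut a (H2_L2 Hf).
case=> // n _; pose s := aut_sym a.
have As : circle_alg s := aut_circle_alg s.
have HG k : H2 (fun z => s z ^+ k * f z).
  elim: k => [|k IH]; first by apply: eq_H2 Hf => z _; rewrite mul1r.
  by apply: eq_H2 (H2M As IH) => z _; rewrite exprS mulrA.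
have -> : cmean (fun z => z ^+ n.+1 * f (a z)) = cmean (fun z => s (a z) ^+ n.+1 * f (a z)).
  by apply: eq_cmean => z z1; rewrite /s /= aut_closedK// z1.
rewrite (cmean_aut (F := fun z => s z ^+ n.+1 * f z) a); last exact: H2_cint.
rewrite poisson_gelfand//; [|exact: H2_cint|by move=> k; exact: H2_moment].
rewrite (eq_gelfand (g := fun z => s z * (s z ^+ n * f z))) => [|z _]; last by rewrite exprS mulrA.
rewrite gelfandM// gelfand_aut// /s /= aut_closedK ?mul0r//.
by rewrite ltW.
Qed.

(** On the circle this is (f e - f^ w) / (e - w), with f^ the Gelfand transform;
    its first moment is the value at w of f - f^ w. *)
Lemma H2_divided f w : normc w < 1 -> H2 f ->
  H2 (fun e => e^* * ((1 - w * e^*)^-1 * (f e - gelfand f w))).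
Proof.
move=> w1 Hf; set c := gelfand f w.
have Hfc : H2 (fun e => f e - c).
  by apply: eq_H2 (H2D Hf (H2_cst (- c))).
have ck := kernel_ccont (ccont_conj R) (@normcJ_circle R) w1.
have cm : ccont (fun e => e^* * (1 - w * e^*)^-1) by apply: ccontM => //; exact: ccont_conj.
have [B B0 HB] := ccont_bounded cm.
apply: (eq_H2 (f := fun e => (e^* * (1 - w * e^*)^-1) * (f e - c))).
  by move=> e _; rewrite mulrA.
apply/H2P; split; first by have [] := L2M (H2_L2 Hfc) (ccont_meas cm) B0 HB.
case=> // n _.
rewrite (eq_cmean (G := fun e => (1 - w * e^*)^-1 * (e ^+ n * (f e - c)))) => [|e e1]; last first.
  have ee : e * e^* = 1 by rewrite mulcJ e1 expr1n.
  rewrite exprSr -[RHS]mul1r -ee; ring.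
rewrite -gelfandE.
rewrite (eq_gelfand (g := fun e => 'X^n.[e] * (f e - c))) => [|e _]; last by rewrite hornerXn.
have [_ ->//] := H2_horner 'X^n Hfc.
by rewrite gelfandB ?gelfand_cst ?subrr ?mulr0//; [exact: H2_cint|exact: cint_cst].
Qed.

(** With w = a z, the function f - f^ w is divisible by e - w, so that f o a - f^ w
    has the factor a - a z, which vanishes at z. *)
Lemma gelfand_comp_aut f a z : normc z < 1 -> H2 f ->
  gelfand (fun e => f (a e)) z = gelfand f (a z).
Proof.
move=> z1 Hf; have az1 := aut_lt1 a z1; set c := gelfand f (a z).
pose g e := e^* * ((1 - a z * e^*)^-1 * (f e - c)).
have Hga : H2 (fun e => g (a e)) := H2_aut a (H2_divided az1 Hf).
have Aa : circle_alg (fun e => a e - a z).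
  by apply: circle_algB; [exact: aut_circle_alg|exact: circle_alg_cst].
have E : gelfand (fun e => f (a e) - c) z = gelfand (fun e => (a e - a z) * g (a e)) z.
  apply: eq_gelfand => e e1; have ae1 := aut_circle a e1.
  rewrite /g; move: (a e) ae1 => b b1.
  have k0 := kernel_neq0 (@normcJ_circle R) az1 b1.
  have -> : (b - a z) * (b^* * ((1 - a z * b^*)^-1 * (f b - c))) =
    (b * b^* - a z * b^*) * (1 - a z * b^*)^-1 * (f b - c) by ring.
  by rewrite mulcJ b1 expr1n divff// mul1r.
have := E; rewrite gelfandM// (gelfandB z1 (cint_aut a (H2_cint Hf)) (cint_cst c)).
rewrite (gelfandB z1 (circle_alg_cint (aut_circle_alg a)) (cint_cst (a z))).
rewrite !gelfand_cst// gelfand_aut// subrr mul0r => /eqP.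
by rewrite subr_eq0 => /eqP.
Qed.

End Composition.

(** * Inverses in the disc algebra *)

Section InverseClosed.
Variable R : realType.
Local Notation "z ^*" := (conjc z) : ring_scope.
Implicit Types (z w c e : R[i]) (f g s : R[i] -> R[i]).

Lemma circle_alg_boundary_lower s (d : R) : circle_alg s ->
  (forall w, normc w < 1 -> d <= normc (gelfand s w)) -> forall z, normc z = 1 -> d <= normc (s z).
Proof.
move=> As Hd z z1; have /circle_algP[cs s0] := As; have iS := ccont_int cs.
apply/ler_addgt0Pr => eps eps0.
have [t t0 Ht] := poisson_approx cs (ccont_ucont cs) eps0.
have zl : normc z <= 1 by rewrite z1.
have [w w1 wz] := disc_dense zl t0.
have := Ht w z w1 z1 wz; rewrite poisson_gelfand// => h.
have := Hd w w1; have := le_normc_sub (gelfand s w) (s z); lra.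
Qed.

Lemma circle_alg_inv_linear r : 1 < normc r -> circle_alg (fun z => (z - r)^-1).
Proof.
move=> r1; have r0 : r != 0 by rewrite -normc_gt0 (lt_trans _ r1).
have rV1 : normc r^-1 < 1 by rewrite normcV invf_lt1// (lt_trans _ r1).
have k0 z : normc z = 1 -> 1 - r^-1 * z != 0 by move=> z1; exact: (kernel_neq0 (u := id)).
apply: (eq_circle_alg (f := fun z => (1 - r^-1 * z)^-1 * (- r^-1))).
  move=> z z1; have -> : z - r = - r * (1 - r^-1 * z) by rewrite mulrBr mulr1 mulNr mulVKf//; ring.
  by rewrite invfM invrN mulrC.
apply: circle_algM; last exact: circle_alg_cst.
apply/circle_algP; split.
  by apply: (kernel_ccont (u := id)) => //; exact: ccont_id.
move=> n n0; have cX : ccont (fun z : R[i] => z ^+ n) by apply: ccontX; exact: ccont_id.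
rewrite (eq_cmean (G := fun z => (1 - r^-1 * z)^-1 * z ^+ n)) => [|z _]; last by rewrite mulrC.
rewrite (kernel_mean (u := id)) ?cmeanX//; [exact: ccont_id|exact: ccont_int|].
by move=> m m0; rewrite -[RHS](@cmeanX R (m + n)) ?addn_gt0 ?m0//; apply: eq_cmean => z _; rewrite exprD.
Qed.

(** Over an algebraically closed field a polynomial without zeros in the closed
    disc is a product of linear factors, whose inverses are geometric series. *)
Lemma circle_alg_inv_poly (p : {poly R[i]}) : p != 0 ->
  (forall z, normc z <= 1 -> p.[z] != 0) -> circle_alg (fun z => p.[z]^-1).
Proof.
move=> p0 Hp; have [r Er] := closed_field_poly_normal p.
have lp : lead_coef p != 0 by rewrite lead_coef_eq0.
have Hr x : x \in r -> 1 < normc x.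
  move=> xr; rewrite ltNge; apply/negP => /Hp; rewrite Er hornerZ horner_prod.
  by rewrite (big_rem x xr)/= hornerXsubC subrr mul0r mulr0 eqxx.
apply: (eq_circle_alg (f := fun z => (lead_coef p)^-1 * \prod_(x <- r) (z - x)^-1)).
  move=> z _; rewrite [in RHS]Er hornerZ horner_prod invfM -prodfV; congr (_ * _).
  by apply: eq_bigr => x _; rewrite hornerXsubC.
apply: circle_algM; first exact: circle_alg_cst.
elim: r Hr {Er} => [|x r IH] Hr.
  by apply: eq_circle_alg (circle_alg_cst 1) => z _; rewrite big_nil.
have A1 := circle_alg_inv_linear (Hr x (mem_head _ _)).
have A2 : circle_alg (fun z => \prod_(x <- r) (z - x)^-1).
  by apply: IH => y yr; apply: Hr; rewrite inE yr orbT.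
by apply: eq_circle_alg (circle_algM A1 A2) => z _; rewrite big_cons.
Qed.

(** A polynomial close to s has no zero in the closed disc, and its inverse is
    close to that of s. *)
Lemma circle_alg_inv s (d : R) : circle_alg s -> 0 < d ->
  (forall w, normc w < 1 -> d <= normc (gelfand s w)) -> circle_alg (fun z => (s z)^-1).
Proof.
move=> As d0 Hd; have Hs := circle_alg_boundary_lower As Hd.
move=> eps eps0; pose t := Num.min (d / 2) (eps / 2 * (d * (d / 2))).
have t0 : 0 < t by rewrite lt_min divr_gt0//= !mulr_gt0// divr_gt0.
have td : t <= d / 2 by rewrite ge_min lexx.
have te : t <= eps / 2 * (d * (d / 2)) by rewrite ge_min lexx orbT.
have [p Hp] := As _ t0.
have lowC z : normc z = 1 -> d / 2 <= normc p.[z].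
  by move=> z1; have := Hs z z1; have := Hp z z1; have := le_normc_sub (s z) p.[z];
    have := le_normc_sub (s z) (s z - p.[z]); rewrite subKr; lra.
have lowD z : normc z < 1 -> d / 2 <= normc p.[z].
  move=> z1; have Asp : circle_alg (fun z => s z - p.[z]).
    by apply: circle_algB => //; exact: circle_alg_horner.
  have := gelfand_le Asp Hp z1; rewrite gelfandB//; [|exact: circle_alg_cint..|];
    last by apply: ccont_int; exact: ccont_horner.
  rewrite gelfand_horner// => h.
  have := Hd z z1; have := le_normc_sub (gelfand s z) (gelfand s z - p.[z]); rewrite subKr; lra.
have d2 : 0 < d / 2 by rewrite divr_gt0.
have low z : normc z <= 1 -> p.[z] != 0.
  rewrite le_eqVlt -normc_gt0 => /orP[/eqP/lowC|/lowD]; exact: lt_le_trans.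
have p0 : p != 0.
  apply/eqP => pz; have := low 0; rewrite pz horner0 eqxx normc0 ler01.
  by move=> /(_ isT).
have eps2 : 0 < eps / 2 by rewrite divr_gt0.
have [r Hr] := circle_alg_inv_poly p0 low eps2.
exists r => z z1; apply: (le_trans (le_normc_trans _ p.[z]^-1 _)).
have s0 : s z != 0 by rewrite -normc_gt0 (lt_le_trans d0)// Hs.
have pz0 : p.[z] != 0 by apply: low; rewrite z1.
have -> : (s z)^-1 - p.[z]^-1 = (p.[z] - s z) / (s z * p.[z]) by field; rewrite s0 pz0.
have : normc ((p.[z] - s z) / (s z * p.[z])) <= eps / 2.
  rewrite normcM normcV normcM ler_pdivrMr; last by rewrite mulr_gt0// normc_gt0.
  rewrite normcB; apply: (le_trans (Hp z z1)); apply: (le_trans te).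
  rewrite ler_pM2l//; apply: ler_pM; rewrite ?(ltW d0) ?(ltW d2)//; [exact: Hs|exact: lowC].
have := Hr z z1; lra.
Qed.

End InverseClosed.

(** * The resolvent of the weighted composition operator *)

Section WeightedComposition.
Variable R : realType.
Local Notation "z ^*" := (conjc z) : ring_scope.
Implicit Types (z w c e mu : R[i]) (f g s h : R[i] -> R[i]).
Variables (phi : R[i] -> R[i]) (rho : disc_aut R).
Hypothesis Aphi : circle_alg phi.
Local Notation W := (weighted_composition phi rho).

(** Linearity is asked at every point and for all functions, so that operators add
    and compose without exceptional null sets. *)
Definition pointwise_bounded (S : (R[i] -> R[i]) -> R[i] -> R[i]) : Prop :=
  [/\ forall f, H2 f -> H2 (S f),
      forall a b f g z, S (fun z => a * f z + b * g z) z = a * S f z + b * S g z &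
      exists2 M : R, 0 <= M & forall f, H2 f -> L2_norm (S f) <= M * L2_norm f].

Lemma eq_circle_pointwise f g : (forall z, normc z = 1 -> f z = g z) -> eq_circle f g.
Proof. by move=> fg; apply: aeW => t _; apply: fg; exact: normc_expi. Qed.

Lemma pointwise_bounded_operator S : pointwise_bounded S -> bounded_operator S.
Proof.
move=> [H1 H2 [M _ HM]]; split => //; last by exists M.
move=> a f g _ _; apply: eq_circle_pointwise => z _.
have := H2 a 1 f g z; rewrite mul1r => <-; congr (S _ z).
by apply/funext => x; rewrite mul1r.
Qed.

Lemma pointwise_bounded_comp S T : pointwise_bounded S -> pointwise_bounded T ->
  pointwise_bounded (fun f => S (T f)).
Proof.
move=> [HS LS [M M0 BS]] [HT LT [N N0 BT]]; split.
- by move=> f Hf; apply: HS; exact: HT.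
- move=> a b f g z; rewrite -LS; congr (S _ z); apply/funext => x; exact: LT.
- exists (M * N) => [|f Hf]; first exact: mulr_ge0.
  by apply: (le_trans (BS _ (HT _ Hf))); rewrite -mulrA ler_wpM2l// BT.
Qed.

Lemma pointwise_bounded_id : pointwise_bounded (fun f => f).
Proof. by split => //; exists 1 => // f _; rewrite mul1r. Qed.

Lemma pointwise_boundedD S T c : pointwise_bounded S -> pointwise_bounded T ->
  pointwise_bounded (fun f z => c * S f z + T f z).
Proof.
move=> [HS LS [M M0 BS]] [HT LT [N N0 BT]]; split.
- by move=> f Hf; apply: H2D; [apply: H2Z; exact: HS|exact: HT].
- by move=> a b f g z; rewrite LS LT; ring.
exists (2 * (normc c * M + N)) => [|f Hf].
  by rewrite mulr_ge0// addr_ge0// mulr_ge0// normc_ge0.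
have [LcS NcS] := L2M (H2_L2 (HS _ Hf)) (cmeas_cst c) (normc_ge0 c) (fun _ _ => lexx _).
have [_] := L2D LcS (H2_L2 (HT _ Hf)); move/le_trans; apply.
rewrite -mulrA ler_wpM2l// mulrDl; apply: lerD; last exact: BT.
by apply: (le_trans NcS); rewrite -mulrA ler_wpM2l ?normc_ge0// BS.
Qed.

Lemma pointwise_boundedM s S : circle_alg s -> pointwise_bounded S ->
  pointwise_bounded (fun f z => s z * S f z).
Proof.
move=> As [HS LS [M M0 BS]]; have cs := circle_alg_ccont As.
have [B B0 HB] := ccont_bounded cs; split.
- by move=> f Hf; apply: H2M => //; exact: HS.
- by move=> a b f g z; rewrite LS; ring.
exists (B * M) => [|f Hf]; first exact: mulr_ge0.
have [_] := L2M (H2_L2 (HS _ Hf)) (ccont_meas cs) B0 HB; move/le_trans; apply.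
by rewrite -mulrA ler_wpM2l// BS.
Qed.

Lemma composition_bounded : pointwise_bounded (fun f z => f (rho z)).
Proof.
split => //; first by move=> f; exact: H2_aut.
exists (2 / (1 - normc (rho 0)) + 1).
  have : normc (rho 0) < 1 by apply: aut_lt1; rewrite normc0.
  by move=> r1; rewrite addr_ge0// divr_ge0// subr_ge0 ltW.
by move=> f /H2_L2/(L2_aut rho)[].
Qed.

Lemma weighted_composition_bounded : pointwise_bounded W.
Proof. exact: (pointwise_boundedM Aphi composition_bounded). Qed.

Lemma gelfand_weighted_composition f z : normc z < 1 -> H2 f ->
  gelfand (W f) z = gelfand phi z * gelfand f (rho z).
Proof.
move=> z1 Hf; rewrite (gelfandM (f := fun z => f (rho z)))//; last exact: H2_aut.
by rewrite gelfand_comp_aut.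
Qed.

Lemma iter_bounded n : pointwise_bounded (iter n W).
Proof.
elim: n => [|n IH]; first exact: pointwise_bounded_id.
exact: pointwise_bounded_comp weighted_composition_bounded IH.
Qed.

Definition orbit_prod n z := \prod_(k < n) phi (iter k rho z).

Lemma iter_weighted_composition n f z : iter n W f z = orbit_prod n z * f (iter n rho z).
Proof.
elim: n z => [|n IH] z; first by rewrite /orbit_prod big_ord0 mul1r.
rewrite iterS /weighted_composition IH -iterSr mulrA /orbit_prod big_ord_recl.
by congr (_ * _ * _); apply: eq_bigr => k _; rewrite lift0 iterSr.
Qed.

Lemma iter_circle_alg k : circle_alg (fun z => phi (iter k rho z)) /\
  forall w, normc w < 1 -> gelfand (fun z => phi (iter k rho z)) w = gelfand phi (iter k rho w).
Proof.
elim: k => [|k [IH1 IH2]]; first by [].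
have [A1 A2] := circle_alg_comp_aut rho IH1.
have E z : normc z = 1 -> phi (iter k rho (rho z)) = phi (iter k.+1 rho z) by rewrite iterSr.
split; first exact: eq_circle_alg E A1.
move=> w w1; rewrite -(eq_gelfand w E) A2// IH2 ?iterSr//.
exact: aut_lt1.
Qed.

Lemma orbit_prod_circle_alg n : circle_alg (orbit_prod n) /\
  forall w, normc w < 1 -> gelfand (orbit_prod n) w = \prod_(k < n) gelfand phi (iter k rho w).
Proof.
elim: n => [|n [IH1 IH2]].
  have E z : normc z = 1 -> 1 = orbit_prod 0 z by rewrite /orbit_prod big_ord0.
  split; first exact: eq_circle_alg E (circle_alg_cst 1).
  by move=> w w1; rewrite -(eq_gelfand w E) gelfand_cst// big_ord0.
have [A1 A2] := iter_circle_alg n.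
have E z : normc z = 1 -> orbit_prod n z * phi (iter n rho z) = orbit_prod n.+1 z.
  by rewrite /orbit_prod big_ord_recr.
split; first exact: eq_circle_alg E (circle_algM IH1 A1).
move=> w w1; rewrite -(eq_gelfand w E) gelfandM//; last exact: circle_alg_H2.
by rewrite IH2// A2// big_ord_recr.
Qed.

(** The quotient of mu^n - x^n by mu - x, at x = W. *)
Fixpoint resolvent_sum mu n f : R[i] -> R[i] :=
  if n is m.+1 then fun z => mu * resolvent_sum mu m f z + iter m W f z else fun=> 0.

Lemma resolvent_sum_bounded mu n : pointwise_bounded (resolvent_sum mu n).
Proof.
elim: n => [|n IH]; last exact: pointwise_boundedD IH (iter_bounded n).
split=> /=; [by move=> f _; exact: H2_cst|by move=> a b f g z; rewrite !mulr0 addr0|].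
exists 0 => // f _; rewrite mul0r L2_normE (eq_rmean (v := fun=> 0)) ?rmean_cst ?sqrtr0//.
by move=> z _; rewrite normc0 expr0n.
Qed.

Lemma resolvent_sum_left mu n f z :
  resolvent_sum mu n (fun z => mu * f z - W f z) z = mu ^+ n * f z - iter n W f z.
Proof.
elim: n => [|n IH] /=; first by rewrite mul1r subrr.
have [_ L _] := iter_bounded n.
have -> : iter n W (fun z => mu * f z - W f z) z = mu * iter n W f z - iter n W (W f) z.
  rewrite -[RHS]/(_ + - _) -[- iter n W (W f) z]mulN1r -L; congr (iter n W _ z).
  by apply/funext => x; rewrite mulN1r.
by rewrite IH -[iter n W (W f)]iterSr iterS exprS; ring.
Qed.

Lemma resolvent_sum_right mu n f z :
  mu * resolvent_sum mu n f z - W (resolvent_sum mu n f) z = mu ^+ n * f z - iter n W f z.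
Proof.
elim: n z => [|n IH] z /=; first by rewrite /weighted_composition expr0; ring.
have IHz := IH z.
have -> : W (fun z => mu * resolvent_sum mu n f z + iter n W f z) z =
    mu * W (resolvent_sum mu n f) z + W (iter n W f) z by rewrite /weighted_composition; ring.
rewrite exprS -mulrA.
have -> : mu ^+ n * f z = mu * resolvent_sum mu n f z - W (resolvent_sum mu n f) z + iter n W f z.
  by rewrite IHz subrK.
ring.
Qed.

(** When the n-th iterate of rho is the identity, W^n is multiplication by the
    product of phi along an orbit, which is rho-invariant; so the inverse of
    mu^n - W^n commutes with W and provides the resolvent. *)
Lemma resolvent_exists mu n (d : R) : 0 < d -> (forall z, normc z = 1 -> iter n rho z = z) ->
  (forall w, normc w < 1 -> d <= normc (mu ^+ n - gelfand (orbit_prod n) w)) ->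
  exists S, [/\ bounded_operator S,
    forall f, H2 f -> eq_circle (S (fun z => mu * f z - W f z)) f &
    forall f, H2 f -> eq_circle (fun z => mu * S f z - W (S f) z) f].
Proof.
move=> d0 per Hd; have [Ap Gp] := orbit_prod_circle_alg n.
have As : circle_alg (fun z => mu ^+ n - orbit_prod n z).
  by apply: circle_algB => //; exact: circle_alg_cst.
have Hs w : normc w < 1 -> d <= normc (gelfand (fun z => mu ^+ n - orbit_prod n z) w).
  move=> w1; rewrite gelfandB ?gelfand_cst//; [exact: Hd|exact: cint_cst|exact: circle_alg_cint].
have Ah := circle_alg_inv As d0 Hs.
have s0 z : normc z = 1 -> mu ^+ n - orbit_prod n z != 0.
  move=> z1; rewrite -normc_gt0; apply: (lt_le_trans d0).
  exact: (circle_alg_boundary_lower As Hs z1).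
have inv z : normc z = 1 -> orbit_prod n (rho z) = orbit_prod n z.
  case: n per {Hd Ap Gp As Hs Ah s0} => [|n] per z1; first by rewrite /orbit_prod !big_ord0.
  rewrite /orbit_prod big_ord_recr [RHS]big_ord_recl /= -iterSr per// mulrC.
  by congr (_ * _); apply: eq_bigr => k _; rewrite -iterSr.
exists (fun f z => (mu ^+ n - orbit_prod n z)^-1 * resolvent_sum mu n f z); split.
- apply: pointwise_bounded_operator; apply: pointwise_boundedM => //.
  exact: resolvent_sum_bounded.
- move=> f _; apply: eq_circle_pointwise => z z1.
  rewrite resolvent_sum_left iter_weighted_composition per// -mulrBl mulrA mulVf ?mul1r//.
  exact: s0.
- move=> f _; apply: eq_circle_pointwise => z z1; rewrite {1}/weighted_composition inv//.
  have := resolvent_sum_right mu n f z.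
  rewrite iter_weighted_composition per// -mulrBl /weighted_composition => E.
  have k0 := s0 z z1; move: E k0.
  move: (mu ^+ n - _) (resolvent_sum _ _ _) => k T E k0.
  have -> : mu * (k^-1 * T z) - phi z * (k^-1 * T (rho z)) =
    k^-1 * (mu * T z - phi z * T (rho z)) by ring.
  by rewrite E mulrA mulVf ?mul1r.
Qed.

End WeightedComposition.

(** * Eigenfunctionals supported on an orbit *)

Lemma big_ord_rot (T : Type) (idx : T) (op : Monoid.com_law idx) q (b : nat -> T) :
  b q = b 0%N -> \big[op/idx]_(k < q) b k.+1 = \big[op/idx]_(k < q) b k.
Proof.
case: q => [|n] bq; first by rewrite !big_ord0.
by rewrite big_ord_recr [RHS]big_ord_recl /= bq Monoid.mulmC.
Qed.

Section Eigenfunctional.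
Variable R : realType.
Local Notation "z ^*" := (conjc z) : ring_scope.
Implicit Types (z w e mu nu : R[i]) (f g h : R[i] -> R[i]) (c : nat -> R[i]).
Variables (phi : R[i] -> R[i]) (rho : disc_aut R).
Hypothesis Aphi : circle_alg phi.
Local Notation W := (weighted_composition phi rho).

Lemma eq_circle_cmean (k : R[i] -> R[i]) f g : cmeas f -> cmeas g -> cmeas k -> eq_circle f g ->
  cmean (fun e => k e * f e) = cmean (fun e => k e * g e).
Proof.
move=> mf mg mk fg.
have [a1 a2] := cmeasM mk mf; have [b1 b2] := cmeasM mk mg.
have ae (p : R[i] -> R) : rmeas (fun e => p (k e * f e)) -> rmeas (fun e => p (k e * g e)) ->
    rmean (fun e => p (k e * f e)) = rmean (fun e => p (k e * g e)).
  move=> m1 m2; rewrite /rmean /Rintegral; congr (_ * fine _).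
  apply: ae_eq_integral => //; [exact: measurable_angles|exact/measurable_EFinP..|].
  move: fg => [N [mN N0 sub]]; exists N; split => //; apply: subset_trans sub.
  by move=> t /= ne eqfg; apply: ne => Dt; rewrite /= eqfg.
by apply: complex_eqP; rewrite ?Re_cmean ?Im_cmean; exact: ae.
Qed.

Lemma eq_circle_gelfand f g z : normc z < 1 -> H2 f -> H2 g -> eq_circle f g ->
  gelfand f z = gelfand g z.
Proof.
move=> z1 /H2_cint/cint_meas mf /H2_cint/cint_meas mg fg; rewrite !gelfandE.
apply: eq_circle_cmean => //; apply: ccont_meas.
by apply: kernel_ccont => //; [exact: ccont_conj|exact: normcJ_circle].
Qed.

Definition point_functional (q : nat) c (w : nat -> R[i]) f := \sum_(k < q) c k * gelfand f (w k).

Section Points.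
Variables (q : nat) (c : nat -> R[i]) (w : nat -> R[i]).
Hypothesis w1 : forall k, normc (w k) < 1.
Local Notation L := (point_functional q c w).

Lemma point_functional_linear a b f g : H2 f -> H2 g ->
  L (fun z => a * f z + b * g z) = a * L f + b * L g.
Proof.
move=> Hf Hg; rewrite /point_functional !mulr_sumr -big_split; apply: eq_bigr => k _ /=.
have [If Ig] := (H2_cint Hf, H2_cint Hg).
rewrite gelfandD//; [|exact: cintZ..].
by rewrite !gelfandZ//; ring.
Qed.

Lemma point_functional_ae f g : H2 f -> H2 g -> eq_circle f g -> L f = L g.
Proof.
by move=> Hf Hg fg; apply: eq_bigr => k _; rewrite (eq_circle_gelfand (w1 k) Hf Hg fg).
Qed.

Lemma point_functional_bounded :
  exists2 B : R, 0 <= B & forall f, H2 f -> normc (L f) <= B * L2_norm f.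
Proof.
have d0 k : 0 <= (1 - normc (w k))^-1 by rewrite invr_ge0 subr_ge0 ltW.
exists (\sum_(k < q) normc (c k) * (1 - normc (w k))^-1).
  by apply: sumr_ge0 => k _; rewrite mulr_ge0// normc_ge0.
move=> f Hf; rewrite /point_functional mulr_suml.
have tri : normc (\sum_(k < q) c k * gelfand f (w k)) <= \sum_(k < q) normc (c k * gelfand f (w k)).
  elim/big_ind2: _ => [|x1 x2 y1 y2 h1 h2|//]; first by rewrite normc0.
  by apply: (le_trans (le_normcD _ _)); exact: lerD.
apply: (le_trans tri); apply: ler_sum => k _; rewrite normcM -mulrA ler_wpM2l ?normc_ge0//.
apply: (le_trans (gelfand_bound (w1 k) (H2_cint Hf))).
by rewrite ler_wpM2l// rmean_normc_le_L2//; exact: H2_L2.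
Qed.

(** Lagrange interpolation separates the points. *)
Lemma point_functional_neq0 (k : 'I_q) : c k != 0 ->
  (forall i j, (i < q)%N -> (j < q)%N -> w i = w j -> i = j) -> exists2 g, H2 g & L g != 0.
Proof.
move=> ck winj; pose p := \prod_(j < q | j != k) ('X - (w j)%:P).
exists (fun z => p.[z]); first by apply: circle_alg_H2; exact: circle_alg_horner.
rewrite /point_functional (bigD1 k)//= [X in _ + X]big1 => [|j jk].
  rewrite addr0 gelfand_horner// mulf_neq0// horner_prod; apply/prodf_neq0 => j jk.
  rewrite hornerXsubC subr_eq0; apply/eqP => E; case/eqP: jk; apply: val_inj.
  by apply: (winj _ _ (ltn_ord j) (ltn_ord k)).
by rewrite gelfand_horner// horner_prod (bigD1 j)//= hornerXsubC subrr mul0r mulr0.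
Qed.

End Points.

(** The eigenvectors of the adjoint of a weighted cyclic shift: with the weights
    m_k along a cycle of length q, whose product is mu^q, take partial products
    of m_k / mu if mu is nonzero, and a point of zero weight otherwise. *)
Lemma cyclic_eigenvector q (m : nat -> R[i]) mu : (0 < q)%N -> mu ^+ q = \prod_(k < q) m k ->
  exists c, (exists k : 'I_q, c k != 0) /\
  forall v : nat -> R[i], v q = v 0%N ->
    \sum_(k < q) c k * (m k * v k.+1) = mu * \sum_(k < q) c k * v k.
Proof.
move=> q0 Em; have [mu0|mu0] := eqVneq mu 0.
  have : \prod_(k < q) m k == 0 by rewrite -Em mu0 expr0n gtn_eqF.
  rewrite prodf_seq_eq0 => /hasP[k _ /= /eqP mk].
  exists (fun j => (j == k :> nat)%:R); split; first by exists k; rewrite eqxx oner_eq0.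
  move=> v _; rewrite mu0 mul0r big1// => j _.
  have [E|] := eqVneq (j : nat) k; last by rewrite mul0r.
  by rewrite (val_inj E) mk mul0r mulr0.
pose c (k : nat) := mu ^- k * \prod_(j < k) m j.
have c0 : c 0%N = 1 by rewrite /c expr0 invr1 big_ord0 mul1r.
have cq : c q = 1 by rewrite /c -Em mulVf// expf_neq0.
have cS k : c k * m k = mu * c k.+1.
  rewrite /c big_ord_recr /= exprS invfM.
  have -> : mu * (mu^-1 * mu ^- k * (\prod_(j < k) m j * m k)) =
    (mu / mu) * (mu ^- k * (\prod_(j < k) m j * m k)) by ring.
  by rewrite divff// mul1r mulrA.
exists c; split; first by exists (Ordinal q0); rewrite c0 oner_eq0.
move=> v vq; transitivity (mu * \sum_(k < q) c k.+1 * v k.+1).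
  by rewrite mulr_sumr; apply: eq_bigr => k _; rewrite mulrA cS -mulrA.
congr (_ * _).
have bq : (fun k => c k * v k) q = (fun k => c k * v k) 0%N by rewrite /= c0 cq vq.
exact: (@big_ord_rot _ _ _ q (fun k => c k * v k) bq).
Qed.

(** If mu were in the resolvent set, an eigenfunctional for a nearby mu' would
    satisfy L g = (mu - mu')^n L (S^n g) for all n, and vanish. *)
Lemma eigenfunctional_spectrum q c (w : nat -> R[i]) mu mu' (M : R) S :
  (forall k, normc (w k) < 1) ->
  (forall f, H2 f -> point_functional q c w (W f) = mu' * point_functional q c w f) ->
  (exists2 g, H2 g & point_functional q c w g != 0) ->
  (forall f, H2 f -> H2 (S f)) ->
  (forall f, H2 f -> L2_norm (S f) <= M * L2_norm f) ->
  (forall f, H2 f -> eq_circle (fun z => mu * S f z - W (S f) z) f) ->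
  0 <= M -> normc (mu - mu') * M <= 2^-1 -> False.
Proof.
move=> w1 HL [g Hg /eqP Lg0] HS BS ES M0 small; apply: Lg0.
set L := point_functional q c w in HL *.
have [HW _ _] := weighted_composition_bounded rho Aphi.
have step f : H2 f -> L f = (mu - mu') * L (S f).
  move=> Hf; have HSf := HS _ Hf; have HWSf := HW _ HSf.
  have E z : normc z = 1 -> mu * S f z + (-1) * W (S f) z = mu * S f z - W (S f) z.
    by rewrite mulN1r.
  have HE : H2 (fun z => mu * S f z + (-1) * W (S f) z) by apply: H2D; exact: H2Z.
  have EE : eq_circle (fun z => mu * S f z + (-1) * W (S f) z) f.
    have := ES _ Hf; congr (eq_circle _ f); apply/funext => z; by rewrite mulN1r.
  rewrite /L -(point_functional_ae q c w1 HE Hf EE) point_functional_linear// -/L HL//.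
  by ring.
have iterS_H2 n : H2 (iter n S g) by elim: n => // n IH; exact: HS.
have iter_norm n : L2_norm (iter n S g) <= M ^+ n * L2_norm g.
  elim: n => [|n IH]; first by rewrite mul1r.
  by apply: (le_trans (BS _ (iterS_H2 n))); rewrite exprS -mulrA ler_wpM2l.
have iterL n : L g = (mu - mu') ^+ n * L (iter n S g).
  elim: n => [|n IH]; first by rewrite mul1r.
  by rewrite IH (step _ (iterS_H2 n)) exprSr mulrA.
have [B B0 HB] := point_functional_bounded q c w1.
apply: (@normc_le_geom0 _ _ 2^-1 (B * L2_norm g)); first by apply/andP; split; lra.
move=> n; rewrite (iterL n) normcM normcX.
have hB : normc (L (iter n S g)) <= M ^+ n * (B * L2_norm g).
  apply: (le_trans (HB _ (iterS_H2 n))).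
  by rewrite mulrCA ler_wpM2l.
apply: (@le_trans _ _ (normc (mu - mu') ^+ n * (M ^+ n * (B * L2_norm g)))).
  by rewrite ler_wpM2l// exprn_ge0// normc_ge0.
rewrite [leLHS]mulrA -exprMn ler_wpM2r//.
  by rewrite mulr_ge0// L2_norm_ge0.
by apply: lerXn2r => //; rewrite nnegrE ?invr_ge0// mulr_ge0// normc_ge0.
Qed.

(** The distances from mu to the q-th roots of nu have product the modulus of
    mu ^+ q - nu. *)
Lemma nearby_root mu nu (q : nat) (eta : R) : (0 < q)%N -> 0 < eta ->
  normc (mu ^+ q - nu) < eta ^+ q -> exists2 x, x ^+ q = nu & normc (mu - x) < eta.
Proof.
move=> q0 eta0 near; have [r Er] := closed_field_poly_normal ('X^q - nu%:P).
rewrite lead_coefXnsubC// scale1r in Er.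
have sr : size r = q.
  by have := congr1 (fun p : {poly R[i]} => size p) Er; rewrite size_XnsubC// size_prod_XsubC => -[].
have [/hasP[x xr xe]|/hasPn H] := boolP (has (fun x => normc (mu - x) < eta) r).
  exists x => //; have : ('X^q - nu%:P).[x] = 0.
    by rewrite Er horner_prod (big_rem x xr)/= hornerXsubC subrr mul0r.
  by rewrite hornerD hornerN hornerXn hornerC => /eqP; rewrite subr_eq0 => /eqP.
have : eta ^+ size r <= normc (\prod_(x <- r) (mu - x)).
  elim: r H {Er sr} => [|x r IH] H; first by rewrite big_nil normc1.
  rewrite big_cons normcM exprS; apply: ler_pM; rewrite ?exprn_ge0 ?(ltW eta0)//.
    by rewrite leNgt; apply: H; rewrite mem_head.
  by apply: IH => y yr; apply: H; rewrite inE yr orbT.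
have -> : \prod_(x <- r) (mu - x) = ('X^q - nu%:P).[mu].
  by rewrite Er horner_prod; apply: eq_bigr => x _; rewrite hornerXsubC.
by rewrite hornerD hornerN hornerXn hornerC sr leNgt near.
Qed.

Lemma closure_normcP (A : set R[i]) z :
  closure A z <-> forall d : R, 0 < d -> exists2 x, A x & normc (x - z) < d.
Proof.
split=> [clA d d0|H B /nbhs_ballP[e /= e0 eB]].
  have [|x [Ax]] := clA (ball z d%:C); first by apply: nbhsx_ballx; rewrite ltcR.
  by rewrite -ball_normE /= normc_norm ltcR normcB => zx; exists x.
have eE : e = (Re e)%:C by rewrite RRe_real// gtr0_real.
have [|x Ax xz] := H (Re e); first by rewrite -ltcR -eE.
exists x; split => //; apply: eB; rewrite -ball_normE /= normc_norm eE ltcR.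
by rewrite normcB.
Qed.

End Eigenfunctional.

(** * The spectrum *)

Section Main.
Variable R : realType.
Local Notation "z ^*" := (conjc z) : ring_scope.
Implicit Types (z w mu : R[i]).

Lemma Hinfty_C1_circle_alg (phi : R[i] -> R[i]) : Hinfty phi -> C1_circle phi -> circle_alg phi.
Proof.
move=> [Hphi _] [[d1 _] [d2 _]]; apply/circle_algP; split; last by move=> n; exact: H2_moment.
by split => t; apply/differentiable_continuous/derivable1_diffP.
Qed.

Variables (phi : R[i] -> R[i]) (rho zeta : disc_aut R) (q : nat) (lambda : R[i]).
Hypotheses (Aphi : circle_alg phi) (lambda1 : normc lambda = 1) (q0 : (0 < q)%N).
Hypothesis lambdaq : q.-primitive_root lambda.
Hypothesis conj_rot : forall z, normc z < 1 -> zeta (rho (aut_inv zeta z)) = lambda * z.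
Local Notation zetaV := (aut_sym zeta).
Local Notation psi := (fun z : R[i] => \prod_(k < q) phi (aut_inv zeta (lambda^-1 ^+ k * z))).

Lemma lambdaX k : normc (lambda ^+ k) = 1.
Proof. by rewrite normcX lambda1 expr1n. Qed.

Lemma rho_zetaV z : normc z <= 1 -> rho (zetaV z) = zetaV (lambda * z).
Proof.
apply: (@closed_ucont_eq _ (fun z => rho (zetaV z)) (fun z => zetaV (lambda * z))).
- by apply: closed_ucont_comp; [exact: aut_ucont|exact: aut_ucont|exact: aut_le1].
- apply: closed_ucont_comp; first exact: aut_ucont.
    move=> eps eps0; exists eps => // u v _ _ uv.
    by rewrite -mulrBr normcM lambda1 mul1r.
  by move=> u; rewrite normcM lambda1 mul1r.
move=> w w1; rewrite -conj_rot//= aut_funK//; apply/unit_discE.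
by apply: aut_lt1; exact: (aut_lt1 zetaV).
Qed.

Lemma iter_rho_zetaV k z : normc z <= 1 -> iter k rho (zetaV z) = zetaV (lambda ^+ k * z).
Proof.
move=> z1; elim: k => [|k IH]; first by rewrite mul1r.
by rewrite iterS IH rho_zetaV ?exprS ?mulrA// normcM lambdaX mul1r.
Qed.

Lemma iter_rho_period z : normc z <= 1 -> iter q rho z = z.
Proof.
move=> z1; have -> : z = zetaV (zeta z) by rewrite /= aut_closedK.
by rewrite iter_rho_zetaV ?aut_le1// prim_expr_order// mul1r.
Qed.

(** The product along an orbit of the rotation by lambda is unchanged when the
    orbit is run through backwards. *)
Lemma psi_orbit_prod z : normc z = 1 -> psi z = orbit_prod phi rho q (zetaV z).
Proof.
move=> z1; rewrite /orbit_prod.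
have lu : lambda != 0 by rewrite -normc_gt0 lambda1.
pose b k := phi (zetaV (lambda ^+ k * z)).
transitivity (\prod_(k < q) b k.+1).
  rewrite (reindex_inj rev_ord_inj) /=; apply: eq_bigr => k _; rewrite /b /=.
  congr (phi (aut_inv zeta (_ * z))); rewrite exprVn.
  apply: (mulfI (expf_neq0 (q - k.+1) lu)); rewrite divff ?expf_neq0// -exprD subnK//.
  by rewrite prim_expr_order.
have bq : b q = b 0%N by rewrite /b prim_expr_order// expr0.
transitivity (\prod_(k < q) b k); last first.
  by apply: eq_bigr => k _; rewrite iter_rho_zetaV// z1.
exact: big_ord_rot.
Qed.

Lemma psi_circle_alg : circle_alg psi.
Proof.
have [Ap _] := orbit_prod_circle_alg rho Aphi q.
have [Az _] := circle_alg_comp_aut zetaV Ap.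
by apply: eq_circle_alg Az => z z1; rewrite psi_orbit_prod.
Qed.

Lemma gelfand_psi w : normc w < 1 -> gelfand psi w = gelfand (orbit_prod phi rho q) (zetaV w).
Proof.
move=> w1; have [Ap _] := orbit_prod_circle_alg rho Aphi q.
have [_ <-//] := circle_alg_comp_aut zetaV Ap.
by apply: eq_gelfand => z; exact: psi_orbit_prod.
Qed.

Lemma resolvent_outside mu : ~ closure (gelfand psi @` @unit_disc R) (mu ^+ q) ->
  ~ spectrum (weighted_composition phi rho) mu.
Proof.
move=> ncl; apply; have [d [d0 Hd]] : exists d : R, 0 < d /\
    forall w, normc w < 1 -> d <= normc (gelfand psi w - mu ^+ q).
  apply: contrapT => no; apply: ncl; apply/closure_normcP => d d0.
  apply: contrapT => nx; apply: no; exists d; split => // w w1.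
  rewrite leNgt; apply/negP => lt; apply: nx; exists (gelfand psi w) => //.
  by exists w => //; apply/unit_discE.
apply: (@resolvent_exists _ phi rho Aphi mu q d d0) => [z z1|w w1]; first by rewrite iter_rho_period ?z1.
have zw1 : normc (zeta w) < 1 by exact: aut_lt1.
have := Hd _ zw1; rewrite normcB gelfand_psi// /= aut_closedK//.
exact: ltW.
Qed.

(** The rotations of the centre coincide; continuity moves the point away from
    it. *)
Lemma closure_off_centre nu (d : R) : closure (gelfand psi @` @unit_disc R) nu -> 0 < d ->
  exists a, [/\ a != 0, normc a < 1 & normc (gelfand psi a - nu) < d].
Proof.
move=> /closure_normcP cl d0; have d2 : 0 < d / 2 by rewrite divr_gt0.
have [_ [a /unit_discE a1 <-] ad] := cl _ d2.
have [a0|a0] := eqVneq a 0; last by exists a; split => //; lra.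
have iP : cint psi := circle_alg_cint psi_circle_alg.
pose m := rmean (fun z => normc (psi z)).
have m0 : 0 <= m by apply: rmean_ge0 => z _; exact: normc_ge0.
have m1 : 0 < 2 * m + 1 by rewrite ltr_wpDl// mulr_ge0.
pose r := Num.min 2^-1 (d / 2 / (2 * m + 1)).
have r0 : 0 < r by rewrite lt_min invr_gt0 ltr0n /= divr_gt0.
have nr : normc r%:C = r by rewrite normc_real gtr0_norm.
have r2 : normc r%:C <= 2^-1 by rewrite nr ge_min lexx.
exists r%:C; split; first by rewrite -normc_gt0 nr.
  by apply: (le_lt_trans r2); lra.
have := gelfand_near0 r2 iP; rewrite -/m nr => h.
apply: (le_lt_trans (le_normc_trans _ (gelfand psi 0) _)).
have rm : r * (2 * m) <= d / 2.
  have : r * (2 * m + 1) <= d / 2 by rewrite -ler_pdivlMr// ge_min lexx orbT.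
  by rewrite mulrDr mulr1; lra.
by move: ad; rewrite a0; lra.
Qed.

Lemma closure_in_spectrum mu : closure (gelfand psi @` @unit_disc R) (mu ^+ q) ->
  spectrum (weighted_composition phi rho) mu.
Proof.
move=> cl [S [[HS _ [M HM]] _ ES]].
pose M1 := `|M| + 1; have M1_gt0 : 0 < M1 by rewrite ltr_wpDl.
have HM1 f : H2 f -> L2_norm (S f) <= M1 * L2_norm f.
  move=> /HM/le_trans; apply; rewrite ler_wpM2r ?L2_norm_ge0//.
  by apply: (le_trans (ler_norm M)); rewrite lerDl.
pose eta := (2 * M1)^-1; have eta0 : 0 < eta by rewrite invr_gt0 mulr_gt0.
have etaq : 0 < eta ^+ q by rewrite exprn_gt0.
have [a [a0 a1 ad]] := closure_off_centre cl etaq.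
rewrite normcB in ad; have [mu' Emu' near] := nearby_root q0 eta0 ad.
pose w k := iter k rho (zetaV a).
have wE k : w k = zetaV (lambda ^+ k * a) by rewrite /w iter_rho_zetaV// ltW.
have ra1 k : normc (lambda ^+ k * a) < 1 by rewrite normcM lambdaX mul1r.
have w1 k : normc (w k) < 1 by rewrite wE; exact: aut_lt1.
have Em : mu' ^+ q = \prod_(k < q) gelfand phi (w k).
  rewrite Emu' gelfand_psi//; have [_ ->//] := orbit_prod_circle_alg rho Aphi q.
  exact: aut_lt1.
have wq : w q = w 0%N by rewrite !wE prim_expr_order// expr0.
have [c [[k ck] Hc]] := @cyclic_eigenvector R q (fun k => gelfand phi (w k)) mu' q0 Em.
have winj i j : (i < q)%N -> (j < q)%N -> w i = w j -> i = j.
  move=> iq jq; rewrite !wE => /(congr1 zeta); rewrite /= !aut_invK; [|exact/unit_discE..].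
  move=> /(mulIf a0) /eqP; rewrite (eq_prim_root_expr lambdaq) !modn_small//.
  by move=> /eqP.
apply: (@eigenfunctional_spectrum R phi rho Aphi q c w mu mu' M1 S) => //.
- move=> f Hf; rewrite /point_functional -(Hc (fun k => gelfand f (w k))) ?wq//.
  by apply: eq_bigr => j _; rewrite gelfand_weighted_composition.
- exact: point_functional_neq0 ck winj.
- exact: ltW.
- apply: (@le_trans _ _ (eta * M1)); first by rewrite ler_wpM2r// ltW.
  by rewrite /eta invfM -mulrA mulVf ?mulr1// gt_eqF.
Qed.

End Main.

Theorem theorem3p2 (R : realType) (phi : R[i] -> R[i]) (rho zeta : disc_aut R)
    (q : nat) (lambda : R[i]) :
  Hinfty phi -> C1_circle phi ->
  elliptic rho -> aut_order rho q ->
  `|lambda| = 1 -> q.-primitive_root lambda ->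
  (forall z, unit_disc z -> zeta (rho (aut_inv zeta z)) = lambda * z) ->
  let taubar := fun z : R[i] => lambda^* * z in
  let psi := fun z : R[i] =>
    \prod_(k < q) phi (aut_inv zeta (iter k taubar z)) in
  spectrum (weighted_composition phi rho) =
    [set mu : R[i] | closure (gelfand psi @` @unit_disc R) (mu ^+ q)].
Proof.
move=> Hphi C1phi _ _ l1 lq conj_rot taubar psi.
have lambda1 : normc lambda = 1 by have := congr1 (@complex.Re R) l1.
have q0 := prim_order_gt0 lq.
have Aphi := Hinfty_C1_circle_alg Hphi C1phi.
have rot z : normc z < 1 -> zeta (rho (aut_inv zeta z)) = lambda * z.
  by move=> /unit_discE; exact: conj_rot.
have lambdaJ : Num.conj lambda = lambda^-1 := conjc_circle lambda1.
have iterE k z : iter k taubar z = lambda^-1 ^+ k * z.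
  elim: k => [|k IH]; first by rewrite mul1r.
  by rewrite iterS IH /taubar lambdaJ mulrA -exprS.
have psiE : psi = fun z => \prod_(k < q) phi (aut_inv zeta (lambda^-1 ^+ k * z)).
  by apply/funext => z; apply: eq_bigr => k _; rewrite iterE.
rewrite psiE; apply/seteqP; split => mu /= Hmu.
  by apply: contrapT => ncl; exact: (resolvent_outside Aphi lambda1 lq rot ncl Hmu).
exact: (closure_in_spectrum Aphi lambda1 q0 lq rot).
Qed.
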